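(* Let $H$ be a separable Hilbert space and $\mathcal A\subseteq\mathcal B(H)$ a semi-finite factor. For unit vectors $\psi,\varphi\in H$, the following are equivalent: (i) $\psi$ is approximately convertible to $\varphi$ via $\mathrm{LOCC}(\mathcal A)$; (ii) $\psi$ is approximately convertible to $\varphi$ via $\mathrm{LOCC}^r(\mathcal A)$; (iii) $\psi$ is approximately convertible to $\varphi$ via $\mathrm{LOCC}^l(\mathcal A)$.
   Context: Normal means weak*-continuous. Inner products are linear in the first argument. **LOCC maps.** Let $\mathcal A\subseteq\mathcal B(H)$ be a von Neumann algebra and $\mathcal B=\mathcal A'$ its commutant. For a von Neumann subalgebra $\mathcal C\subseteq \mathcal B(H)$, $\mathrm{CP}^\sigma_{\mathcal C}(\mathcal B(H))$ is the set of normal completely positive maps $\Phi:\mathcal B(H)\to\mathcal B(H)$ with $\Phi(axb)=a\Phi(x)b$ for all $a,b\in\mathcal C$, $x\in\mathcal B(H)$; $\mathrm{UCP}^\sigma_{\mathcal C}(\mathcal B(H))$ is the subset of unital ones. - A *one-way right local map* relative to $\mathcal A$ is a map $\Phi\circ\Psi$ with $\Phi\in\mathrm{UCP}^\sigma_{\mathcal A}(\mathcal B(H))$ and $\Psi\in\mathrm{CP}^\sigma_{\mathcal B}(\mathcal B(H))$; a *one-way left local map* is a map $\Phi\circ\Psi$ with $\Phi\in\mathrm{CP}^\sigma_{\mathcal A}(\mathcal B(H))$ and $\Psi\in\mathrm{UCP}^\sigma_{\mathcal B}(\mathcal B(H))$. - An *instrument* is a collection $\mathcal I=(\Theta_k)_{k\in\mathbb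 N}$ of normal completely positive maps on $\mathcal B(H)$ such that $\sum_k\Theta_k(x)$ converges weak* to a limit $\Theta_{\mathcal I}(x)$ for every $x\in\mathcal B(H)$, and $\Theta_{\mathcal I}$ is a normal unital completely positive map. Instruments differing only by a bijective relabelling of the index set are identified. - A *one-way right (left) instrument* relative to $\mathcal A$ is an instrument all of whose maps are one-way right (left) local maps relative to $\mathcal A$; a *one-way (local) instrument* is one which is either a one-way right or a one-way left instrument. - $\mathrm{LOCC}^r(\mathcal A)$ (resp. $\mathrm{LOCC}^l(\mathcal A)$) is the set of maps $\Theta_{\mathcal I}$ with $\mathcal I$ a one-way right (resp. left) instrument relative to $\mathcal A$. - An instrument $(\Gamma_j)_{j\in\mathbb N}$ is a *coarse-graining* of $(\Theta_k)_{k\in\mathbb N}$ if there is a partition $\mathbb N=\bigcup_j S_j$ with $\Gamma_j=\sum_{k\in S_j}\Theta_k$ (point-weak* convergent) for all $j$. - An instrument $\mathcal J$ is *linked* to $\mathcal I=(\Theta_k)_k$ if there are one-way instruments $(\Theta_{ki})_{i\in\mathbb N}$, $k\in\mathbb N$, relative to $\mathcal A$ such that $\mathcal J$ is a coarse-graining of $(\Theta_k\circ\Theta_{ki})_{i,k\in\mathbb N}$. - A normal unital completely positive map $\Theta$ on $\mathcal B(H)$ is in $\mathrm{LOCC}(\mathcal A)$ if there are instruments $\mathcal I_0,\dots,\mathcal I_n$ such that $\mathcal I_0$ is a one-way local instrument relative to $\mathcal A$, $\mathcal I_{l+1}$ is linked to $\mathcal I_l$ for $l=0,\dots,n-1$,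 and $\Theta=\Theta_{\mathcal I_n}$. **Convertibility.** For $\psi\in H$, $\omega_\psi(x)=(x\psi,\psi)$, $x\in\mathcal B(H)$; for a normal map $\Theta$ on $\mathcal B(H)$, $\Theta_*$ is its predual, $\Theta_*(\omega)=\omega\circ\Theta$ for $\omega\in\mathcal B(H)_*$. For a class $\mathcal L$ among $\mathrm{LOCC}(\mathcal A)$, $\mathrm{LOCC}^r(\mathcal A)$, $\mathrm{LOCC}^l(\mathcal A)$, a unit vector $\psi$ is *approximately convertible* to a unit vector $\varphi$ via $\mathcal L$ if for every $\varepsilon>0$ there is $\Theta\in\mathcal L$ with $\|\Theta_*(\omega_\psi)-\omega_\varphi\|<\varepsilon$. *)

(* Defs.v *)
From HB Require Import structures.
From mathcomp Require Import all_boot all_order all_algebra sesquilinear.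
From mathcomp Require Import complex.
From mathcomp Require Import all_classical all_reals all_analysis.

Set Implicit Arguments.
Unset Strict Implicit.
Unset Printing Implicit Defensive.

Import Order.TTheory GRing.Theory Num.Theory.
Import numFieldNormedType.Exports.

Local Open Scope classical_set_scope.
Local Open Scope complex_scope.
Local Open Scope ring_scope.

(* Forms in [{dot H for Num.conj}] are linear in their first argument and
   conjugate-linear in the second one. *)
HB.mixin Record isHilbert (R : realType) H & CompleteNormedModule R[i] H := {
  inner : {dot H for (@Num.conj R[i])} ;
  inner_norm : forall x : H, inner x x = `|x| ^+ 2
}.

#[short(type="hilbertType")]
HB.structure Definition Hilbert (R : realType) :=
  { H of CompleteNormedModule R[i] H & isHilbert R H }.

Definition separable_space (T : topologicalType) : Prop :=
  exists2 D : set T, countable D & dense D.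

(* The algebra B(H): its ring product is the composition of operators. *)
Section bounded_operators.
Context {R : realType} (H : hilbertType R).

Definition bop_pred : {pred H -> H} :=
  mem [set f : H -> H | linear f /\ continuous f].

Record bop := Bop { bop_fun :> H -> H; _ : bop_fun \in bop_pred }.

HB.instance Definition _ := [isSub for bop_fun].
HB.instance Definition _ := [Choice of bop by <:].

Lemma bop_submod_closed : submod_closed bop_pred.
Proof.
split.
  rewrite inE; split; last by move=> x; exact: cvg_cst.
  by move=> a u v; rewrite /= scaler0 addr0.
move=> a f g; rewrite !inE => -[fl fc] [gl gc]; split.
  by move=> b u v; rewrite !fctE /= fl gl !scalerDr !scalerA mulrC addrACA.
move=> x; apply: (@continuousD _ _ _ (a \*: f) g); last exact: gc.
by apply: cvgZl_tmp; exact: fc.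
Qed.

HB.instance Definition _ :=
  GRing.isSubmodClosed.Build R[i] (H -> H) bop_pred bop_submod_closed.
HB.instance Definition _ := [SubChoice_isSubLmodule of bop by <:].

Lemma bop_linear (x : bop) : linear x.
Proof. by case: x => f /=; rewrite inE => -[]. Qed.

Lemma bop_continuous (x : bop) : continuous x.
Proof. by case: x => f /=; rewrite inE => -[]. Qed.

Lemma bop_ext (x y : bop) : (forall u, x u = y u) -> x = y.
Proof. by move=> xy; apply: val_inj; apply/funext. Qed.

Lemma bop_one_subproof : idfun \in bop_pred.
Proof. by rewrite inE; split=> // x; exact: cvg_id. Qed.

Lemma bop_mul_subproof (x y : bop) : (x \o y) \in bop_pred.
Proof.
rewrite inE; split; first by move=> a u v; rewrite /= !bop_linear.
by move=> u; apply: continuous_comp; exact: bop_continuous.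
Qed.

Definition bop_one : bop := Bop bop_one_subproof.
Definition bop_mul (x y : bop) : bop := Bop (bop_mul_subproof x y).

Lemma bop_mulA : associative bop_mul.
Proof. by move=> x y z; exact: bop_ext. Qed.

Lemma bop_mul1l : left_id bop_one bop_mul.
Proof. by move=> x; exact: bop_ext. Qed.

Lemma bop_mul1r : right_id bop_one bop_mul.
Proof. by move=> x; exact: bop_ext. Qed.

Lemma bop_mulDl : left_distributive bop_mul +%R.
Proof. by move=> x y z; exact: bop_ext. Qed.

Lemma bop_mulDr : right_distributive bop_mul +%R.
Proof.
move=> x y z; apply: bop_ext => u /=.
by have := bop_linear x 1 (y u) (z u); rewrite !scale1r.
Qed.

HB.instance Definition _ := GRing.Zmodule_isPzRing.Build bop
  bop_mulA bop_mul1l bop_mul1r bop_mulDl bop_mulDr.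

End bounded_operators.

Section von_neumann_algebras.
Context {R : realType} {H : hilbertType R}.
Implicit Types (A : set (bop H)) (x y e f : bop H).

(* [adjoint x y] means y = x^*; such a y exists and is unique (Riesz). *)
Definition adjoint x y : Prop :=
  forall xi eta : H, inner (x xi) eta = inner xi (y eta).

Definition commutant A : set (bop H) :=
  [set x | forall a, A a -> a * x = x * a].

(* Self-adjoint sets equal to their bicommutant: a bicommutant is
   automatically a unital subalgebra. *)
Definition von_neumann A : Prop :=
  (forall x y, A x -> adjoint x y -> A y) /\ commutant (commutant A) = A.

Definition vn_center A : set (bop H) := A `&` commutant A.

Definition is_factor A : Prop :=
  von_neumann A /\ vn_center A = [set c *: (1 : bop H) | c in [set: R[i]]].

Definition projection e : Prop := e * e = e /\ adjoint e e.

Definition proj_le e f : Prop := f * e = e.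

(* Murray-von Neumann equivalence: v^* v = e and v v^* = f. *)
Definition mvn_equiv A e f : Prop :=
  exists v w, [/\ A v, adjoint v w, w * v = e & v * w = f].

Definition finite_projection A e : Prop :=
  [/\ A e, projection e & forall f, A f -> projection f ->
    proj_le f e -> mvn_equiv A e f -> f = e].

Definition is_semifinite A : Prop :=
  forall z, vn_center A z -> projection z -> z != 0 ->
  exists e, [/\ finite_projection A e, e != 0 & proj_le e z].

End von_neumann_algebras.

Section weak_star_topology.
Context {R : realType} (H : hilbertType R).

Definition square_summable (xi : nat -> H) : Prop :=
  cvgn (series (fun n => `|xi n| ^+ 2) : nat -> R[i]^o).

(* B(H)_*, as the functionals induced by the trace-class operators
   \sum_n (. , eta_n) xi_n. *)
Definition predual_functional (omega : bop H -> R[i]) : Prop :=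
  exists xi eta : nat -> H, [/\ square_summable xi, square_summable eta &
    forall x : bop H,
      (series (fun n => inner (x (xi n)) (eta n)) : nat -> R[i]^o) @ \oo
        --> (omega x : R[i]^o)].

Definition predual : Type :=
  {omega : bop H -> R[i] | predual_functional omega}.

Definition weakstar : topologicalType :=
  sup_topology (fun omega : predual =>
    Topological.class (initial_topology (sval omega : bop H -> R[i]^o))).

End weak_star_topology.

Section maps.
Context {R : realType} {H : hilbertType R}.
Implicit Types (A C : set (bop H)) (Phi Psi Theta : bop H -> bop H).

Definition normal_map Phi : Prop := continuous (Phi : weakstar H -> weakstar H).

(* Positivity in M_n(B(H)) = B(H^n). *)
Definition mx_positive n (x : 'M[bop H]_n) : Prop :=
  forall xi : 'I_n -> H, 0 <= \sum_i \sum_j inner (x i j (xi j)) (xi i).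

Definition completely_positive Phi : Prop :=
  forall n (x : 'M[bop H]_n), mx_positive x -> mx_positive (map_mx Phi x).

Definition normal_cp : set (bop H -> bop H) :=
  [set Phi | [/\ linear Phi, normal_map Phi & completely_positive Phi]].

Definition normal_ucp : set (bop H -> bop H) :=
  [set Phi | normal_cp Phi /\ Phi 1 = 1].

Definition bimodule_map C Phi : Prop :=
  forall a b x, C a -> C b -> Phi (a * x * b) = a * Phi x * b.

Definition CP C : set (bop H -> bop H) := normal_cp `&` bimodule_map C.

Definition UCP C : set (bop H -> bop H) := normal_ucp `&` bimodule_map C.

Definition right_local A : set (bop H -> bop H) :=
  [set Theta | exists Phi Psi,
    [/\ UCP A Phi, CP (commutant A) Psi & Theta = Phi \o Psi]].

Definition left_local A : set (bop H -> bop H) :=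
  [set Theta | exists Phi Psi,
    [/\ CP A Phi, UCP (commutant A) Psi & Theta = Phi \o Psi]].

End maps.

Section instruments.
Context {R : realType} {H : hilbertType R}.
Implicit Types (A : set (bop H)) (T : bop H -> bop H).
Implicit Types (I J : nat -> bop H -> bop H).

(* T is the point-weak* sum of the maps I k, for k in S. *)
Definition point_sum (S : set nat) I T : Prop :=
  forall x, (fun n => \sum_(0 <= k < n | k \in S) I k x : weakstar H) @ \oo
    --> (T x : weakstar H).

Definition instrument_with_sum I T : Prop :=
  [/\ forall k, normal_cp (I k), point_sum [set: nat] I T & normal_ucp T].

Definition instrument I : Prop := exists T, instrument_with_sum I T.

Definition right_instrument A I : Prop :=
  instrument I /\ forall k, right_local A (I k).

Definition left_instrument A I : Prop :=
  instrument I /\ forall k, left_local A (I k).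

Definition one_way_instrument A I : Prop :=
  right_instrument A I \/ left_instrument A I.

Definition LOCCr A : set (bop H -> bop H) :=
  [set T | exists2 I, right_instrument A I & instrument_with_sum I T].

Definition LOCCl A : set (bop H -> bop H) :=
  [set T | exists2 I, left_instrument A I & instrument_with_sum I T].

(* The blocks S j may be empty, the corresponding map J j then being 0. This does
   not affect LOCC: the protocol can be run with the finest partitions. *)
Definition coarse_graining I J : Prop :=
  [/\ instrument I, instrument J & exists S : nat -> set nat,
    [/\ trivIset [set: nat] S, \bigcup_j S j = [set: nat] &
        forall j, point_sum (S j) I (J j)]].

(* J is linked to I. The doubly indexed instrument (I k \o K k i) is relabelled
   by N through the bijection e. *)
Definition linked A I J : Prop :=
  exists K : nat -> nat -> bop H -> bop H,
    (forall k, one_way_instrument A (K k)) /\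
    exists2 e : nat -> nat * nat, bijective e &
      coarse_graining (fun m => I (e m).1 \o K (e m).1 (e m).2) J.

Definition LOCC A : set (bop H -> bop H) :=
  [set T | exists n (I : nat -> nat -> bop H -> bop H),
    [/\ one_way_instrument A (I 0%N),
        forall l, (l < n)%N -> linked A (I l) (I l.+1) &
        instrument_with_sum (I n) T]].

End instruments.

Section convertibility.
Context {R : realType} {H : hilbertType R}.

Definition vector_functional (psi : H) : bop H -> R[i] :=
  fun x => inner (x psi) psi.

Definition predual_map (Theta : bop H -> bop H) (omega : bop H -> R[i]) :
  bop H -> R[i] := omega \o Theta.

(* The norm of B(H)_* as a subspace of the dual of B(H). *)
Definition functional_norm (omega : bop H -> R[i]) : \bar R :=
  ereal_sup [set (complex.Re `|omega x|)%:E | x in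
    [set x : bop H | forall xi, `|x xi| <= `|xi|]].

Definition approx_convertible (L : set (bop H -> bop H)) (psi phi : H) : Prop :=
  forall eps : R, 0 < eps -> exists2 Theta, L Theta &
    (functional_norm (predual_map Theta (vector_functional psi)
       \- vector_functional phi)%R < eps%:E)%E.

End convertibility.

(* Main.v *)
From HB Require Import structures.
From mathcomp Require Import all_boot all_order all_algebra sesquilinear.
From mathcomp Require Import complex ring lra.
From mathcomp Require Import all_classical all_reals all_analysis.
Require Import Defs.

Set Implicit Arguments.
Unset Strict Implicit.
Unset Printing Implicit Defensive.

Import Order.TTheory GRing.Theory Num.Theory.
Import numFieldNormedType.Exports.

Local Open Scope classical_set_scope.
Local Open Scope complex_scope.
Local Open Scope ring_scope.

(** For a factor A with commutant B, let V(chi) be the supremum of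
    sum_k |<b_k a_k chi, phi>|^2 over the finite families of pairs with a_k in A,
    sum_k a_k^* a_k <= 1, and contractions b_k in B: the fidelity with phi that can
    be reached from chi by measuring in A and correcting in B. By concatenation,
    sum_i V(a_i chi) <= V(chi) for every measurement (a_i) of A. The heart of the
    proof is that the same holds for the measurements (b_i) of B. If xi is a vector
    whose state is tracial up to a factor close to 1 on corners of A and of B (it
    exists because A has a nonzero finite projection), an operator of a corner of B
    has a transpose in A with the same value at xi, and polar decompositions turn
    b_i chi, for chi = x y xi with x in A and y in B, into c_i a_i chi for contractions
    c_i of B and a measurement (a_i) of A. Vectors chi which are sums of such x y xi,
    which are dense, are of this form in an amplification of A and B by matrix
    algebras.

    The Kraus operators of A-bimodule maps lie in B, and conversely, so that
    induction over the rounds of an LOCC protocol bounds its fidelity with phi by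
    V(psi). In turn a finite family (a_k, b_k) as above extends to a one-way right
    instrument with at least its fidelity, and fidelity close to 1 is closeness in
    norm. Monotonicity under measurements also gives V(psi) <= V'(psi), for V' the
    value with A and B exchanged, whence one-way left instruments. *)

(** No trace on [A] is constructed. Comparing partial isometries yields, for every [K > 1], a vector
    [xi] whose state on a corner satisfies the trace inequality up to the factor [K]; finiteness of
    a projection is what makes that comparison work. Transposing with such a [xi] loses the factor
    [K ^+ 4]. The value [V] does not involve [K], so the loss disappears as [K] tends to 1.

    The amplification needed for a sum of [n] vectors [x y xi] grows with [n], and better
    approximations of [chi] may need more summands. This is harmless because the amplified vector
    satisfies the trace inequality with the same [K], whatever [n] is. Passing from the dense set to
    all vectors costs a factor [1 + d], again arbitrarily close to 1.

    In an LOCC protocol the later instruments depend on the earlier outcomes. The induction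
    therefore runs in the Heisenberg picture and is stated for families of positive operators, one
    for each outcome, whose quadratic forms lie below [V]. It uses finitely many Kraus operators at
    a time, infinite sums being exhausted from below. *)

Section scalars.
Context {R : realType}.
Implicit Types z w : R[i].

(** Squared moduli, like the squared norms [q] below, are kept in [R]: estimates become polynomial
    inequalities between reals, and square roots are mostly confined to the interface with norms. *)
Definition cm z : R := complex.Re z ^+ 2 + complex.Im z ^+ 2.

Lemma cm_ge0 z : 0 <= cm z.
Proof. by rewrite addr_ge0 // sqr_ge0. Qed.

Lemma cmM z w : cm (z * w) = cm z * cm w.
Proof. by case: z w => [a b] [c d]; rewrite /cm /=; ring. Qed.

Lemma cmJ z : cm (z^*) = cm z.
Proof. by case: z => a b; rewrite /cm /= sqrrN. Qed.

Lemma cm_real (r : R) : cm r%:C = r ^+ 2.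
Proof. by rewrite /cm /= expr0n addr0. Qed.

Lemma cm_eq0 z : cm z = 0 -> z = 0.
Proof.
case: z => a b /eqP; rewrite /cm /= paddr_eq0 ?sqr_ge0// !sqrf_eq0.
by move=> /andP[/eqP-> /eqP->].
Qed.

Lemma cm0 : cm 0 = 0. Proof. by rewrite /cm /= expr0n addr0. Qed.

Lemma cmN z : cm (- z) = cm z.
Proof. by case: z => a b; rewrite /cm /= !sqrrN. Qed.

Lemma mulJc z : z * z^* = (cm z)%:C.
Proof.
case: z => a b; rewrite /cm /=; apply/eqP; rewrite eq_complex /=.
by apply/andP; split; apply/eqP; ring.
Qed.

Lemma norm_cm z : `|z| = (Num.sqrt (cm z))%:C.
Proof. by rewrite normc_def. Qed.

Lemma ReD z w : complex.Re (z + w) = complex.Re z + complex.Re w.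
Proof. by case: z w => [a b] [c d]. Qed.

Lemma ReN z : complex.Re (- z) = - complex.Re z.
Proof. by case: z. Qed.

Lemma ReJ z : complex.Re (z^*) = complex.Re z.
Proof. by case: z. Qed.

Lemma ReZ (r : R) z : complex.Re (r%:C * z) = r * complex.Re z.
Proof. by case: z => a b /=; rewrite mul0r subr0. Qed.

Lemma Re_sum I (s : seq I) (P : pred I) (F : I -> R[i]) :
  complex.Re (\sum_(i <- s | P i) F i) = \sum_(i <- s | P i) complex.Re (F i).
Proof. by elim/big_rec2: _ => //= i x y _ <-; rewrite ReD. Qed.

Lemma Re_le_cm z : complex.Re z ^+ 2 <= cm z.
Proof. by rewrite lerDl sqr_ge0. Qed.

(** Young's inequality: in each component the difference of the two sides is a square over [d]. The
    free weight [d] is what lets a small perturbation cost a factor close to 1. *)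
Lemma cmD_le z w (d : R) : 0 < d ->
  cm (z + w) <= (1 + d) * cm z + (1 + d^-1) * cm w.
Proof.
move=> d0; have di := divff (lt0r_neq0 d0).
have aux (a b : R) : (a + b) ^+ 2 <= (1 + d) * a ^+ 2 + (1 + d^-1) * b ^+ 2.
  rewrite -subr_ge0.
  have -> : (1 + d) * a ^+ 2 + (1 + d^-1) * b ^+ 2 - (a + b) ^+ 2 =
    d^-1 * (d * a - b) ^+ 2.
    have -> : d^-1 * (d * a - b) ^+ 2 = (d / d) * (d * a ^+ 2 - a * b *+ 2) + d^-1 * b ^+ 2 by ring.
    by rewrite di; ring.
  by rewrite mulr_ge0 ?sqr_ge0 // invr_ge0 ltW.
case: z w => [a b] [c e]; rewrite /cm /=.
have h1 := aux a c; have h2 := aux b e; lra.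
Qed.

End scalars.

Lemma lim_eps {R : realType} (x y : R) : (forall e, 0 < e -> x <= y + e) -> x <= y.
Proof. by move=> h; apply/ler_addgt0Pr => e /h. Qed.

Section inner_product.
Context {R : realType} {H : hilbertType R}.
Implicit Types (u v w : H) (a b : R[i]).
Local Notation "''[' u , v ]" := (inner u v).

Lemma inC u v : '[u, v] = ('[v, u])^*.
Proof. by rewrite hermC expr0 mul1r. Qed.

Lemma inDl u v w : '[u + v, w] = '[u, w] + '[v, w].
Proof. exact: linearDl. Qed.

Lemma inDr u v w : '[w, u + v] = '[w, u] + '[w, v].
Proof. exact: linearDr. Qed.

Lemma inNl u w : '[- u, w] = - '[u, w].
Proof. exact: linearNl. Qed.

Lemma inNr u w : '[w, - u] = - '[w, u].
Proof. exact: linearNr. Qed.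

Lemma inBl u v w : '[u - v, w] = '[u, w] - '[v, w].
Proof. by rewrite inDl inNl. Qed.

Lemma inBr u v w : '[w, u - v] = '[w, u] - '[w, v].
Proof. by rewrite inDr inNr. Qed.

Lemma inZl a u w : '[a *: u, w] = a * '[u, w].
Proof. exact: linearZl_LR. Qed.

Lemma inZr a u w : '[w, a *: u] = a^* * '[w, u].
Proof. by rewrite inC inZl rmorphM /= -inC. Qed.

Lemma in0l w : '[0, w] = 0. Proof. exact: linear0l. Qed.

Lemma in0r w : '[w, 0] = 0. Proof. exact: linear0r. Qed.

Lemma in_suml I (s : seq I) (P : pred I) (F : I -> H) w :
  '[\sum_(i <- s | P i) F i, w] = \sum_(i <- s | P i) '[F i, w].
Proof. by elim/big_rec2: _ => [|i x y _ <-]; rewrite ?in0l ?inDl. Qed.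

Lemma in_sumr I (s : seq I) (P : pred I) (F : I -> H) w :
  '[w, \sum_(i <- s | P i) F i] = \sum_(i <- s | P i) '[w, F i].
Proof. by elim/big_rec2: _ => [|i x y _ <-]; rewrite ?in0r ?inDr. Qed.

Definition q u : R := complex.Re '[u, u].

Lemma q_norm u : `|u| = (Num.sqrt (q u))%:C.
Proof.
have := normr_ge0 u; rewrite /q inner_norm.
case: (`|u|) => a b /=; rewrite lecE /= => /andP[/eqP -> a0].
by rewrite mulr0 subr0 -expr2 sqrtr_sqr ger0_norm.
Qed.

Lemma inq u : '[u, u] = (q u)%:C.
Proof.
apply/eqP; rewrite eq_complex /= eqxx /=.
rewrite inner_norm q_norm -[_ ^+ 2]/(_ * _) /= mul0r mulr0 addr0 eqxx; exact: isT.
Qed.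

Lemma q_ge0 u : 0 <= q u.
Proof.
by rewrite -ler0c -inq inner_norm exprn_ge0.
Qed.

Lemma q_eq0 u : q u = 0 -> u = 0.
Proof. by move=> u0; apply: normr0_eq0; rewrite q_norm u0 sqrtr0. Qed.

Lemma q_gt0 u : u != 0 -> 0 < q u.
Proof.
move=> u0; rewrite lt_neqAle q_ge0 andbT eq_sym; apply: contraNneq u0.
by move/q_eq0->.
Qed.

Lemma q0 : q 0 = 0. Proof. by rewrite /q in0l. Qed.

Definition rp u v : R := complex.Re '[u, v].

Lemma rpC u v : rp u v = rp v u.
Proof. by rewrite /rp inC ReJ. Qed.

Lemma qD u v : q (u + v) = q u + q v + rp u v *+ 2.
Proof.
rewrite /q inDl !inDr !ReD -!/(rp _ _) (rpC v u) mulr2n; ring.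
Qed.

Lemma qN u : q (- u) = q u.
Proof. by rewrite /q inNl inNr opprK. Qed.

Lemma rpNr u v : rp u (- v) = - rp u v.
Proof. by rewrite /rp inNr ReN. Qed.

Lemma qB u v : q (u - v) = q u + q v - rp u v *+ 2.
Proof. by rewrite qD qN rpNr mulNrn. Qed.

Lemma qZ a u : q (a *: u) = cm a * q u.
Proof. by rewrite /q inZl inZr mulrA mulJc ReZ. Qed.

Lemma qZr (r : R) u : q (r%:C *: u) = r ^+ 2 * q u.
Proof. by rewrite qZ cm_real. Qed.

Lemma qBC u v : q (u - v) = q (v - u).
Proof. by rewrite -opprB qN. Qed.

Lemma parallelogram u v : q (u + v) + q (u - v) = (q u + q v) *+ 2.
Proof. by rewrite qD qB !mulr2n; ring. Qed.

Lemma cauchy_schwarz u v : cm '[u, v] <= q u * q v.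
Proof.
have [->|v0] := eqVneq v 0; first by rewrite in0r cm0 q0 mulr0.
have qv := q_gt0 v0.
set z := '[u, v].
have : 0 <= q ((q v)%:C *: u - z *: v) by exact: q_ge0.
rewrite qB !qZ cm_real /rp inZl inZr -/z.
have -> : (z^* * z) = (cm z)%:C by rewrite mulrC mulJc.
rewrite -rmorphM /=.
have -> : q v ^+ 2 * q u + cm z * q v - (q v * cm z) *+ 2 =
  q v * (q u * q v - cm z) by ring.
by rewrite pmulr_rge0 // subr_ge0.
Qed.

Lemma rp_le u v (d : R) : 0 < d -> rp u v *+ 2 <= d * q u + d^-1 * q v.
Proof.
move=> d0; have := q_ge0 (d%:C *: u - v).
rewrite qB qZr /rp inZl ReZ -/(rp u v) => h.
have di := divff (lt0r_neq0 d0).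
have : 0 <= d^-1 * (d ^+ 2 * q u + q v - (d * rp u v) *+ 2).
  by rewrite mulr_ge0 // invr_ge0 ltW.
have -> : d^-1 * (d ^+ 2 * q u + q v - (d * rp u v) *+ 2) =
  (d / d) * (d * q u - rp u v *+ 2) + d^-1 * q v by ring.
rewrite di => h'; lra.
Qed.

Lemma qD_le u v (d : R) : 0 < d -> q (u + v) <= (1 + d) * q u + (1 + d^-1) * q v.
Proof. by move=> d0; rewrite qD; have := rp_le u v d0; lra. Qed.

Lemma qD_le2 u v : q (u + v) <= 2 * q u + 2 * q v.
Proof. by have := @qD_le u v 1 ltr01; rewrite invr1; lra. Qed.

Lemma in_ext u v : (forall w, '[u, w] = '[v, w]) -> u = v.
Proof.
move=> h; apply/eqP; rewrite -subr_eq0; apply/eqP/q_eq0.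
by rewrite /q inBl h subrr.
Qed.

Lemma q_le_test u (M : R) : 0 <= M ->
  (forall w, cm '[u, w] <= M * q w) -> q u <= M.
Proof.
move=> M0 h; have [->|u0] := eqVneq u 0; first by rewrite q0.
by have := h u; rewrite inq cm_real expr2 ler_pM2r ?q_gt0.
Qed.

End inner_product.

(** * Operators on a Hilbert space *)

Section hilbert_convergence.
Context {R : realType} {H : hilbertType R}.
Implicit Types (u v w l : H) (s t : nat -> H).
Local Notation "''[' u , v ]" := (inner u v).

Definition qcv s l := forall e : R, 0 < e -> exists N, forall n, (N <= n)%N -> q (s n - l) < e.

Definition qcauchy s := forall e : R, 0 < e ->
  exists N, forall m n, (N <= m)%N -> (N <= n)%N -> q (s m - s n) < e.

Lemma norm_ltq u (e : R) : 0 < e -> (`|u| < e%:C) = (q u < e ^+ 2).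
Proof.
move=> e0; rewrite q_norm ltcR -[X in _ < X](gtr0_norm e0) -sqrtr_sqr ltr_sqrt //.
by rewrite exprn_gt0.
Qed.

Lemma ltc0P (e : R[i]) : 0 < e -> exists2 r : R, 0 < r & e = r%:C.
Proof. by case: e => a b; rewrite ltcE /= => /andP[/eqP-> a0]; exists a. Qed.

Lemma cvg_qcv s l : s @ \oo --> l -> qcv s l.
Proof.
move=> /cvgrPdist_lt sl e e0.
have s0 : 0 < Num.sqrt e by rewrite sqrtr_gt0.
have /sl[N _ hN] : 0 < (Num.sqrt e)%:C :> R[i] by rewrite ltcR.
exists N => n /hN /=; rewrite norm_ltq // qBC sqr_sqrtr // ltW //.
Qed.

Lemma qcauchy_cv s : qcauchy s -> exists l, qcv s l.
Proof.
move=> cs; have : cvg (s @ \oo).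
  apply/cauchy_cvgP/cauchy_ballP => e /ltc0P[r r0 ->].
  have [N hN] := cs _ (exprn_gt0 2 r0).
  have nN : \forall n \near \oo, (N <= n)%N by exists N.
  exists ([set s n | n in [set n | (N <= n)%N]], [set s n | n in [set n | (N <= n)%N]]).
    by split; apply: (filterS _ nN) => n /= Nn; exists n.
  move=> [_ _] /= [[m Nm <-] [n Nn <-]].
  by rewrite -ball_normE /= norm_ltq //; apply: hN.
by move=> cvs; exists (lim (s @ \oo)); exact: cvg_qcv.
Qed.

Lemma qcv_uniq s l l' : qcv s l -> qcv s l' -> l = l'.
Proof.
move=> sl sl'; apply/eqP; rewrite -subr_eq0; apply/eqP/q_eq0.
apply/eqP; rewrite eq_le q_ge0 andbT; apply: lim_eps => e e0.
have e4 : 0 < e / 4 by lra.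
have [N hN] := sl _ e4; have [N' hN'] := sl' _ e4.
have h1 := hN _ (leq_maxl N N'); have h2 := hN' _ (leq_maxr N N').
have -> : l - l' = - (s (maxn N N') - l) + (s (maxn N N') - l').
  by rewrite opprB addrA subrK.
have := qD_le2 (- (s (maxn N N') - l)) (s (maxn N N') - l'); rewrite qN; lra.
Qed.

Lemma qcvD s t l l' : qcv s l -> qcv t l' -> qcv (fun n => s n + t n) (l + l').
Proof.
move=> sl sl' e e0.
have e4 : 0 < e / 4 by lra.
have [N hN] := sl _ e4; have [N' hN'] := sl' _ e4.
exists (maxn N N') => n; rewrite geq_max => /andP[/hN h1 /hN' h2].
rewrite opprD addrACA.
have := qD_le2 (s n - l) (t n - l'); lra.
Qed.

Lemma qcvZ s l (a : R[i]) : qcv s l -> qcv (fun n => a *: s n) (a *: l).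
Proof.
move=> sl e e0; have c0 := cm_ge0 a.
have [|N hN] := sl (e / (cm a + 1)); first by rewrite divr_gt0 //; lra.
exists N => n /hN; rewrite -scalerBr qZ ltr_pdivlMr; last lra.
have := q_ge0 (s n - l); nra.
Qed.

Lemma qcvN s l : qcv s l -> qcv (fun n => - s n) (- l).
Proof. by move=> sl e /sl[N hN]; exists N => n /hN; rewrite -opprD qN. Qed.

Lemma qcv_cst l : qcv (fun=> l) l.
Proof. by move=> e e0; exists 0%N => n _; rewrite subrr q0. Qed.

Lemma qcv_le s l (M : R) N : qcv s l -> (forall n, (N <= n)%N -> q (s n) <= M) -> q l <= M.
Proof.
move=> sl sM; apply: lim_eps => e e0.
have M0 : 0 <= M by apply: le_trans (sM N (leqnn N)); exact: q_ge0.
pose d := e / (2 * (M + 1)).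
have d0 : 0 < d by rewrite divr_gt0 //; lra.
have i0 : 0 < d^-1 by rewrite invr_gt0.
have [|N' hN] := sl (e / (2 * (1 + d^-1))); first by rewrite divr_gt0 //; lra.
have h := hN _ (leq_maxr N N'); have h' := sM _ (leq_maxl N N').
set n := maxn N N' in h h'.
rewrite -[l](subrK (s n)) addrC.
apply: (le_trans (qD_le _ _ d0)); rewrite qBC.
move: h; rewrite ltr_pdivlMr; last lra.
have dM : d * (M + 1) = e / 2.
  rewrite /d -mulrA; field; lra.
have q1 := q_ge0 (s n).
nra.
Qed.

Lemma qcv_in s l w : qcv s l -> forall e : R, 0 < e ->
  exists N, forall n, (N <= n)%N -> cm ('[s n, w] - '[l, w]) < e.
Proof.
move=> sl e e0; have w0 := q_ge0 w.
have [|N hN] := sl (e / (q w + 1)); first by rewrite divr_gt0 //; lra.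
exists N => n /hN; rewrite -inBl ltr_pdivlMr; last lra.
have := cauchy_schwarz (s n - l) w; have := q_ge0 (s n - l); nra.
Qed.

Lemma cm_small (z : R[i]) : (forall e : R, 0 < e -> cm z < e) -> z = 0.
Proof.
move=> h; apply: cm_eq0; apply/eqP; rewrite eq_le cm_ge0 andbT.
by apply: lim_eps => e /h; rewrite add0r => /ltW.
Qed.

Lemma qcv_in_eq0 s l w : qcv s l -> (forall n, '[s n, w] = 0) -> '[l, w] = 0.
Proof.
move=> sl s0; apply: cm_small => e /(qcv_in w sl)[N /(_ _ (leqnn N))].
by rewrite s0 sub0r cmN.
Qed.

Definition subspace (D : set H) :=
  D 0 /\ forall a u v, D u -> D v -> D (a *: u + v).

Definition qclosed (D : set H) := forall s l, (forall n, D (s n)) -> qcv s l -> D l.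

Lemma subspaceD D u v : subspace D -> D u -> D v -> D (u + v).
Proof. by move=> [_ h] Du Dv; rewrite -[u]scale1r; exact: h. Qed.

Lemma subspaceZ D a u : subspace D -> D u -> D (a *: u).
Proof. by move=> [D0 h] Du; rewrite -[_ *: _]addr0; exact: h. Qed.

Lemma projection_theorem (D : set H) h : subspace D -> qclosed D ->
  exists2 p, D p & forall d, D d -> '[h - p, d] = 0.
Proof.
move=> sD cD; pose S := [set q (h - d) | d in D].
have S0 : S !=set0 by exists (q (h - 0)); exists 0 => //; case: sD.
have lS : has_lbound S by exists 0 => _ [d _ <-]; exact: q_ge0.
have iS : has_inf S by split.
pose m := inf S.
have m_le d : D d -> m <= q (h - d) by move=> Dd; apply: ge_inf => //; exists d.
have ex n : exists d, D d /\ q (h - d) < m + n.+1%:R^-1.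
  have [|_ [d Dd <-] lt] := @inf_adherent R S n.+1%:R^-1 _ iS; last by exists d.
  by rewrite invr_gt0.
pose s n := sval (cid (ex n)).
have sP n : D (s n) /\ q (h - s n) < m + n.+1%:R^-1 by rewrite /s; case: cid.
have small (e : R) : 0 < e -> exists N, forall n, (N <= n)%N -> (n.+1%:R^-1 : R) < e.
  move=> e0; have ei : 0 < e^-1 by rewrite invr_gt0.
  exists (Num.truncn e^-1).+1 => n Nn.
  rewrite invf_plt ?posrE //; apply: lt_trans (truncnS_gt _) _.
  by rewrite ltr_nat ltnS.
have [p sp] : exists p, qcv s p.
  apply: qcauchy_cv => e e0; have [|N hN] := small (e / 4); first lra.
  exists N => i j Ni Nj.
  have -> : s i - s j = (h - s j) - (h - s i) by rewrite opprB [RHS]addrC addrA subrK.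
  have par := parallelogram (h - s j) (h - s i).
  have : 4 * m <= q (h - s j + (h - s i)).
    have -> : h - s j + (h - s i) = 2%:R%:C *: (h - (2^-1)%:C *: (s j + s i)).
      rewrite scalerBr scalerA -rmorphM /= divff // scale1r addrACA -opprD.
      by rewrite rmorph_nat scaler_nat mulr2n.
    rewrite qZr; have : m <= q (h - (2^-1)%:C *: (s j + s i)).
      by apply: m_le; apply: subspaceZ => //; apply: subspaceD => //; case: (sP j); case: (sP i).
    lra.
  have [_ h1] := sP i; have [_ h2] := sP j; have h3 := hN _ Ni; have h4 := hN _ Nj.
  by move=> h5; move: (_^-1) (_^-1) h1 h2 h3 h4 => a b *; lra.
have Dp : D p by apply: cD sp => n; case: (sP n).
exists p => // d Dd.
have qp : q (h - p) <= m.
  apply: lim_eps => e e0; have [|N hN] := small e; first lra.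
  apply: (@qcv_le (fun n => h - s n) _ _ N).
    by apply: qcvD; [exact: qcv_cst | exact: qcvN].
  by move=> n /hN h2; have [_ h1] := sP n; move: (_^-1) h1 h2 => a *; lra.
set z := '[h - p, d]; pose r : R := (q d + 1)^-1.
have dp := q_ge0 d.
have r0 : 0 < r by rewrite invr_gt0; lra.
have rd : r * q d <= 1 by rewrite mulrC ler_pdivrMr; lra.
(* Moving [p] by [r z d] lowers the squared distance by [r |z|^2 (2 - r q d)], where
   [r q d <= 1]. *)
have : m <= q (h - (p + (r%:C * z) *: d)).
  by apply: m_le; apply: subspaceD => //; exact: subspaceZ.
rewrite opprD addrA qB qZ cmM cm_real /rp inZr -/z.
have -> : (r%:C * z)^* * z = (r * cm z)%:C.
  rewrite rmorphM /= -mulrA [z^* * z]mulrC mulJc.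
  by rewrite [RHS]rmorphM; congr (_ * _); exact: conjc_real.
move=> /= hm; apply: cm_eq0; apply/eqP; rewrite eq_le cm_ge0 andbT leNgt; apply/negP => c0.
have : r * cm z * (2 - r * q d) <= 0 by lra.
have rc : 0 < r * cm z by rewrite mulr_gt0.
by rewrite pmulr_rle0 //; lra.
Qed.

Lemma riesz (f : H -> R[i]) (K : R) : (forall a u v, f (a *: u + v) = a * f u + f v) ->
  (forall u, cm (f u) <= K * q u) -> exists y, forall u, f u = '[u, y].
Proof.
move=> lf bf; have f0 : f 0 = 0.
  have := lf 1 0 0; rewrite scale1r addr0 mul1r => h.
  by apply: (addIr (f 0)); rewrite add0r -h.
have fZ a u : f (a *: u) = a * f u by rewrite -[a *: u]addr0 lf f0 addr0.
have fB u v : f (u - v) = f u - f v by rewrite addrC -scaleN1r lf mulN1r addrC.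
pose D := [set u | f u = 0].
have sD : subspace D.
  by split=> // a u v; rewrite /D /= => fu fv; rewrite lf fu fv mulr0 addr0.
have cD : qclosed D.
  move=> s l Ds sl; rewrite /D /=; apply: cm_small => e e0.
  have K0 : 0 < `|K| + 1 by have := normr_ge0 K; lra.
  have [|N /(_ _ (leqnn N)) h] := sl (e / (`|K| + 1)); first by rewrite divr_gt0.
  have -> : f l = - f (s N - l) by rewrite fB (Ds N) sub0r opprK.
  rewrite cmN; apply: le_lt_trans (bf _) _.
  move: h; rewrite ltr_pdivlMr //; have := ler_norm K; have := q_ge0 (s N - l); nra.
have [[h fh]|nh] := pselect (exists h, f h <> 0); last first.
  exists 0 => u; rewrite in0r; apply: contrapT => fu; apply: nh; by exists u.
have [p Dp ph] := projection_theorem h sD cD.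
set w := h - p.
have fw : f w <> 0 by rewrite /w fB Dp subr0.
have w0 : w != 0 by apply/eqP => w0; apply: fw; rewrite w0.
have qw := q_gt0 w0.
have qwc : (q w)%:C != 0 :> R[i] by rewrite eq_complex /= eqxx andbT gt_eqF.
exists ((f w / (q w)%:C)^* *: w) => u; rewrite inZr.
have : D (f u *: w - f w *: u) by rewrite /D /= fB !fZ mulrC subrr.
move/ph; rewrite inBr !inZr -/w => /eqP; rewrite subr_eq0 => /eqP e.
have e' : f u * (q w)%:C = f w * '[u, w].
  have := congr1 Num.conj e; rewrite !rmorphM /= !conjCK -!inC inq => -> //.
rewrite conjCK; apply: (mulIf qwc).
by rewrite e' [RHS]mulrAC divfK.
Qed.

End hilbert_convergence.

Section operators.
Context {R : realType} {H : hilbertType R}.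
Implicit Types (u v w l : H) (x y : bop H).
Local Notation "''[' u , v ]" := (inner u v).

Lemma bD x u v : x (u + v) = x u + x v.
Proof. by have := bop_linear x 1 u v; rewrite !scale1r. Qed.

Lemma b0 x : x 0 = 0.
Proof. by apply: (addIr (x 0)); rewrite -bD !add0r. Qed.

Lemma bZ x a u : x (a *: u) = a *: x u.
Proof. by rewrite -[a *: u]addr0 bop_linear b0 addr0. Qed.

Lemma bN x u : x (- u) = - x u.
Proof. by rewrite -scaleN1r bZ scaleN1r. Qed.

Lemma bB x u v : x (u - v) = x u - x v.
Proof. by rewrite bD bN. Qed.

Lemma opD x y u : (x + y) u = x u + y u. Proof. by []. Qed.
Lemma opN x u : (- x) u = - x u. Proof. by []. Qed.
Lemma opB x y u : (x - y) u = x u - y u. Proof. by []. Qed.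
Lemma opM x y u : (x * y) u = x (y u). Proof. by []. Qed.
Lemma op1 u : (1 : bop H) u = u. Proof. by []. Qed.
Lemma op0 u : (0 : bop H) u = 0. Proof. by []. Qed.
Lemma opZ a x u : (a *: x) u = a *: x u. Proof. by []. Qed.

Lemma op_sum I (s : seq I) (P : pred I) (F : I -> bop H) u :
  (\sum_(i <- s | P i) F i) u = \sum_(i <- s | P i) F i u.
Proof. by elim/big_rec2: _ => [|i y v _ <-]; rewrite ?op0 ?opD. Qed.

Definition bnd (K : R) x := forall u, q (x u) <= K * q u.

Lemma bop_bnd x : exists2 K : R, 0 < K & bnd K x.
Proof.
have : x @ (0 : H) --> x 0 by exact: bop_continuous.
move=> /cvgrPdist_lt/(_ 1 ltr01).
rewrite b0 => /nbhs_ballP[e /ltc0P[r r0 ->]] h.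
have r2 : 0 < r ^+ 2 by rewrite exprn_gt0.
exists (2 / r ^+ 2); first by rewrite divr_gt0.
move=> u; have [->|u0] := eqVneq u 0; first by rewrite b0 q0 mulr0.
have qu := q_gt0 u0.
pose t := Num.sqrt (r ^+ 2 / (2 * q u)).
have t2 : t ^+ 2 = r ^+ 2 / (2 * q u) by rewrite sqr_sqrtr // divr_ge0 ?ltW //; lra.
have : ball (0 : H) r%:C (t%:C *: u).
  rewrite -ball_normE /= sub0r normrN norm_ltq // qZr t2 -mulrA.
  by rewrite gtr_pMr // mulrC ltr_pdivrMr; lra.
move/h; rewrite /= sub0r normrN (_ : 1 = 1%:C) // norm_ltq // bZ qZr t2 expr1n.
rewrite mulrAC ltr_pdivrMr; last lra.
by move=> h1; rewrite mulrAC ler_pdivlMr //; lra.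
Qed.

Lemma mkbop (f : H -> H) (K : R) : (forall a u v, f (a *: u + v) = a *: f u + f v) ->
  (forall u, q (f u) <= K * q u) -> exists x : bop H, forall u, x u = f u.
Proof.
move=> lf bf.
have fP : f \in @bop_pred R H.
  rewrite inE; split=> // u; apply/cvgrPdist_lt => e /ltc0P[r r0 ->].
  have K0 : 0 < `|K| + 1 by have := normr_ge0 K; lra.
  have d0 : 0 < r / Num.sqrt (`|K| + 1) by rewrite divr_gt0 // sqrtr_gt0.
  apply/nbhs_ballP; exists (r / Num.sqrt (`|K| + 1))%:C; first by rewrite /= ltcR.
  move=> v; rewrite -ball_normE /= !norm_ltq // expr_div_n sqr_sqrtr ?ltW //.
  rewrite ltr_pdivlMr // => h.
  have -> : f u - f v = f (u - v).
    by rewrite -[in RHS]scaleN1r [in RHS]addrC lf scaleN1r addrC.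
  apply: le_lt_trans (bf _) _; have := ler_norm K; have := q_ge0 (u - v); nra.
by exists (Bop fP).
Qed.

Lemma qcv_bop x s l : qcv s l -> qcv (fun n => x (s n)) (x l).
Proof.
move=> sl e e0; have [K K0 hK] := bop_bnd x.
have [|N hN] := sl (e / K); first by rewrite divr_gt0.
exists N => n /hN; rewrite -bB ltr_pdivlMr // mulrC.
by apply: le_lt_trans.
Qed.

Lemma adj_ex x : exists y, adjoint x y.
Proof.
have [K K0 hK] := bop_bnd x.
have ex eta : exists y : H, forall u, '[x u, eta] = '[u, y].
  apply: (@riesz _ _ _ (K * q eta)).
    by move=> a u v; rewrite bop_linear inDl inZl.
  move=> u; apply: le_trans (cauchy_schwarz _ _) _.
  by rewrite mulrAC; apply: ler_wpM2r; rewrite ?q_ge0.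
pose f eta := sval (cid (ex eta)).
have fP u eta : '[x u, eta] = '[u, f eta] by rewrite /f; case: cid.
have fP' u w : '[f u, w] = '[u, x w] by rewrite inC -fP -inC.
have [||y yf] := @mkbop f K; last by exists y => u v; rewrite yf fP.
  by move=> a u v; apply: in_ext => w; rewrite inDl inZl !fP' inDl inZl.
move=> u; have [->|fu0] := eqVneq (f u) 0; first by rewrite q0 mulr_ge0 ?q_ge0 // ltW.
have : cm '[x (f u), u] <= q (x (f u)) * q u by exact: cauchy_schwarz.
rewrite fP inq cm_real => h; have := hK (f u); have := q_gt0 fu0; have := q_ge0 u.
move=> h1 h2 h3.
have : q (f u) ^+ 2 <= K * q (f u) * q u by apply: le_trans h _; apply: ler_wpM2r.
by rewrite expr2 mulrAC ler_pM2r.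
Qed.

End operators.

(** The discriminant of a nonnegative quadratic form in [c]. It is enough to test [c = - t conj z],
    with [t = 1 / b], or with a large [t] when [b = 0]. Both Cauchy-Schwarz inequalities, for
    positive operators and for completely positive maps, come from here. *)
Lemma cs_num {R : realType} (a b : R) (z : R[i]) : 0 <= b ->
  (forall c : R[i], 0 <= a + cm c * b + complex.Re (c * z) *+ 2) -> cm z <= a * b.
Proof.
move=> b0 h; have h' (t : R) : 0 <= a + t ^+ 2 * cm z * b - (t * cm z) *+ 2.
  have e : - (t%:C * conjc z) * z = - (t * cm z)%:C.
    by rewrite mulNr -mulrA [conjc z * z]mulrC (mulJc z) -rmorphM.
  have := h (- (t%:C * conjc z)).
  by rewrite cmN cmM cm_real (cmJ z) e ReN [complex.Re _]/= mulNrn.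
have c0 := cm_ge0 z; have a0 := h 0; rewrite mul0r [complex.Re _]/= cm0 mul0r mul0rn !addr0 in a0.
have [->|cz] := eqVneq (cm z) 0; first by rewrite mulr_ge0.
have {}cz : 0 < cm z by rewrite lt_neqAle eq_sym cz.
have [b1|b1] := eqVneq b 0.
  have := h' ((a + 1) / (cm z)); rewrite b1 mulr0 addr0 divfK ?gt_eqF //.
  by rewrite mulr2n; lra.
have bb : b^-1 * b = 1 by rewrite mulVf.
have := h' b^-1.
have -> : b^-1 ^+ 2 * cm z * b = (b^-1 * b) * (b^-1 * cm z) by ring.
rewrite bb mul1r mulr2n opprD addrA addrK subr_ge0 mulrC ler_pdivrMr //.
by rewrite lt_neqAle eq_sym b1.
Qed.

Lemma monotone_cauchy {R : realType} (y : nat -> R) (M : R) :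
  (forall n, y n <= y n.+1) -> (forall n, y n <= M) ->
  forall e, 0 < e -> exists N, forall m n, (N <= n <= m)%N -> 0 <= y m - y n < e.
Proof.
move=> yS yM e e0.
have mono m n : (n <= m)%N -> y n <= y m by have /nondecreasing_seqP h := yS; exact: h.
have hS : has_sup (range y).
  by split; [exists (y 0%N); exists 0%N | exists M => _ [n _ <-]].
have [_ [N _ <-] hN] := sup_adherent e0 hS.
exists N => m n /andP[Nn nm]; rewrite subr_ge0 mono //=.
have h1 := mono _ _ Nn; have h2 : y m <= sup (range y).
  by apply: (sup_upper_bound hS); exists m.
lra.
Qed.

Section operator_calculus.
Context {R : realType} {H : hilbertType R}.
Implicit Types (u v w l : H) (x y z : bop H).
Local Notation "''[' u , v ]" := (inner u v).

Definition adj x : bop H := sval (cid (adj_ex x)).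

Lemma adjP x u v : '[x u, v] = '[u, adj x v].
Proof. by rewrite /adj; case: cid => y /= ->. Qed.

Lemma adjP' x u v : '[adj x u, v] = '[u, x v].
Proof. by rewrite inC -adjP -inC. Qed.

Lemma op_ext x y : (forall u v, '[x u, v] = '[y u, v]) -> x = y.
Proof. by move=> h; apply: bop_ext => u; apply: in_ext => v; exact: h. Qed.

Lemma adj_uniq x y : (forall u v, '[x u, v] = '[u, y v]) -> adj x = y.
Proof. by move=> h; apply: op_ext => u v; rewrite adjP' inC h -inC. Qed.

Lemma adjK x : adj (adj x) = x.
Proof. by apply: adj_uniq => u v; rewrite adjP'. Qed.

Lemma adjM x y : adj (x * y) = adj y * adj x.
Proof. by apply: adj_uniq => u v; rewrite !opM !adjP. Qed.

Lemma adjD x y : adj (x + y) = adj x + adj y.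
Proof. by apply: adj_uniq => u v; rewrite !opD inDl inDr !adjP. Qed.

Lemma adjN x : adj (- x) = - adj x.
Proof. by apply: adj_uniq => u v; rewrite !opN inNl inNr !adjP. Qed.

Lemma adjB x y : adj (x - y) = adj x - adj y.
Proof. by rewrite adjD adjN. Qed.

Lemma adjZ a x : adj (a *: x) = a^* *: adj x.
Proof. by apply: adj_uniq => u v; rewrite !opZ inZl inZr conjCK adjP. Qed.

Lemma adj1 : adj 1 = 1. Proof. exact: adj_uniq. Qed.

Lemma adj0 : adj 0 = 0.
Proof. by apply: adj_uniq => u v; rewrite !op0 in0l in0r. Qed.

Lemma conj_real (r : R) : (r%:C)^* = r%:C :> R[i].
Proof. exact: conjc_real. Qed.

Lemma q_adj x u : q (x u) = complex.Re '[(adj x * x) u, u].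
Proof. by rewrite opM adjP' . Qed.

Lemma mulZl a x y : (a *: x) * y = a *: (x * y).
Proof. by apply: bop_ext. Qed.

Lemma mulZr a x y : x * (a *: y) = a *: (x * y).
Proof. by apply: bop_ext => u; rewrite opM !opZ bZ. Qed.

Lemma q_tri u v (a b : R) : 0 <= a -> 0 <= b -> q u <= a ^+ 2 -> q v <= b ^+ 2 ->
  q (u + v) <= (a + b) ^+ 2.
Proof.
move=> a0 b0' hu hv; rewrite qD.
have : rp u v ^+ 2 <= (a * b) ^+ 2.
  apply: le_trans (Re_le_cm _) _; apply: le_trans (cauchy_schwarz _ _) _.
  by rewrite exprMn; apply: ler_pM => //; exact: q_ge0.
have [rp0|rp0] := leP 0 (rp u v); last by have : 0 <= a * b by [apply: mulr_ge0]; nra.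
rewrite ler_sqr ?nnegrE ?mulr_ge0 //; nra.
Qed.

Lemma bndD (a b : R) x y : 0 <= a -> 0 <= b -> bnd (a ^+ 2) x -> bnd (b ^+ 2) y ->
  bnd ((a + b) ^+ 2) (x + y).
Proof.
move=> a0 b0' hx hy u; have u0 := q_ge0 u; rewrite opD.
have s2 : Num.sqrt (q u) ^+ 2 = q u by rewrite sqr_sqrtr.
rewrite -s2 -exprMn mulrDl; apply: q_tri; rewrite ?mulr_ge0 ?sqrtr_ge0 // exprMn s2; [exact: hx|exact: hy].
Qed.

Lemma bndM (a b : R) x y : 0 <= a -> bnd a x -> bnd b y -> bnd (a * b) (x * y).
Proof.
move=> a0 hx hy u; rewrite opM -mulrA; apply: le_trans (hx _) _.
by apply: ler_wpM2l.
Qed.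

Lemma bnd_le (a b : R) x : a <= b -> bnd a x -> bnd b x.
Proof.
move=> ab hx u; apply: le_trans (hx u) _; apply: ler_wpM2r => //; exact: q_ge0.
Qed.

Lemma bndZ (c : R[i]) (a : R) x : bnd a x -> bnd (cm c * a) (c *: x).
Proof. by move=> hx u; rewrite opZ qZ -mulrA ler_wpM2l // cm_ge0. Qed.

Lemma bnd1 : bnd 1 (1 : bop H).
Proof. by move=> u; rewrite mul1r. Qed.

Lemma bnd_adj (K : R) x : 0 <= K -> bnd K x -> bnd K (adj x).
Proof.
move=> K0 hx u; apply: q_le_test => [|w]; first by rewrite mulr_ge0 ?q_ge0.
rewrite adjP'; apply: le_trans (cauchy_schwarz _ _) _.
have := hx w; have := q_ge0 u; nra.
Qed.

Definition posop x := forall u, 0 <= '[x u, u].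

Lemma posopRe x : posop x -> forall u, 0 <= complex.Re '[x u, u].
Proof. by move=> px u; have := px u; rewrite lecE => /andP[]. Qed.

(** Polarization: the sesquilinear defect [D] vanishes on the diagonal, hence is antisymmetric;
    replacing [v] by [i v] makes it symmetric as well. *)
Lemma posop_sa x : posop x -> adj x = x.
Proof.
move=> px; pose D u v := '[x u, v] - '[u, x v].
have D0 u : D u u = 0.
  rewrite /D [X in _ - X]inC; have := px u; case: ('[x u, u]) => a b.
  by rewrite lecE /= => /andP[/eqP-> _]; apply/eqP; rewrite eq_complex /= oppr0 !subrr !eqxx.
have DD u v : D (u + v) (u + v) = D u u + D v v + (D u v + D v u).
  by rewrite /D !bD !inDl !inDr; ring.
have s1 u v : D u v = - D v u.
  by have := D0 (u + v); rewrite DD !D0 !add0r => /eqP; rewrite addr_eq0 => /eqP.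
have Di u v : D u ('i%C *: v) = - 'i%C * D u v.
  rewrite /D bZ !inZr -mulrBr; congr (_ * _).
  by apply/eqP; rewrite eq_complex /= oppr0 !eqxx.
have Di' u v : D ('i%C *: v) u = 'i%C * D v u.
  by rewrite /D bZ !inZl -mulrBr.
have i0 : 'i%C != 0 :> R[i] by rewrite eq_complex /= oner_eq0 andbF.
have D00 u v : D u v = 0.
  have := s1 u ('i%C *: v); rewrite Di Di' mulNr => /oppr_inj /(mulfI i0) e.
  have := s1 u v; rewrite e => /eqP; rewrite -addr_eq0 -mulr2n mulrn_eq0 /=.
  by move=> /eqP.
apply: adj_uniq => u v; apply/eqP; rewrite -subr_eq0; apply/eqP; exact: D00.
Qed.

Lemma posop_adj_mul x : posop (adj x * x).
Proof. by move=> u; rewrite opM adjP' inq ler0c q_ge0. Qed.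

Lemma posopD x y : posop x -> posop y -> posop (x + y).
Proof. by move=> px py u; rewrite opD inDl addr_ge0. Qed.

Lemma posopZ (r : R) x : 0 <= r -> posop x -> posop (r%:C *: x).
Proof. by move=> r0 px u; rewrite opZ inZl mulr_ge0 // ler0c. Qed.

Lemma posop1 : posop 1.
Proof. by move=> u; rewrite inq ler0c q_ge0. Qed.

Lemma posop0 : posop 0.
Proof. by move=> u; rewrite op0 in0l. Qed.

Lemma Re_ge0 (c : R[i]) : 0 <= c -> c = (complex.Re c)%:C.
Proof.
by case: c => a b; rewrite lecE /= => /andP[/eqP-> _].
Qed.

Lemma posop_cs x u v : posop x ->
  cm '[x u, v] <= complex.Re '[x u, u] * complex.Re '[x v, v].
Proof.
move=> px; have sx := posop_sa px; rewrite -cmJ.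
apply: cs_num; first exact: posopRe.
move=> c; have := posopRe px (u + c *: v).
rewrite bD bZ !inDl !inDr !inZl !inZr !ReD mulrA mulJc ReZ.
have -> : '[x v, u] = ('[x u, v])^* by rewrite -inC -{1}sx adjP'.
have -> : complex.Re (c^* * '[x u, v]) = complex.Re (c * ('[x u, v])^*).
  by rewrite -[in RHS]ReJ rmorphM /= conjCK.
lra.
Qed.

Lemma posop_contr x : posop x -> posop (1 - x) -> bnd 1 x.
Proof.
move=> px p1 u; rewrite mul1r; apply: q_le_test => [|w]; first exact: q_ge0.
have h w' : complex.Re '[x w', w'] <= q w'.
  by have := posopRe p1 w'; rewrite opB inBl ReD ReN subr_ge0.
apply: le_trans (posop_cs _ _ px) _.
by apply: ler_pM => //; exact: posopRe.
Qed.

End operator_calculus.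

Section strong_limits.
Context {R : realType} {H : hilbertType R}.
Implicit Types (u v w l : H) (x y z : bop H).
Local Notation "''[' u , v ]" := (inner u v).

Lemma qcv_q (s : nat -> H) l : qcv s l -> forall e : R, 0 < e ->
  exists N, forall n, (N <= n)%N -> q (s n) <= q l + e.
Proof.
move=> sl e e0; have l0 := q_ge0 l.
pose d := e / (2 * (q l + 1)).
have d0 : 0 < d by rewrite divr_gt0 //; lra.
have i0 : 0 < d^-1 by rewrite invr_gt0.
have [|N hN] := sl (e / (2 * (1 + d^-1))); first by rewrite divr_gt0 //; lra.
exists N => n /hN; rewrite ltr_pdivlMr; last lra.
move=> h; have := qD_le l (s n - l) d0; rewrite addrC subrK.
have dM : d * (q l + 1) = e / 2 by rewrite /d -mulrA; field; lra.
nra.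
Qed.

Lemma qcv_q_ge (s : nat -> H) l : qcv s l -> forall e : R, 0 < e ->
  exists N, forall n, (N <= n)%N -> q l <= q (s n) + e.
Proof.
move=> sl e e0; have l0 := q_ge0 l.
have [N1 h1] := qcv_q sl (ltr01).
pose d := e / (2 * (q l + 2)).
have d0 : 0 < d by rewrite divr_gt0 //; lra.
have i0 : 0 < d^-1 by rewrite invr_gt0.
have [|N hN] := sl (e / (2 * (1 + d^-1))); first by rewrite divr_gt0 //; lra.
exists (maxn N1 N) => n; rewrite geq_max => /andP[/h1 h2 /hN]; rewrite ltr_pdivlMr; last lra.
move=> h; have := qD_le (s n) (l - s n) d0; rewrite addrC subrK qBC.
have dM : d * (q l + 2) = e / 2 by rewrite /d -mulrA; field; lra.
have := q_ge0 (s n); nra.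
Qed.

Lemma qcv_le2 (s t : nat -> H) l l' (K : R) : 0 <= K -> qcv s l -> qcv t l' ->
  (forall n, q (t n) <= K * q (s n)) -> q l' <= K * q l.
Proof.
move=> K0 sl tl h; apply: lim_eps => e e0.
have [|N hN] := qcv_q sl (e := e / (K + 1)); first by rewrite divr_gt0 //; lra.
have e1 : e / (K + 1) * (K + 1) = e by rewrite divfK //; lra.
have e2 : 0 < e / (K + 1) by rewrite divr_gt0 //; lra.
apply: (@qcv_le _ _ t _ _ N tl) => n /hN h1; apply: le_trans (h n) _.
nra.
Qed.

Lemma slim (X : nat -> bop H) (K : R) : 0 <= K -> (forall n, bnd K (X n)) ->
  (forall u, qcauchy (fun n => X n u)) ->
  exists2 Y : bop H, bnd K Y & forall u, qcv (fun n => X n u) (Y u).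
Proof.
move=> K0 bX cX; pose f u := sval (cid (qcauchy_cv (cX u))).
have fP u : qcv (fun n => X n u) (f u) by rewrite /f; case: cid.
have bf u : q (f u) <= K * q u.
  by apply: qcv_le2 K0 (qcv_cst u) (fP u) _ => n; exact: bX.
have [|x xf] := mkbop _ bf.
  move=> a u v; apply: (qcv_uniq (fP _)).
  rewrite (_ : (fun n => _) = (fun n => a *: X n u + X n v)); last first.
    by apply/funext => n; rewrite bop_linear.
  by apply: qcvD => //; exact: qcvZ.
exists x => u; rewrite xf //; exact: bf.
Qed.

Lemma qcv_in_eq (s t : nat -> H) l l' w w' : qcv s l -> qcv t l' ->
  (forall n, '[s n, w] = '[w', t n]) -> '[l, w] = '[w', l'].
Proof.
move=> sl tl h; apply/eqP; rewrite -subr_eq0; apply/eqP/cm_small => e e0.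
have e4 : 0 < e / 4 by lra.
have [N hN] := qcv_in w sl e4; have [N' hN'] := qcv_in w' tl e4.
have h1 := hN _ (leq_maxl N N'); have h2 := hN' _ (leq_maxr N N').
set n := maxn N N' in h1 h2.
have -> : '[l, w] - '[w', l'] = - ('[s n, w] - '[l, w]) + (('[t n, w'] - '[l', w'])^*).
  by rewrite rmorphB /= -!inC -h; ring.
have := @cmD_le _ (- ('[s n, w] - '[l, w])) (('[t n, w'] - '[l', w'])^*) 1 ltr01.
by rewrite cmN (cmJ ('[t n, w'] - '[l', w'])) invr1; lra.
Qed.

Lemma slim_sa (X : nat -> bop H) (Y : bop H) : (forall n, adj (X n) = X n) ->
  (forall u, qcv (fun n => X n u) (Y u)) -> adj Y = Y.
Proof.
move=> sX XY; apply: adj_uniq => u v; apply: qcv_in_eq (XY u) (XY v) _ => n.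
by rewrite -{1}(sX n) adjP'.
Qed.

Lemma slim_adj (X : nat -> bop H) (Y Z : bop H) : (forall u, qcv (fun n => X n u) (Y u)) ->
  (forall u, qcv (fun n => adj (X n) u) (Z u)) -> Z = adj Y.
Proof.
move=> XY XZ; rewrite -[Z]adjK; congr adj; apply: adj_uniq => u v.
by apply: qcv_in_eq (XZ u) (XY v) _ => n; rewrite adjP'.
Qed.

Lemma slim_comm (X : nat -> bop H) (Y y : bop H) : (forall n, y * X n = X n * y) ->
  (forall u, qcv (fun n => X n u) (Y u)) -> y * Y = Y * y.
Proof.
move=> yX XY; apply: bop_ext => u; apply: (qcv_uniq (s := fun n => y (X n u))).
  exact: qcv_bop.
rewrite (_ : (fun n => _) = (fun n => X n (y u))); first exact: XY.
by apply/funext => n; have := congr1 (fun t : bop H => t u) (yX n).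
Qed.

Lemma slim_mul (X Y : nat -> bop H) (X' Y' : bop H) (K : R) : 0 <= K -> (forall n, bnd K (X n)) ->
  (forall u, qcv (fun n => X n u) (X' u)) -> (forall u, qcv (fun n => Y n u) (Y' u)) ->
  forall u, qcv (fun n => (X n * Y n) u) ((X' * Y') u).
Proof.
move=> K0 bX XX YY u e e0.
have [|N hN] := YY u (e / (4 * (K + 1))); first by rewrite divr_gt0 //; lra.
have [|N' hN'] := XX (Y' u) (e / 4); first lra.
exists (maxn N N') => n; rewrite geq_max => /andP[/hN + /hN']; rewrite ltr_pdivlMr; last lra.
move=> h1 h2; rewrite !opM.
have -> : X n (Y n u) - X' (Y' u) = X n (Y n u - Y' u) + (X n (Y' u) - X' (Y' u)).
  by rewrite bB addrA subrK.
have := qD_le2 (X n (Y n u - Y' u)) (X n (Y' u) - X' (Y' u)).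
have := bX n (Y n u - Y' u); have := q_ge0 (Y n u - Y' u); lra.
Qed.

End strong_limits.

(** * Extension of bounded linear relations to operators *)

Section extension.
Context {R : realType} {H : hilbertType R}.
Implicit Types (u v w l : H) (x y z : bop H).
Local Notation "''[' u , v ]" := (inner u v).

(** A set of pairs rather than a function: maps such as [r u |-> z u] are given through a parameter,
    and are single-valued only by virtue of a norm bound. *)
Definition linrel (D : set (H * H)) :=
  D (0, 0) /\ forall a p p', D p -> D p' -> D (a *: p.1 + p'.1, a *: p.2 + p'.2).

(** The closure of the relation is the graph of a map on a closed subspace, extended by 0 on the
    orthogonal complement. An operator [y] commutes with the result once [y] and [adj y] both
    preserve the relation, since [adj y] preserving the domain means that [y] preserves its
    complement. *)
Lemma ext_op (D : set (H * H)) (K : R) : 0 <= K -> linrel D ->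
  (forall p, D p -> q p.2 <= K * q p.1) ->
  exists x : bop H, [/\ bnd K x, forall p, D p -> x p.1 = p.2,
    forall w, (forall p, D p -> '[w, p.1] = 0) -> x w = 0,
    forall w, (forall p, D p -> '[p.2, w] = 0) -> forall u, '[x u, w] = 0 &
    forall y, (forall p, D p -> D (y p.1, y p.2)) ->
      (forall p, D p -> D (adj y p.1, adj y p.2)) -> y * x = x * y].
Proof.
move=> K0 [D0 DD] DK.
pose G a b := exists s : nat -> H * H, [/\ forall n, D (s n),
  qcv (fun n => (s n).1) a & qcv (fun n => (s n).2) b].
have GD p : D p -> G p.1 p.2 by move=> Dp; exists (fun=> p); split=> //; exact: qcv_cst.
have GL c a b a' b' : G a b -> G a' b' -> G (c *: a + a') (c *: b + b').
  move=> [s [Ds sa sb]] [t [Dt ta tb]].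
  exists (fun n => (c *: (s n).1 + (t n).1, c *: (s n).2 + (t n).2)).
  by split=> [n||]; [exact: DD|apply: qcvD => //; exact: qcvZ|apply: qcvD => //; exact: qcvZ].
have GK a b : G a b -> q b <= K * q a.
  by move=> [s [Ds sa sb]]; apply: qcv_le2 K0 sa sb _ => n; exact: DK.
pose E a := exists b, G a b.
have sE : subspace E.
  split; first by exists 0; exact: (GD (0, 0)).
  by move=> c a a' [b Gab] [b' Gab']; exists (c *: b + b'); exact: GL.
(* Near each [s n] choose a pair of [D] itself; the second components form a Cauchy sequence by the
   bound [K]. *)
have cE : qclosed E.
  move=> s a Es sa.
  have ex n : exists p, D p /\ q (p.1 - s n) < n.+1%:R^-1.
    have [b [t [Dt ta _]]] := Es n.
    have [|N hN] := ta n.+1%:R^-1; first by rewrite invr_gt0.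
    by exists (t N); split=> //; exact: hN.
  pose t n := sval (cid (ex n)).
  have tP n : D (t n) /\ q ((t n).1 - s n) < n.+1%:R^-1 by rewrite /t; case: cid.
  have ta : qcv (fun n => (t n).1) a.
    move=> e e0; have [|N hN] := sa (e / 4); first lra.
    exists (maxn N (Num.truncn (4 / e)).+1) => n; rewrite geq_max => /andP[/hN h1 h2].
    have h3 : n.+1%:R^-1 < e / 4 :> R.
      rewrite -[e / 4]invrK ltf_pV2 ?posrE ?invr_gt0 //; last by lra.
      rewrite invf_div; apply: lt_trans (truncnS_gt _) _.
      by rewrite ltr_nat ltnS.
    have [_ h4] := tP n; have h5 := lt_trans h4 h3.
    have := qD_le2 ((t n).1 - s n) (s n - a); rewrite addrA subrK; lra.
  have [b tb] : exists b, qcv (fun n => (t n).2) b.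
    apply: qcauchy_cv => e e0.
    have [|N hN] := ta (e / (4 * (K + 1))); first by rewrite divr_gt0 //; lra.
    exists N => m n /hN h1 /hN h2; rewrite ltr_pdivlMr in h1; last lra.
    rewrite ltr_pdivlMr in h2; last lra.
    have /DK /= : D (-1 *: (t n).1 + (t m).1, -1 *: (t n).2 + (t m).2).
      by apply: DD; [case: (tP n)|case: (tP m)].
    rewrite !scaleN1r ![- _ + _]addrC => h3.
    have := qD_le2 ((t m).1 - a) (a - (t n).1); rewrite addrA subrK (qBC a).
    have := q_ge0 ((t m).1 - (t n).1); nra.
  by exists b, t; split=> // n; case: (tP n).
pose F u b := exists2 p, G p b & forall e, E e -> '[u - p, e] = 0.
have Fex u : exists b, F u b.
  by have [p [b Gb] hp] := projection_theorem u sE cE; exists b, p.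
have FL c u b u' b' : F u b -> F u' b' -> F (c *: u + u') (c *: b + b').
  move=> [p Gp hp] [p' Gp' hp']; exists (c *: p + p'); first exact: GL.
  move=> e Ee; have -> : c *: u + u' - (c *: p + p') = c *: (u - p) + (u' - p').
    by rewrite scalerBr opprD addrACA.
  by rewrite inDl inZl hp // hp' // mulr0 addr0.
have FK u b : F u b -> q b <= K * q u.
  move=> [p Gp hp]; apply: le_trans (GK _ _ Gp) _; apply: ler_wpM2l => //.
  have -> : u = (u - p) + p by rewrite subrK.
  by rewrite [X in _ <= X]qD /rp hp ?mul0rn ?addr0 ?lerDr ?q_ge0 //; exists b.
have FU u b b' : F u b -> F u b' -> b = b'.
  move=> Fb Fb'; have := FK _ _ (FL (-1) _ _ _ _ Fb Fb').
  rewrite !scaleN1r [- u + u]addrC subrr q0 mulr0 addrC => h.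
  by apply/eqP; rewrite eq_sym -subr_eq0; apply/eqP/q_eq0/eqP; rewrite eq_le h q_ge0.
pose f u := sval (cid (Fex u)).
have fF u : F u (f u) by rewrite /f; case: cid.
have [||x xf] := @mkbop _ _ f K.
- by move=> a u v; apply: FU (fF _) _; exact: FL.
- by move=> u; exact: FK.
have xF u b : F u b -> x u = b by move=> Fb; rewrite xf; exact: FU (fF u) Fb.
exists x; split.
- by move=> u; rewrite xf; exact: FK.
- move=> p Dp; apply: xF; exists p.1; first exact: GD.
  by move=> e _; rewrite subrr in0l.
- move=> w hw; apply: xF; exists 0; first exact: (GD (0, 0)).
  move=> e [b [s [Ds se _]]]; rewrite subr0 inC.
  by rewrite (@qcv_in_eq0 _ _ _ _ w se) ?conjC0 // => n; rewrite inC hw // conjC0.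
- move=> w hw u; rewrite xf; have [p [s [Ds _ sb]] _] := fF u.
  by apply: qcv_in_eq0 sb _ => n; exact: hw.
- have inv y : (forall p, D p -> D (y p.1, y p.2)) -> forall a b, G a b -> G (y a) (y b).
    move=> hy a b [s [Ds sa sb]]; exists (fun n => (y (s n).1, y (s n).2)).
    by split=> [n||]; [exact: hy|exact: qcv_bop|exact: qcv_bop].
  move=> y hy hy'; apply: bop_ext => u; rewrite !opM; apply/esym/xF.
  rewrite xf; have [p Gp hp] := fF u; exists (y p); first exact: inv.
  move=> e [b Gb]; rewrite -bB adjP; apply: hp; exists (adj y b).
  exact: (inv (adj y)).
Qed.

Lemma subspace_linrel (S : set H) : subspace S -> linrel [set p | S p.1 /\ p.1 = p.2].
Proof.
move=> [S0 SD]; split=> // a [p1 p2] [p3 p4] /= [h1 <-] [h2 <-].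
by split=> //; exact: SD.
Qed.

Lemma proj_ex (S : set H) : subspace S -> exists e : bop H, [/\ e * e = e, adj e = e,
  forall u, S u -> e u = u, forall w, (forall u, S u -> '[w, u] = 0) -> e w = 0 &
  forall y, (forall u, S u -> S (y u)) -> (forall u, S u -> S (adj y u)) -> y * e = e * y].
Proof.
move=> sS; have [|e [be eS e0 eW eC]] := ext_op ler01 (subspace_linrel sS).
  by move=> [p1 p2] /= [_ ->]; rewrite mul1r.
have {}eS u : S u -> e u = u by move=> Su; apply: (eS (u, u)).
have aS u : S u -> adj e u = u.
  move=> Su; apply/eqP; rewrite -subr_eq0; apply/eqP/q_eq0/eqP.
  rewrite eq_le q_ge0 andbT qB /rp adjP' eS // -/(q u).
  have := bnd_adj ler01 be u; rewrite mul1r; lra.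
have perp u v : S v -> '[u - e u, v] = 0.
  by move=> Sv; rewrite inBl adjP aS // subrr.
have ee : e * e = e.
  apply: bop_ext => u; rewrite opM; apply/esym/eqP; rewrite -subr_eq0 -bB; apply/eqP.
  by apply: e0 => -[p1 p2] /= [Sp _]; exact: perp.
exists e; split=> //.
- apply: adj_uniq => u v.
  have z u' v' : '[e u', v' - e v'] = 0.
    by apply: eW => -[p1 p2] /= [Sp <-]; rewrite inC perp // conjC0.
  have h1 := z u v; have h2 := z v u.
  move: h1 h2; rewrite !inBr => /eqP; rewrite subr_eq0 => /eqP-> /eqP.
  by rewrite subr_eq0 => /eqP h2; rewrite inC -h2 -inC.
- by move=> w hw; apply: e0 => -[p1 p2] /= [Sp _]; exact: hw.
- by move=> y h1 h2; apply: eC => -[p1 p2] /= [Sp <-]; split=> //; [exact: h1|exact: h2].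
Qed.

End extension.

(** * Square roots and polar decompositions *)

Section square_root.
Context {R : realType} {H : hilbertType R}.
Implicit Types (u v w l : H) (x y z X Y S : bop H).
Local Notation "''[' u , v ]" := (inner u v).

(** The operator [Y = 1 - sqrt (1 - S)] solves [Y = (S + Y^2) / 2] and is reached by iteration from
    0. The scalar iteration [ys], which is the case [S = 1], majorizes it: norms of differences of
    [Ys] are at most differences of [ys], an increasing sequence bounded by 1. *)
Let ys n : R := iter n (fun t : R => 2^-1 * (1 + t ^+ 2)) 0.
Let Ys S n : bop H := iter n (fun Y => (2^-1)%:C *: (S + Y * Y)) 0.

Let ys01 n : 0 <= ys n <= 1.
Proof.
elim: n => [|n /andP[h1 h2]]; first by rewrite /ys /= lexx ler01.
by rewrite [ys _]/= -/(ys n); apply/andP; split; nra.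
Qed.

Let ysS n : ys n.+1 - ys n = 2^-1 * (1 - ys n) ^+ 2.
Proof. by rewrite [ys n.+1]/= -/(ys n); field. Qed.

Let ysS_ge n : ys n <= ys n.+1.
Proof. by rewrite -subr_ge0 ysS mulr_ge0 // ?sqr_ge0 // invr_ge0. Qed.

Let YsS S n : Ys S n.+1 = (2^-1)%:C *: (S + Ys S n * Ys S n).
Proof. by []. Qed.

Let Ys_comm S y n : y * S = S * y -> y * Ys S n = Ys S n * y.
Proof.
move=> h; elim: n => [|n IH]; first by rewrite /Ys /= mulr0 mul0r.
rewrite YsS mulZr mulZl mulrDr mulrDl h; congr (_ *: (_ + _)).
by rewrite mulrA IH -mulrA IH mulrA.
Qed.

Let Ys_comm2 S m n : Ys S m * Ys S n = Ys S n * Ys S m.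
Proof. by apply: Ys_comm; apply/esym/Ys_comm. Qed.

Let Ys_bnd S n : bnd 1 S -> bnd (ys n ^+ 2) (Ys S n).
Proof.
move=> hS; elim: n => [|n IH]; first by move=> u; rewrite (_ : Ys S 0 u = 0) // q0 mulr_ge0 ?sqr_ge0 ?q_ge0.
rewrite YsS [ys _]/= -/(ys n) exprMn -(cm_real (2^-1)); apply: bndZ.
apply: bndD => //; first exact: sqr_ge0.
  by rewrite expr1n.
by rewrite [X in bnd X]expr2; apply: bndM => //; exact: sqr_ge0.
Qed.

Let Ys_diff S n : bnd 1 S -> bnd ((ys n.+1 - ys n) ^+ 2) (Ys S n.+1 - Ys S n).
Proof.
move=> hS; elim: n => [|n IH].
  by rewrite (_ : ys 0 = 0) // (_ : Ys S 0 = 0) // !subr0; exact: Ys_bnd.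
have -> : ys n.+2 - ys n.+1 = 2^-1 * ((ys n.+1 + ys n) * (ys n.+1 - ys n)).
  have h1 : ys n.+2 = 2^-1 * (1 + ys n.+1 ^+ 2) by [].
  have h2 : ys n.+1 = 2^-1 * (1 + ys n ^+ 2) by [].
  by move: (ys n.+2) (ys n.+1) (ys n) h1 h2 => a b c -> hb; lra.
have -> : Ys S n.+2 - Ys S n.+1 =
    (2^-1)%:C *: ((Ys S n.+1 + Ys S n) * (Ys S n.+1 - Ys S n)).
  rewrite (YsS S n.+1) {2}(YsS S n) -scalerBr opprD addrACA subrr add0r; congr (_ *: _).
  by rewrite mulrDl !mulrBr (Ys_comm2 S n n.+1) addrA subrK.
rewrite !exprMn -(cm_real (2^-1)); apply: bndZ; apply: bndM => //; first exact: sqr_ge0.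
have /andP[a0 _] := ys01 n.+1; have /andP[c0 _] := ys01 n.
by apply: bndD => //; exact: Ys_bnd.
Qed.

Let Ys_diffn S n k : bnd 1 S -> bnd ((ys (n + k) - ys n) ^+ 2) (Ys S (n + k) - Ys S n).
Proof.
move=> hS; elim: k => [|k IH].
  by rewrite addn0 !subrr expr0n => u; rewrite op0 q0 mul0r.
rewrite addnS -[_ - ys n](subrKA (ys (n + k))) -[_ - Ys S n](subrKA (Ys S (n + k))).
have mono i : ys n <= ys (n + i).
  by elim: i => [|i h]; [rewrite addn0|rewrite addnS; apply: le_trans h _].
by apply: bndD; rewrite ?subr_ge0 //; exact: Ys_diff.
Qed.

Lemma sqrt_aux S : posop S -> posop (1 - S) -> exists Y, [/\ adj Y = Y, bnd 1 Y,
  Y + Y = S + Y * Y & forall y, y * S = S * y -> y * Y = Y * y].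
Proof.
move=> pS pS1; have hS := posop_contr pS pS1.
have b1 n : bnd 1 (Ys S n).
  by apply: bnd_le (Ys_bnd n hS); have := ys01 n; nra.
have [||Y bY YsY] := @slim _ _ (Ys S) 1 ler01 => //.
  move=> u e e0; have qu := q_ge0 u.
  pose d := Num.min 1 (e / (q u + 1)).
  have ep : 0 < e / (q u + 1) by rewrite divr_gt0 //; lra.
  have d0 : 0 < d by rewrite lt_min ltr01 ep.
  have d1 : d <= 1 by rewrite ge_min lexx.
  have d2 : d * (q u + 1) <= e.
    by rewrite -ler_pdivlMr; [rewrite ge_min lexx orbT|lra].
  have [N hN] := monotone_cauchy ysS_ge (fun n => proj2 (andP (ys01 n))) d0.
  exists N => m n; wlog nm : m n / (n <= m)%N.
    move=> W; have /orP[h|h] := leq_total n m; first exact: W.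
    by move=> h1 h2; rewrite qBC; exact: W.
  move=> Nm Nn; have /andP[h1 h2] : 0 <= ys m - ys n < d by apply: hN; rewrite Nn.
  rewrite -(subnKC nm) in h1 h2 *.
  have := Ys_diffn n (m - n) hS u; rewrite opB.
  move: (ys _ - _) h1 h2 => a a0 ad h.
  have a2 : a ^+ 2 <= d by nra.
  apply: le_lt_trans h _; nra.
have sY : adj Y = Y.
  apply: slim_sa YsY => n; elim: n => [|n IH]; first exact: adj0.
  by rewrite YsS adjZ adjD adjM IH (posop_sa pS) conj_real.
exists Y; split=> //; last first.
  by move=> y h; apply: slim_comm YsY => n; exact: Ys_comm.
apply: bop_ext => u.
have c1 : qcv (fun n => (2^-1)%:C *: (S u + (Ys S n * Ys S n) u)) ((2^-1)%:C *: (S u + (Y * Y) u)).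
  apply: qcvZ; apply: qcvD; first exact: qcv_cst.
  exact: (slim_mul ler01 b1 YsY YsY u).
have c2 : qcv (fun n => (2^-1)%:C *: (S u + (Ys S n * Ys S n) u)) (Y u).
  by move=> e /(YsY u)[N hN]; exists N => n Nn; exact: (hN n.+1 (leqW Nn)).
rewrite !opD (qcv_uniq c2 c1) -scalerDl.
have -> : (2^-1)%:C + (2^-1)%:C = 1 :> R[i].
  by rewrite -rmorphD /= -(rmorph1 (real_complex R)); congr _%:C; field.
by rewrite scale1r.
Qed.

Lemma sa_posop x : adj x = x -> (forall u, 0 <= complex.Re '[x u, u]) -> posop x.
Proof.
move=> sx h u; have := h u; have : '[x u, u] = ('[x u, u])^* by rewrite -inC -{1}sx adjP'.
case: ('[x u, u]) => a b /= /eqP; rewrite eq_complex /= => /andP[_ /eqP e] a0.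
by rewrite lecE /= a0 andbT; apply/eqP; lra.
Qed.

(** After scaling to [X' <= 1], [sqrt_aux] with [S = 1 - X'] gives a [Y] with [(1 - Y)^2 = X']. The
    commutation clause is what later places the root in the algebra of [X]. *)
Lemma sqrt_ex X : posop X -> exists r, [/\ posop r, r * r = X &
  forall y, y * X = X * y -> y * r = r * y].
Proof.
move=> pX; have [K K0 bX] := bop_bnd X.
have Xle u : complex.Re '[X u, u] <= (K + 1) * q u.
  have qu := q_ge0 u; have := posopRe pX u; have := Re_le_cm '[X u, u].
  have := cauchy_schwarz (X u) u; have := bX u.
  move: (complex.Re _) (cm _) (q (X u)) => a c b h1 h2 h3 h4.
  have h5 : a ^+ 2 <= K * q u ^+ 2 by nra.
  have h6 : a ^+ 2 <= ((K + 1) * q u) ^+ 2 by nra.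
  by rewrite -ler_sqr ?nnegrE // mulr_ge0 //; lra.
have k0 : 0 < K + 1 by lra.
pose X' := ((K + 1)^-1)%:C *: X.
have pX' : posop X' by apply: posopZ => //; rewrite invr_ge0 ltW.
have p1 : posop (1 - X').
  apply: sa_posop; first by rewrite adjB adj1 posop_sa.
  move=> u; rewrite opB inBl op1 inq opZ inZl ReD ReN ReZ subr_ge0 /=.
  by rewrite mulrC ler_pdivrMr // mulrC Xle.
have [Y [sY bY YY cY]] : exists Y, [/\ adj Y = Y, bnd 1 Y,
  Y + Y = 1 - X' + Y * Y & forall y, y * (1 - X') = (1 - X') * y -> y * Y = Y * y].
  by apply: sqrt_aux => //; rewrite opprB addrC subrK.
pose c := Num.sqrt (K + 1).
have c2 : c%:C * c%:C = (K + 1)%:C :> R[i] by rewrite -rmorphM /= -expr2 sqr_sqrtr ?ltW.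
exists (c%:C *: (1 - Y)); split.
- apply: posopZ; first exact: sqrtr_ge0.
  apply: sa_posop; first by rewrite adjB adj1 sY.
  move=> u; rewrite opB inBl inq ReD ReN subr_ge0 /=.
  have := rp_le (Y u) u ltr01; have := bY u; rewrite /rp invr1; lra.
- rewrite mulZl mulZr scalerA c2.
  have -> : (1 - Y) * (1 - Y) = X'.
    rewrite mulrBl !mulrBr !mul1r mulr1 opprB addrACA -opprD YY opprD opprB addrACA.
    by rewrite subrr addr0 addrC subrK.
  by rewrite scalerA -rmorphM /= divff ?gt_eqF // scale1r.
- move=> y h; rewrite mulZr mulZl; congr (_ *: _).
  rewrite mulrBr mulrBl mulr1 mul1r cY // mulrBr mulrBl mulr1 mul1r.
  by rewrite mulZl mulZr h.
Qed.

End square_root.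

Section polar.
Context {R : realType} {H : hilbertType R}.
Implicit Types (u v w l : H) (x y z o r : bop H) (C : set (bop H)).
Local Notation "''[' u , v ]" := (inner u v).

Definition star C := forall x, C x -> C (adj x).

Lemma comm_adj x y : adj y * x = x * adj y -> y * adj x = adj x * y.
Proof. by move=> h; rewrite -{1}[y]adjK -adjM -h adjM adjK. Qed.

(** With [r = |z|], the vectors [r u] and [z u] have the same norm, so [r u |-> z u] extends to a
    partial isometry [o]. Elements of a star-closed set commuting with [z] preserve this relation
    together with their adjoints, hence commute with [o]. *)
Lemma polar z : exists r o, [/\ posop r, r * r = adj z * z, o * r = z, adj o * z = r &
  bnd 1 o] /\ [/\ o * adj o * o = o, forall w, z w = 0 -> o w = 0,
  forall w, adj z w = 0 -> adj o w = 0 &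
  forall C, star C -> commutant C z -> commutant C r /\ commutant C o].
Proof.
have [r [pr rr cr]] := sqrt_ex (@posop_adj_mul _ _ z).
have sr := posop_sa pr.
have in_rz u v : '[r u, r v] = '[z u, z v].
  by rewrite -{1}sr adjP' -opM rr opM -adjP.
pose D := [set p : H * H | exists u, p = (r u, z u)].
have D1 : linrel D.
  split; first by exists 0; rewrite !b0.
  by move=> a _ _ [u ->] [v ->]; exists (a *: u + v); rewrite !bD !bZ.
have [|o [bo oD o0 oR oC]] := ext_op ler01 D1.
  by move=> _ [u ->]; rewrite mul1r /q in_rz.
have or : o * r = z by apply: bop_ext => u; apply: (oD (r u, z u)); exists u.
have o0' w : (forall u, '[w, r u] = 0) -> o w = 0.
  by move=> h; apply: o0 => _ [u ->]; exact: h.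
have oz : adj o * z = r.
  apply: bop_ext => u; apply/eqP; rewrite -subr_eq0; apply/eqP; rewrite opM.
  set w := _ - _; have wr v : '[w, r v] = 0.
    by rewrite /w inBl adjP' -opM or in_rz subrr.
  apply: q_eq0; rewrite /q {2}/w inBr wr -adjP o0' // in0l subrr //.
exists r, o; split; split=> //.
- apply: bop_ext => u; apply/eqP; rewrite -subr_eq0 !opM -bB; apply/eqP/o0' => v.
  by rewrite inBl adjP' -(opM o r v) or adjP -opM oz subrr.
- move=> w zw; apply: o0' => u; rewrite -sr -adjP.
  have -> : r w = 0 by apply: q_eq0; rewrite /q in_rz zw in0l.
  by rewrite in0l.
- move=> w zw; apply: in_ext => u; rewrite in0l adjP' inC oR ?conjC0 //.
  by move=> _ [v ->] /=; rewrite adjP zw in0r.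
- move=> C sC zC; have rC : commutant C r.
    move=> y Cy; apply: cr; rewrite mulrA comm_adj; last by apply: zC; exact: sC.
    by rewrite -!mulrA zC.
  split=> // y Cy; apply: oC.
    move=> _ [u ->]; exists (y u); rewrite /= -!opM zC // rC //.
  move=> _ [u ->]; exists (adj y u); have Cy' := sC _ Cy.
  by rewrite /= -!opM zC // rC.
Qed.

End polar.

Lemma invS_small {R : realType} (e : R) : 0 < e ->
  exists N, forall n, (N <= n)%N -> (n.+1%:R^-1 : R) < e.
Proof.
move=> e0; exists (Num.truncn e^-1).+1 => n Nn.
rewrite invf_plt ?posrE //; apply: lt_trans (truncnS_gt _) _.
by rewrite ltr_nat ltnS.
Qed.

(** * Factors and their commutants *)

Section commuting_pairs.
Context {R : realType} {H : hilbertType R}.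
Implicit Types (u v w l xi : H) (x y z e f p : bop H) (A B C : set (bop H)).
Local Notation "''[' u , v ]" := (inner u v).

Lemma commutantM C x y : commutant C x -> commutant C y -> commutant C (x * y).
Proof. by move=> hx hy a Ca; rewrite mulrA hx // -mulrA hy // mulrA. Qed.

Lemma commutantD C x y : commutant C x -> commutant C y -> commutant C (x + y).
Proof. by move=> hx hy a Ca; rewrite mulrDl mulrDr hx // hy. Qed.

Lemma commutantN C x : commutant C x -> commutant C (- x).
Proof. by move=> hx a Ca; rewrite mulNr mulrN hx. Qed.

Lemma commutantB C x y : commutant C x -> commutant C y -> commutant C (x - y).
Proof. by move=> hx hy; apply: commutantD => //; exact: commutantN. Qed.

Lemma commutantZ C c x : commutant C x -> commutant C (c *: x).
Proof. by move=> hx a Ca; rewrite mulZl mulZr hx. Qed.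

Lemma commutant1 C : commutant C 1.
Proof. by move=> a Ca; rewrite mul1r mulr1. Qed.

Lemma commutant0 C : commutant C 0.
Proof. by move=> a Ca; rewrite mul0r mulr0. Qed.

Lemma star_commutant C : star C -> star (commutant C).
Proof. by move=> sC x Cx a Ca; apply/comm_adj/Cx/sC. Qed.

(** Stated symmetrically, so that every result on a pair also holds with the two algebras
    exchanged. *)
Definition cpair A B := [/\ star A, star B, commutant A = B & commutant B = A].

Lemma cpair_sym A B : cpair A B -> cpair B A.
Proof. by case. Qed.

Definition proj e := e * e = e /\ adj e = e.

Lemma projE e : projection e <-> proj e.
Proof.
split=> -[ee ea]; split=> //; first exact: adj_uniq.
by move=> u v; rewrite adjP ea.
Qed.

Lemma proj_bnd e : proj e -> bnd 1 e.
Proof.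
move=> [ee ea] u; rewrite mul1r -{2}[u](subrK (e u)) qD.
have -> : rp (u - e u) (e u) = 0.
  by rewrite /rp -{2}ea -adjP bB -opM ee subrr in0l.
by rewrite mul0rn addr0 lerDr q_ge0.
Qed.

Lemma proj_q e u : proj e -> q (e u) = complex.Re '[e u, u].
Proof. by move=> [ee ea]; rewrite q_adj ea ee. Qed.

Lemma projC e : proj e -> proj (1 - e).
Proof.
move=> [ee ea]; split; last by rewrite adjB adj1 ea.
by rewrite mulrBr mulr1 mulrBl mul1r ee subrr subr0.
Qed.

Lemma posop_proj e : proj e -> posop e.
Proof. by move=> [ee ea]; have := posop_adj_mul e; rewrite ea ee. Qed.

Section pair.
Variables A B : set (bop H).
Hypothesis AB : cpair A B.

Lemma cpairC x y : A x -> B y -> x * y = y * x.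
Proof. by case: AB => _ _ <- _ Ax By; exact: By. Qed.

Lemma cpairCv x y u : A x -> B y -> x (y u) = y (x u).
Proof. by move=> Ax By; rewrite -!opM cpairC. Qed.

Lemma cpairM x y : A x -> A y -> A (x * y).
Proof. by case: AB => _ _ _ <-; exact: commutantM. Qed.
Lemma cpairD x y : A x -> A y -> A (x + y).
Proof. by case: AB => _ _ _ <-; exact: commutantD. Qed.
Lemma cpairB x y : A x -> A y -> A (x - y).
Proof. by case: AB => _ _ _ <-; exact: commutantB. Qed.
Lemma cpairZ c x : A x -> A (c *: x).
Proof. by case: AB => _ _ _ <-; exact: commutantZ. Qed.
Lemma cpair1 : A 1.
Proof. by case: AB => _ _ _ <-; exact: commutant1. Qed.
Lemma cpair0 : A 0.
Proof. by case: AB => _ _ _ <-; exact: commutant0. Qed.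
Lemma cpair_adj x : A x -> A (adj x).
Proof. by case: AB => sA _ _ _; exact: sA. Qed.
Lemma cpairI x : (forall y, B y -> y * x = x * y) -> A x.
Proof. by case: AB => _ _ _ <- h y By; exact: h. Qed.
Lemma cpair_sum (I : Type) (s : seq I) (P : pred I) (F : I -> bop H) :
  (forall i, A (F i)) -> A (\sum_(i <- s | P i) F i).
Proof.
move=> h; elim/big_rec: _ => [|i x _ Ax]; first exact: cpair0.
exact: cpairD.
Qed.

(** The projection onto the closure of [B xi] commutes with [B], because the orbit is invariant
    under [B] and its adjoints; it therefore lies in [A]. *)
Lemma cyc_proj xi : exists2 p, A p /\ proj p & [/\ forall b, B b -> p (b xi) = b xi,
  p xi = xi & forall w, (forall b, B b -> '[w, b xi] = 0) -> p w = 0].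
Proof.
have BA := cpair_sym AB; case: (AB) => sA sB cA cB.
pose S := [set b xi | b in B].
have sS : subspace S.
  split; first by exists 0 => //; rewrite -cA; exact: commutant0.
  move=> a _ _ [b Bb <-] [c Bc <-]; exists (a *: b + c) => //.
  by rewrite -cA in Bb Bc *; apply: commutantD => //; exact: commutantZ.
have [p [pp pa pS p0 pC]] := proj_ex sS.
exists p; split=> //.
- rewrite -cB => y By; apply: pC => _ [b Bb <-].
    by exists (y * b) => //; rewrite -cA in By Bb *; exact: commutantM.
  by exists (adj y * b) => //; have := sB _ By; rewrite -cA in Bb * => ?; exact: commutantM.
- by move=> b Bb; apply: pS; exists b.
- by apply: pS; exists 1 => //; rewrite -cA; exact: commutant1.
- by move=> w hw; apply: p0 => _ [b Bb <-]; exact: hw.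
Qed.

End pair.

Definition scalar_center A B := forall c, A c -> B c -> exists k : R[i], c = k *: (1 : bop H).

(** The double orthogonal complement of [X] is invariant under [A] and [B], so its projection
    commutes with both and is central, that is a scalar. It fixes a nonzero vector, so the scalar is
    1. *)
Lemma factor_total A B (X : set H) : cpair A B -> scalar_center A B ->
  (forall x u, A x -> X u -> X (x u)) -> (forall x u, B x -> X u -> X (x u)) ->
  (exists2 u, X u & u != 0) -> forall w, (forall u, X u -> '[w, u] = 0) -> w = 0.
Proof.
move=> AB sc XA XB [u0 Xu0 u00] w hw.
pose P := [set w | forall u, X u -> '[w, u] = 0].
pose S := [set s | forall w, P w -> '[s, w] = 0].
have sS : subspace S.
  split; first by move=> v _; rewrite in0l.
  by move=> a u v Su Sv v' Pv; rewrite inDl inZl Su // Sv // mulr0 addr0.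
have inv x : A x \/ B x -> A (adj x) \/ B (adj x).
  by case: AB => sA sB _ _ [h|h]; [left; exact: sA|right; exact: sB].
have Sinv x : A x \/ B x -> forall s, S s -> S (x s).
  move=> hx s Ss v Pv; rewrite adjP; apply: Ss => u Xu.
  by rewrite adjP'; apply: Pv; case: hx => h; [exact: XA|exact: XB].
have [p [pp pa pS p0 pC]] := proj_ex sS.
have Ap : A p.
  case: AB => _ _ _ <- y By; apply: pC; apply: Sinv; first by right.
  by apply: inv; right.
have Bp : B p.
  case: AB => _ _ <- _ y Ay; apply: pC; apply: Sinv; first by left.
  by apply: inv; left.
have [k pk] := sc _ Ap Bp.
have Su0 : S u0 by move=> v Pv; rewrite inC Pv // conjC0.
have k1 : k = 1.
  have := pS _ Su0; rewrite pk opZ op1 => /eqP; rewrite -subr_eq0 -{2}[u0]scale1r -scalerBl.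
  by rewrite scaler_eq0 (negbTE u00) orbF subr_eq0 => /eqP.
have := p0 w; rewrite pk k1 scale1r; apply => s Ss.
by rewrite inC Ss ?conjC0.
Qed.

(** Otherwise the range of [f] would be orthogonal to all vectors [a e u], which are total by
    [factor_total]. *)
Lemma factor_link A B e f : cpair A B -> scalar_center A B -> A e -> A f -> proj e -> proj f ->
  e != 0 -> f != 0 -> exists2 a, A a & f * a * e != 0.
Proof.
move=> AB sc Ae Af [ee ea] [ff fa] e0 f0; apply: contrapT => nex.
have h a : A a -> f * a * e = 0.
  by move=> Aa; apply: contrapT => /eqP h; apply: nex; exists a.
have ex x : x != 0 -> exists u, x u != 0.
  move=> x0; apply: contrapT => n; case/eqP: x0; apply: bop_ext => u; apply/eqP.
  by apply: contrapT => /negP xu; apply: n; exists u.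
have [v fv] := ex _ f0; have [u eu] := ex _ e0.
pose X := [set a (e u') | a in A & u' in setT].
case/eqP: fv; apply: (@factor_total A B X) => //.
- by move=> x _ Ax [a Aa [u' _ <-]]; exists (x * a); [exact: (cpairM AB)|exists u'].
- move=> x _ Bx [a Aa [u' _ <-]]; exists a => //; exists (x u') => //.
  by rewrite (cpairCv AB _ Ae Bx) (cpairCv AB _ Aa Bx).
- by exists ((1 : bop H) (e u)) => //; exists 1; [exact: (cpair1 AB)|exists u].
- move=> _ [a Aa [u' _ <-]]; rewrite -{1}fa adjP'.
  by have := congr1 (fun t : bop H => t u') (h _ Aa); rewrite !opM => ->; rewrite in0r.
Qed.

(** Project [chi] onto the closure of [S]. The remainder is orthogonal to [S], hence killed by [r];
    applying the contraction [r], which fixes [S], brings any approximation of the projected vector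
    back to [chi]. *)
Lemma dense_proj (S : set H) r chi (eps : R) : subspace S -> proj r ->
  (forall w, (forall u, S u -> '[w, u] = 0) -> r w = 0) -> (forall u, S u -> r u = u) ->
  r chi = chi -> 0 < eps -> exists2 s, S s & q (chi - s) < eps.
Proof.
move=> sS pr hS rS rchi eps0.
pose E := [set l | forall e : R, 0 < e -> exists2 s, S s & q (l - s) < e].
have SE s : S s -> E s by move=> Ss e e0; exists s => //; rewrite subrr q0.
have sE : subspace E.
  split; first by apply: SE; case: sS.
  move=> a u v Eu Ev e e0; have c0 := cm_ge0 a.
  have [|s Ss hs] := Eu (e / (4 * (cm a + 1))); first by rewrite divr_gt0 //; lra.
  have [|t St ht] := Ev (e / 4); first by lra.
  exists (a *: s + t); first by case: sS => _; apply.
  rewrite opprD addrACA -scalerBr; rewrite ltr_pdivlMr in hs; last lra.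
  have := qD_le2 (a *: (u - s)) (v - t); rewrite qZ.
  have := q_ge0 (u - s); nra.
have cE : qclosed E.
  move=> s l Es sl e e0; have [|N /(_ _ (leqnn N)) hN] := sl (e / 4); first lra.
  have [|t St ht] := Es N (e / 4); first lra.
  exists t => //; have := qD_le2 (l - s N) (s N - t).
  by rewrite addrA subrK qBC; lra.
have [p Ep hp] := projection_theorem chi sE cE.
have : r (chi - p) = 0 by apply: hS => u Su; apply: hp; exact: SE.
rewrite bB rchi => /eqP; rewrite subr_eq0 => /eqP e.
have [s Ss hs] := Ep _ eps0; exists s => //.
rewrite e -(rS _ Ss) -bB; apply: le_lt_trans hs.
by have := proj_bnd pr (p - s); rewrite mul1r.
Qed.

Lemma dense_perp (S : set H) chi (eps : R) : subspace S ->
  (forall w, (forall u, S u -> '[w, u] = 0) -> w = 0) -> 0 < eps ->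
  exists2 s, S s & q (chi - s) < eps.
Proof.
move=> sS hS; apply: (dense_proj (r := 1)) => //.
by split; [rewrite mulr1|exact: adj1].
Qed.

Lemma rank1_ex (f h : H) : exists x : bop H, forall u, x u = '[u, f] *: h.
Proof.
apply: (@mkbop _ _ _ (q f * q h)).
  by move=> a u v; rewrite inDl inZl scalerDl scalerA.
move=> u; rewrite qZ [_ * q u]mulrC mulrA; apply: ler_wpM2r; first exact: q_ge0.
exact: cauchy_schwarz.
Qed.

(* |h><f| *)
Definition rank1 (h f : H) : bop H := sval (cid (rank1_ex f h)).

Lemma rank1E (h f u : H) : rank1 h f u = '[u, f] *: h.
Proof. by rewrite /rank1; case: cid. Qed.

Lemma q_le_dense (S : set H) (d : H) (M : R) : 0 <= M ->
  (forall e : R, 0 < e -> exists2 s, S s & q (d - s) < e) ->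
  (forall s, S s -> cm '[d, s] <= M * q s) -> q d <= M.
Proof.
move=> M0 dS hS; have [->|d0] := eqVneq d 0; first by rewrite q0.
have qd := q_gt0 d0.
have ex n : exists s, S s /\ q (d - s) < n.+1%:R^-1.
  by have [|s Ss hs] := dS n.+1%:R^-1; [rewrite invr_gt0|exists s].
pose s n := sval (cid (ex n)).
have sP n : S (s n) /\ q (d - s n) < n.+1%:R^-1 by rewrite /s; case: cid.
have sd : qcv s d.
  move=> e e0; have [N hN] := invS_small e0; exists N => n /hN.
  by rewrite qBC; apply: lt_trans; case: (sP n).
have Mq : 0 <= M * q d by rewrite mulr_ge0 // ltW.
(* Writing the functional ['[_, d]] as the operator [rank1 d d] lets the bound pass to the limit
   [s n -> d]. *)
have : q (rank1 d d d) <= M * q d * q d.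
  apply: qcv_le2 Mq sd (qcv_bop (rank1 d d) sd) _ => n.
  rewrite rank1E qZ inC cmJ mulrC [X in _ <= X]mulrAC [X in _ <= X]mulrC.
  by apply: ler_wpM2l; [exact: ltW|apply: hS; case: (sP n)].
rewrite rank1E qZ inq cm_real => h; rewrite -(ler_pM2r (mulr_gt0 qd qd)); lra.
Qed.

End commuting_pairs.

(** A countable substitute for Zorn's lemma: each step moves to an element above the current one
    that nearly minimizes [F] there. If the chain has a limit at which [F] is continuous, that limit
    minimizes [F] among the elements above it. *)
Lemma greedy_chain {R : realType} (T : Type) (P : set T) (le : T -> T -> Prop)
  (F : T -> R) (M : R) (x0 : T) : P x0 -> (forall x, P x -> le x x) ->
  (forall x, P x -> M <= F x) ->
  exists x : nat -> T, [/\ x 0%N = x0, forall n, P (x n), forall n, le (x n) (x n.+1),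
    forall n, F (x n.+1) <= F (x n) &
    forall n y, P y -> le (x n) y -> F (x n.+1) <= F y + n.+1%:R^-1].
Proof.
move=> Px0 ler PM.
have step n x : exists y, P x -> [/\ P y, le x y, F y <= F x &
    forall z, P z -> le x z -> F y <= F z + n.+1%:R^-1].
  have [Px|nPx] := pselect (P x); last by exists x.
  pose S := [set F z | z in [set z | P z /\ le x z]].
  have Sx : S (F x) by exists x => //; split=> //; exact: ler.
  have iS : has_inf S.
    by split; [exists (F x)|exists M => _ [z [Pz _] <-]; exact: PM].
  have [|_ [y [Py xy] <-] hy] := @inf_adherent R S n.+1%:R^-1 _ iS.
    by rewrite invr_gt0.
  have inf_le z : P z -> le x z -> inf S <= F z.
    by move=> Pz xz; apply: ge_inf; [case: iS|exists z].
  (* If the near-minimizer is worse than the current element, the latter is kept, so that [F] never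
     increases. *)
  have [h|h] := leP (F y) (F x).
    exists y => _; split=> // z Pz xz; apply: le_trans (ltW hy) _.
    by rewrite lerD2r; exact: inf_le.
  exists x => _; split=> //; first exact: ler.
  move=> z Pz xz; apply: le_trans (ltW h) _; apply: le_trans (ltW hy) _.
  by rewrite lerD2r; exact: inf_le.
pose f n x := sval (cid (step n x)).
have fP n x : P x -> [/\ P (f n x), le x (f n x), F (f n x) <= F x &
    forall z, P z -> le x z -> F (f n x) <= F z + n.+1%:R^-1].
  by rewrite /f; case: cid.
pose s := fix s n := if n is m.+1 then f m (s m) else x0.
have Ps n : P (s n) by elim: n => //= n /(fP n)[].
by exists s; split=> // n; case: (fP n _ (Ps n)).
Qed.

(** * Trace vectors *)

Section partial_isometries.
Context {R : realType} {H : hilbertType R}.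
Implicit Types (u v xi eta : H) (w o p e : bop H) (A B C : set (bop H)).
Local Notation "''[' u , v ]" := (inner u v).

Definition pisom w := w * adj w * w = w.

Lemma pisom_adj w : pisom w -> pisom (adj w).
Proof. by rewrite /pisom => h; rewrite -{4}h !adjM adjK mulrA. Qed.

Lemma pisom_init w : pisom w -> proj (adj w * w).
Proof.
by move=> h; split; [rewrite -mulrA [w * _]mulrA h|rewrite adjM adjK].
Qed.

Lemma pisom_final w : pisom w -> proj (w * adj w).
Proof. by move=> /pisom_adj/pisom_init; rewrite adjK. Qed.

Lemma q_init w u : pisom w -> q (w u) = q ((adj w * w) u).
Proof. by move=> h; rewrite q_adj proj_q //; exact: pisom_init. Qed.

Lemma pisom_bnd w : pisom w -> bnd 1 w.
Proof. by move=> h u; rewrite q_init //; apply/proj_bnd/pisom_init. Qed.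

Lemma proj_pisom e : proj e -> pisom e.
Proof. by move=> [ee ea]; rewrite /pisom ea !ee. Qed.

(** The extension order: [w'] agrees with [w] on the initial space of [w], and [adj w'] with [adj w]
    on its final space. *)
Definition ple w w' := w' * (adj w * w) = w /\ (w * adj w) * w' = w.

Lemma ple_refl w : pisom w -> ple w w.
Proof. by move=> h; split=> //; rewrite mulrA. Qed.

Lemma ple_adj w w' : ple w w' -> ple (adj w) (adj w').
Proof.
move=> [h1 h2]; split; rewrite adjK.
  by rewrite -[RHS](congr1 adj h2) adjM [adj (w * _)]adjM adjK.
by rewrite -[RHS](congr1 adj h1) adjM [adj (adj w * _)]adjM adjK.
Qed.

Lemma ple_trans_l w1 w2 w3 : pisom w1 -> ple w1 w2 -> ple w2 w3 -> w3 * (adj w1 * w1) = w1.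
Proof.
move=> p1 [h1 h2] [h3 h4].
have e : adj w2 * w1 = adj w1 * w1.
  have <- : adj w2 * (w1 * adj w1) = adj w1.
    by rewrite -[RHS](congr1 adj h2) adjM [adj (w1 * _)]adjM adjK.
  by rewrite -!mulrA [w1 * _]mulrA p1.
rewrite -e -{1}h1 [adj w2 * _]mulrA mulrA h3.
exact: h1.
Qed.

Lemma ple_trans w1 w2 w3 : pisom w1 -> ple w1 w2 -> ple w2 w3 -> ple w1 w3.
Proof.
move=> p1 h1 h2; split; first exact: ple_trans_l h1 h2.
have := ple_trans_l (pisom_adj p1) (ple_adj h1) (ple_adj h2).
by move=> /(congr1 adj); rewrite !adjM !adjK.
Qed.

Lemma ple_q w w' u : pisom w -> ple w w' -> q (w' u - w u) = q (w' u) - q (w u).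
Proof.
move=> p1 [_ h]; have e : w u = (w * adj w) (w' u) by rewrite -opM h.
rewrite qB e rpC /rp -proj_q; last exact: pisom_final.
by rewrite mulr2n opprD addrA addrK.
Qed.

Definition finproj A p := forall v : bop H, A v -> adj v * v = p -> p * (v * adj v) = v * adj v ->
  v * adj v = p.

(** Along the chain [q (V n u)] increases, and by [ple_q] its increments are the squared distances.
    The same holds for the adjoints, so both sequences converge strongly and the algebraic relations
    survive in the limit. *)
Lemma pisom_chain_limit (V : nat -> bop H) : (forall n, pisom (V n)) ->
  (forall n, ple (V n) (V n.+1)) ->
  exists W : bop H, [/\ pisom W, forall u, qcv (fun n => V n u) (W u),
    forall u, qcv (fun n => adj (V n) u) (adj W u) & forall n, ple (V n) W].
Proof.
move=> pV lV; have lVn n k : ple (V n) (V (n + k)%N).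
  elim: k => [|k IH]; first by rewrite addn0; exact: ple_refl.
  by rewrite addnS; exact: ple_trans IH (lV _).
have cau (X : nat -> bop H) : (forall n, pisom (X n)) ->
    (forall n k, ple (X n) (X (n + k)%N)) -> forall u, qcauchy (fun n => X n u).
  move=> pX lX u.
  have mono n : q (X n u) <= q (X n.+1 u).
    by rewrite -subr_ge0 -ple_q ?q_ge0 // -addn1.
  have ub n : q (X n u) <= q u by have := pisom_bnd (pX n) u; rewrite mul1r.
  move=> e e0; have [N hN] := monotone_cauchy mono ub e0; exists N => m n.
  wlog nm : m n / (n <= m)%N.
    move=> W; have /orP[h|h] := leq_total n m; first exact: W.
    by move=> h1 h2; rewrite qBC; exact: W.
  move=> _ Nn; have := hN m n; rewrite Nn nm => /(_ isT)/andP[_].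
  by rewrite -(subnKC nm) -ple_q.
have bV n : bnd 1 (V n) by exact: pisom_bnd.
have [W bW VW] := slim ler01 bV (cau _ pV lVn).
have bV' n : bnd 1 (adj (V n)) by apply/pisom_bnd/pisom_adj.
have [W' bW' VW'] := slim ler01 bV' (cau _ (fun n => pisom_adj (pV n)) (fun n k => ple_adj (lVn n k))).
have eW := slim_adj VW VW'; rewrite eW in VW' bW'.
exists W; split=> //.
  apply: bop_ext => u.
  have h1 := slim_mul ler01 bV VW VW'.
  have h2 := @slim_mul _ _ (fun n => V n * adj (V n)) V _ _ 1 ler01 _ h1 VW u.
  apply: (qcv_uniq (s := fun n => (V n * adj (V n) * V n) u)).
    by apply: h2 => n; apply/proj_bnd/pisom_final.
  by rewrite (_ : (fun n => _) = (fun n => V n u)) //; apply/funext => n; rewrite (pV n).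
move=> n; split; apply: bop_ext => u.
  apply: (qcv_uniq (s := fun k => V (n + k)%N ((adj (V n) * V n) u))).
    by move=> e /(VW ((adj (V n) * V n) u))[N hN]; exists N => k Nk; apply: hN; exact: leq_trans (leq_addl _ _).
  rewrite (_ : (fun n => _) = (fun k => V n u)); first exact: qcv_cst.
  by apply/funext => k; rewrite -opM; case: (lVn n k) => ->.
apply: (qcv_uniq (s := fun k => (V n * adj (V n)) (V (n + k)%N u))).
  rewrite opM; apply: qcv_bop => e /(VW u)[N hN]; exists N => k Nk.
  by apply: hN; exact: leq_trans (leq_addl _ _).
rewrite (_ : (fun n => _) = (fun k => V n u)); first exact: qcv_cst.
by apply/funext => k; rewrite -opM; case: (lVn n k) => _ ->.
Qed.

End partial_isometries.

Section exhaustion.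
Context {R : realType} {H : hilbertType R}.
Implicit Types (u v xi eta : H) (w o p e : bop H) (A B C : set (bop H)).
Local Notation "''[' u , v ]" := (inner u v).

Lemma qcv_qabs (s : nat -> H) l : qcv s l -> forall e : R, 0 < e ->
  exists N, forall n, (N <= n)%N -> `|q (s n) - q l| <= e.
Proof.
move=> sl e e0; have [N1 h1] := qcv_q sl e0; have [N2 h2] := qcv_q_ge sl e0.
exists (maxn N1 N2) => n; rewrite geq_max => /andP[/h1 a1 /h2 a2].
by rewrite ler_norml; apply/andP; split; lra.
Qed.

Lemma projB p e : proj p -> proj e -> p * e = e -> proj (p - e).
Proof.
move=> [pp pa] [ee ea] pe; have ep : e * p = e by rewrite -{1}ea -{1}pa -adjM pe ea.
split; last by rewrite adjB pa ea.
by rewrite mulrBr !mulrBl pp pe ep ee subrr subr0.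
Qed.

Lemma proj_mulC e x : proj e -> e * x = x -> adj x * e = adj x.
Proof. by move=> [_ ea] h; rewrite -{1}ea -adjM h. Qed.

Lemma polar_corner A B (z : bop H) e f : cpair A B -> A z -> proj e -> proj f ->
  f * z = z -> z * e = z -> exists r o, [/\ A r, A o, posop r & r * r = adj z * z] /\
  [/\ o * r = z, adj o * z = r, pisom o, bnd 1 o & [/\ f * o = o, o * e = o, r * e = r & forall v, z v = 0 -> o v = 0]].
Proof.
move=> AB Az [ee ea] [ff fa] fz ze; case: (AB) => sA sB cA cB.
have [r [ o [[pr rr orz oz bo] [ooo o0 ao0 oC]]]] := polar z.
have [Ar Ao] : A r /\ A o.
  by have := oC B sB; rewrite cB; apply.
exists r, o; split=> //; split=> //; split=> //.
- apply/eqP; rewrite -subr_eq0 -{2}(mul1r o) -mulrBl -[X in X == _]adjK adjM.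
  rewrite (_ : _ * _ = 0) ?adj0 //; apply: bop_ext => u; rewrite opM; apply: ao0.
  by rewrite -opM -adjM mulrBl mul1r fz subrr adj0.
- apply/eqP; rewrite -subr_eq0 -{2}(mulr1 o) -mulrBr; apply/eqP/bop_ext => u.
  by rewrite opM; apply: o0; rewrite -opM mulrBr mulr1 ze subrr.
- by rewrite -oz -mulrA ze.
Qed.

(** Take a partial isometry [W] of the corner of [p] that minimizes
    [F w = a q (adj w eta) + b q (w xi)] among its extensions, starting from 0, so that [F W <= 0].
    By finiteness and the assumption on [F p], [W] leaves room on both sides, and the factor
    property gives a nonzero [o] acting between these leftovers. Extending [W] by [o w] cannot lower
    [F], whence the inequality, with [adj o eta] in place of [eta]. *)
Lemma pisom_exhaust A B p xi eta (a b : R) : cpair A B -> scalar_center A B ->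
  A p -> proj p -> finproj A p -> 0 < a * q (p eta) + b * q (p xi) ->
  exists o, [/\ A o, pisom o, o != 0, p * o = o & o * p = o] /\
    forall w, A w -> pisom w -> w * (adj o * o) = w -> (adj o * o) * w = w ->
    0 <= a * q (adj w (adj o eta)) + b * q (w xi).
Proof.
move=> AB sc Ap pp fp Fp.
pose F w := a * q (adj w eta) + b * q (w xi).
pose P w := [/\ A w, pisom w, p * w = w & w * p = w].
have P0 : P 0.
  by split; rewrite /pisom ?mul0r ?mulr0 //; exact: (cpair0 AB).
have lb w : P w -> - (`|a| * q eta + `|b| * q xi) <= F w.
  move=> [_ piw _ _]; have := pisom_bnd piw xi; have := pisom_bnd (pisom_adj piw) eta.
  rewrite !mul1r; have := q_ge0 (adj w eta); have := q_ge0 (w xi).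
  rewrite /F; move: (q (adj w eta)) (q (w xi)) (q eta) (q xi) => c d c' d' c0 d0 cc dd.
  have := ler_norm (- a); have := ler_norm (- b); rewrite !normrN.
  have := normr_ge0 a; have := normr_ge0 b; nra.
have ler w : P w -> ple w w by move=> [_ piw _ _]; exact: ple_refl.
have [V [V0 PV lV FV mV]] := @greedy_chain _ (bop H) P ple F _ 0 P0 ler lb.
have piV n : pisom (V n) by case: (PV n).
have [W [piW VW VW' lW]] := pisom_chain_limit piV lV.
have PW : P W.
  split=> //.
  - apply: (cpairI AB) => y By; apply: slim_comm VW => n.
    by apply/esym/(cpairC AB) => //; case: (PV n).
  - apply: bop_ext => u; apply: (qcv_uniq (s := fun n => p (V n u))).
      exact: qcv_bop.
    rewrite (_ : (fun n => _) = (fun n => V n u)) //; apply/funext => n.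
    by rewrite -opM; case: (PV n) => _ _ ->.
  - apply: bop_ext => u; apply: (qcv_uniq (s := fun n => V n (p u))).
      exact: VW.
    rewrite (_ : (fun n => _) = (fun n => V n u)) //; apply/funext => n.
    by rewrite -opM; case: (PV n) => _ _ _ ->.
have FW (e : R) : 0 < e -> exists N, forall n, (N <= n)%N -> `|F (V n) - F W| <= e.
  move=> e0; have na := normr_ge0 a; have nb := normr_ge0 b.
  have e' : 0 < e / (`|a| + `|b| + 1) by rewrite divr_gt0 //; lra.
  have [N1 h1] := qcv_qabs (VW' eta) e'; have [N2 h2] := qcv_qabs (VW xi) e'.
  exists (maxn N1 N2) => n; rewrite geq_max => /andP[/h1 a1 /h2 a2].
  rewrite /F opprD addrACA -!mulrBr; apply: le_trans (ler_normD _ _) _; rewrite !normrM.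
  have : e / (`|a| + `|b| + 1) * (`|a| + `|b| + 1) = e by rewrite divfK //; lra.
  move: (e / _) a1 a2 e' => d; nra.
have F0n n : F (V n) <= 0.
  elim: n => [|n IH]; last exact: le_trans (FV n) IH.
  by rewrite V0 /F adj0 !op0 q0 !mulr0 addr0.
have FW0 : F W <= 0.
  apply: lim_eps => e /FW[N /(_ _ (leqnn N))]; rewrite ler_norml => /andP[h _].
  by have := F0n N; lra.
(* Whatever extends [W] extends every [V n], so it competed at step [n] of the chain, up to the
   error [1 / (n + 1)]. *)
have Fmin y : P y -> ple W y -> F W <= F y.
  move=> Py Wy; apply: lim_eps => e e0; have e2 : 0 < e / 2 by lra.
  have [N1 h1] := FW _ e2; have [N2 h2] := invS_small e2.
  have := h1 (maxn N1 N2).+1 (leqW (leq_maxl _ _)); have := h2 _ (leq_maxr N1 N2).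
  have := mV (maxn N1 N2) y Py (ple_trans (piV _) (lW _) Wy).
  move: (_^-1) => d; rewrite ler_norml => h3 h4 /andP[h5 h6]; lra.
case: (PW) => AW _ pW Wp.
set E := adj W * W; set G := W * adj W.
have pE : proj E by exact: pisom_init.
have pG : proj G by exact: pisom_final.
have AE : A E by apply: (cpairM AB) => //; exact: (cpair_adj AB).
have AG : A G by apply: (cpairM AB) => //; exact: (cpair_adj AB).
have paW : p * adj W = adj W by case: pp => _ pa; rewrite -{1}pa -adjM Wp.
have pEE : p * E = E by rewrite mulrA paW.
have pGG : p * G = G by rewrite mulrA pW.
have FWE : F W = a * q (G eta) + b * q (E xi).
  by rewrite /F (q_init _ piW) (q_init _ (pisom_adj piW)) adjK.
(* If [E = p], finiteness gives [G = p], and [F W] would be the number assumed positive. *)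
have Ep : E <> p.
  move=> Ep; have Gp : G = p by apply: fp.
  by move: FW0; rewrite FWE Gp Ep leNgt Fp.
have Gp : G <> p.
  move=> Gp; apply: Ep; rewrite -[E]/(adj W * W) -{2}(adjK W); apply: fp.
  - exact: (cpair_adj AB).
  - by rewrite adjK.
  - by rewrite adjK.
have pe1 : proj (p - E) by exact: projB.
have pf1 : proj (p - G) by exact: projB.
have [||a0 Aa0 z0] := factor_link AB sc (cpairB AB Ap AE) (cpairB AB Ap AG) pe1 pf1.
- by rewrite subr_eq0; apply/eqP => /esym.
- by rewrite subr_eq0; apply/eqP => /esym.
set z := _ * _ * _ in z0.
have Az : A z by apply: (cpairM AB) => //; [apply: (cpairM AB) => //|]; exact: (cpairB AB).
have [||r [ o [[Ar Ao pr rr] [orz oz pio bo [fo oe re o0]]]]] := polar_corner AB Az pe1 pf1.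
- by rewrite /z !mulrA; case: pf1 => ->.
- by rewrite /z -!mulrA; case: pe1 => ->.
have EpE : E * p = E by rewrite -mulrA Wp.
have GpG : G * p = G by case: pp => _ pa; case: pG => _ Ga; rewrite -{1}Ga -{1}pa -adjM pGG Ga.
exists o; split.
  split=> //.
  - by apply/eqP => o00; move: z0; rewrite -orz o00 mul0r eqxx.
  - by rewrite -fo mulrA mulrBr; case: pp => -> _; rewrite pGG.
  - by rewrite -oe -mulrA mulrBl; case: pp => -> _; rewrite EpE.
move=> w Aw piw wo ow.
have Go : G * o = 0 by rewrite -fo mulrA mulrBr GpG; case: pG => -> _; rewrite subrr mul0r.
have oE : o * E = 0 by rewrite -oe -mulrA mulrBl pEE; case: pE => -> _; rewrite subrr mulr0.
(* [X] is orthogonal to [W] on both sides: hence [W + X] is a partial isometry extending [W], and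
   [F] is additive on the sum. *)
set X := o * w.
have GX : G * X = 0 by rewrite mulrA Go mul0r.
have XE : X * E = 0 by rewrite -mulrA -wo -!mulrA oE !mulr0.
have aWWW : adj W * W * adj W = adj W by have := pisom_adj piW; rewrite /pisom adjK.
have aWX : adj W * X = 0 by rewrite -[RHS](mulr0 (adj W)) -GX /G !mulrA aWWW.
have XaW : X * adj W = 0 by rewrite -aWWW mulrA XE mul0r.
have WaX : W * adj X = 0 by rewrite -[W]adjK -adjM XaW adj0.
have aXW : adj X * W = 0 by rewrite -[W]adjK -adjM aWX adj0.
have piX : X * adj X * X = X.
  rewrite /X adjM -!mulrA; congr (_ * _).
  by rewrite [adj o * _]mulrA ow mulrA piw.
have PWX : P (W + X).
  split.
  - by apply: (cpairD AB) => //; exact: (cpairM AB).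
  - rewrite /pisom adjD mulrDl !mulrDr WaX XaW addr0 add0r !mulrDl piW piX.
    by rewrite -/G GX -mulrA aXW mulr0 add0r addr0.
  - by rewrite mulrDr pW /X mulrA -{1}fo mulrA mulrBr; case: (pp) => -> _; rewrite pGG fo.
  - rewrite mulrDl Wp /X -mulrA; congr (_ + _ * _); rewrite -{1}wo -mulrA -[adj o * o * p]mulrA.
    have -> : o * p = o by rewrite -oe -mulrA mulrBl; case: (pp) => -> _; rewrite EpE.
    by rewrite wo.
have : F W <= F (W + X).
  apply: Fmin => //; split; rewrite -/E -/G.
    by rewrite mulrDl XE addr0 mulrA piW.
  by rewrite mulrDr GX addr0 piW.
have -> : F (W + X) = F W + F X.
  rewrite /F adjD !opD !qD /rp adjP' -opM WaX op0 in0r mul0rn addr0.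
  by rewrite adjP -opM aWX op0 in0r mul0rn addr0; ring.
rewrite lerDl /F adjM opM opM (q_init (w xi) pio) -(opM (adj o * o)) ow.
by [].
Qed.

End exhaustion.

Section spectral_halving.
Context {R : realType} {H : hilbertType R}.
Implicit Types (u v xi eta : H) (w p e h z : bop H) (A B C : set (bop H)).
Local Notation "''[' u , v ]" := (inner u v).

(* [e] is the spectral projection of [h] for the interval [1/2, 1]. *)
Lemma spectral_half A B h : cpair A B -> A h -> posop h -> posop (1 - h) ->
  exists e, [/\ A e, proj e, posop (h + h - e), posop (1 - (h + h - e)) &
    forall v, h v = 0 -> e v = 0].
Proof.
move=> AB Ah ph ph1; have sh := posop_sa ph.
have [s sE] : exists s, s = h + h - 1 by exists (h + h - 1).
have As : A s by rewrite sE; apply: (cpairB AB); [exact: (cpairD AB)|exact: (cpair1 AB)].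
have ss : adj s = s by rewrite sE adjB adjD sh adj1.
have [r [pr rr cr]] := sqrt_ex (@posop_adj_mul _ _ s).
rewrite ss in rr cr.
have Ar : A r.
  apply: (cpairI AB) => y By; apply: cr.
  by rewrite mulrA -(cpairC AB As By) -!mulrA (cpairC AB As By).
have sr : s * r = r * s by apply: cr; rewrite mulrA.
(* Here [r = |s|], and [r + s] is twice the positive part of [s = 2 h - 1]. *)
pose S := [set (r + s) u | u in setT].
have sS : subspace S.
  split; first by exists 0 => //; rewrite b0.
  by move=> a _ _ [u _ <-] [v _ <-]; exists (a *: u + v) => //; rewrite bD bZ.
have Sinv y : y * (r + s) = (r + s) * y -> forall u, S u -> S (y u).
  by move=> yr _ [u _ <-]; exists (y u) => //; rewrite -!opM yr.
have [e [ee ea eS e0 eC]] := proj_ex sS.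
have pe : proj e by [].
have srs : s * (r + s) = (r + s) * s by rewrite mulrDr mulrDl sr.
have se : s * e = e * s by apply: eC; apply: Sinv; rewrite ?ss.
have Ars : A (r + s) by exact: (cpairD AB).
have Ae : A e.
  apply: (cpairI AB) => y By; apply: eC; apply: Sinv; apply/esym/(cpairC AB) => //.
  exact: (cpair_adj (cpair_sym AB)).
have ers : e * (r + s) = r + s.
  by apply: bop_ext => u; rewrite opM eS //; exists u.
have sre : (r + s) * e = r + s.
  have := congr1 adj ers; rewrite adjM ea adjD ss (posop_sa pr); exact.
(* As [(r - s) (r + s) = r^2 - s^2 = 0], the operator [s] equals [|s|] on the range of [e]; on the
   complement it equals [- |s|] because [r + s] vanishes there. *)
have mre : (r - s) * e = 0.
  have h1 : e * (r - s) = 0.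
    apply: bop_ext => u; rewrite opM; apply: e0 => _ [v _ <-].
    rewrite -adjP' -opM adjD ss (posop_sa pr) mulrBr !mulrDl rr sr.
    by rewrite [s * s + _]addrC subrr op0 in0l.
  by have := congr1 adj h1; rewrite adjM ea adjB ss (posop_sa pr) adj0.
have re : r * e = s * e by apply/eqP; rewrite -subr_eq0 -mulrBl mre.
have [d dE] : exists d, d = 1 - e by exists (1 - e).
have pd : proj d by rewrite dE; exact: projC.
have rd : r * d = - (s * d).
  by apply/eqP; rewrite -addr_eq0 -mulrDl dE mulrBr mulr1 sre subrr.
have sd : s * d = d * s by rewrite dE mulrBr mulrBl mulr1 mul1r se.
have decomp u : complex.Re '[s u, u] =
    complex.Re '[s (e u), e u] + complex.Re '[s (d u), d u].
  have aux f : proj f -> s * f = f * s -> '[s (f u), f u] = '[(s * f) u, u].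
    by move=> [ff fa] hf; rewrite -{2}fa -adjP -!opM -hf -mulrA ff.
  by rewrite !aux // -ReD -inDl -opD -mulrDr dE addrC subrK mulr1.
have r_e u : complex.Re '[s (e u), e u] >= 0.
  by rewrite -opM -re opM; exact: posopRe.
have r_d u : complex.Re '[s (d u), d u] <= 0.
  rewrite -opM -[s * d]opprK -rd opN opM inNl ReN oppr_le0; exact: posopRe.
have s_ge u : - q u <= complex.Re '[s u, u].
  rewrite sE opB inBl opD inDl !ReD ReN op1 -/(q u).
  by have := posopRe ph u; lra.
have s_le u : complex.Re '[s u, u] <= q u.
  rewrite sE opB inBl opD inDl !ReD ReN op1 -/(q u).
  by have := posopRe ph1 u; rewrite opB inBl ReD ReN op1 -/(q u); lra.
have hs : h + h = s + 1 by rewrite sE subrK.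
have p1 : posop (h + h - e).
  apply: sa_posop; first by rewrite adjB adjD sh ea.
  move=> u; rewrite hs -addrA opD inDl ReD decomp -dE -(proj_q u pd).
  by have := r_e u; have := s_ge (d u); lra.
exists e; split=> //.
  apply: sa_posop; first by rewrite !adjB adjD sh ea adj1.
  move=> u; rewrite hs !opB opD op1 !inBl inDl !(ReD, ReN) decomp -(proj_q u pe).
  by have := r_d u; have := s_le (e u); lra.
move=> v hv; apply: q_eq0; apply/eqP; rewrite eq_le q_ge0 andbT (proj_q v pe).
have := posopRe p1 v; rewrite opB opD hv addr0 sub0r inNl ReN; lra.
Qed.

Lemma half_small (M e : R) : 0 <= M -> 0 < e -> exists n, 2^-1 ^+ n * M <= e.
Proof.
move=> M0 e0; have [|N /(_ _ (leqnn N)) hN] := invS_small (e := e / (M + 1)).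
  by rewrite divr_gt0 //; lra.
exists N; have h : 2^-1 ^+ N <= N.+1%:R^-1 :> R.
  by rewrite exprVn lef_pV2 ?posrE ?exprn_gt0 // -natrX ler_nat ltn_expl.
have e1 : e / (M + 1) * (M + 1) = e by rewrite divfK //; lra.
have i0 : 0 <= 2^-1 ^+ N :> R by rewrite exprn_ge0 // invr_ge0.
move: (e / (M + 1)) (2^-1 ^+ N) (N.+1%:R^-1) hN h e1 i0 => a b c *; nra.
Qed.

(* Only projections are compared in the hypothesis: write z = o |z| and expand
   |z|^2 in binary digits, which are projections by [spectral_half]. *)
Lemma trace_ineq_ext A B p xi (K : R) : cpair A B -> A p -> proj p -> 0 <= K ->
  (forall w, A w -> pisom w -> p * w = w -> w * p = w -> q (adj w xi) <= K * q (w xi)) ->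
  forall z, A z -> p * z = z -> z * p = z -> q (adj z xi) <= K * q (z xi).
Proof.
move=> AB Ap pp K0 hK z Az pz zp.
have [r [ o [[Ar Ao pr rr] [orz oz pio bo [fo oe re o0]]]]] := polar_corner AB Az pp pp pz zp.
have sr := posop_sa pr.
have rzo : r = adj z * o by rewrite -{1}sr -oz adjM adjK.
have aoo e : (forall v, z v = 0 -> e v = 0) -> adj e = e -> adj o * o * e = e.
  move=> ez ea; rewrite -{1}ea -[adj o * o]adjK -adjM.
  rewrite -[RHS]ea; congr adj; rewrite adjM adjK.
  apply/esym/eqP; rewrite -subr_eq0 -{1}[e]mulr1 -mulrBr; apply/eqP/bop_ext => u.
  rewrite opM; apply: ez; rewrite -orz opM rzo opM.
  have -> : o ((1 - adj o * o) u) = 0.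
    by rewrite -opM mulrBr mulr1 mulrA pio subrr.
  by rewrite !b0.
pose L h := complex.Re '[h (adj o xi), adj o xi].
pose T h := complex.Re '[h xi, xi].
(* Write [h = (e + h') / 2] with [h' = h + h - e] again between 0 and 1: one binary digit is settled
   by the projection [e], and the error term is halved. *)
have claim n h : A h -> posop h -> posop (1 - h) -> (forall v, z v = 0 -> h v = 0) ->
    L h <= K * T h + 2^-1 ^+ n * q xi.
  elim: n h => [|n IH] h Ah ph ph1 hz.
    rewrite expr0 mul1r.
    have h1 : L h <= q (adj o xi).
      by have := posopRe ph1 (adj o xi); rewrite opB inBl ReD ReN -/(q _) -/(L h); lra.
    have h2 := bnd_adj ler01 bo xi; have := posopRe ph xi; rewrite -/(T h) => h3.
    by have := mulr_ge0 K0 h3; lra.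
  have [e [Ae pe p1 p2 e0]] := spectral_half AB Ah ph ph1.
  have h1 := IH _ (cpairB AB (cpairD AB Ah Ah) Ae) p1 p2.
  have {}h1 : L (h + h - e) <= K * T (h + h - e) + 2^-1 ^+ n * q xi.
    by apply: h1 => v zv; rewrite opB opD hz // e0 ?hz // addr0 subr0.
  have ea : adj e = e by case: pe.
  have ooe : adj o * o * e = e by apply: aoo => // v /hz/e0.
  (* For a projection [e] below the support of [z], [o e] is a partial isometry with
     [L e = q (adj (o e) xi)] and [T e = q ((o e) xi)], so the hypothesis applies. *)
  have h2 : L e <= K * T e.
    have h3 : L e = q (adj (o * e) xi) by rewrite /L -proj_q // adjM ea opM.
    have h4 : T e = q ((o * e) xi) by rewrite /T -proj_q // (opM o) (q_init _ pio) -(opM (adj o * o)) ooe.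
    rewrite h3 h4; apply: hK.
    - exact: (cpairM AB).
    - have ooe' : adj o * (o * e) = e by rewrite mulrA.
      by rewrite /pisom adjM ea -!mulrA ooe'; have [ee _] := pe; rewrite !ee.
    - by rewrite mulrA fo.
    - rewrite -mulrA; congr (_ * _); apply/eqP; rewrite -subr_eq0 -{2}[e]mulr1 -mulrBr.
      apply/eqP/bop_ext => v; rewrite opM e0 // hz // opB bB -opM zp subrr //.
  have L1 : L (h + h - e) = L h + L h - L e by rewrite /L opB opD inBl inDl !ReD ReN.
  have T1 : T (h + h - e) = T h + T h - T e by rewrite /T opB opD inBl inDl !ReD ReN.
  rewrite L1 T1 in h1; rewrite exprS -mulrA; lra.
have [k k0 bz] := bop_bnd z.
pose h := (k^-1)%:C *: (adj z * z).
have ph : posop h by apply: posopZ; [rewrite invr_ge0 ltW|exact: posop_adj_mul].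
have ph1 : posop (1 - h).
  apply: sa_posop; first by rewrite adjB adj1 (posop_sa ph).
  move=> u; rewrite opB inBl op1 opZ inZl ReD ReN ReZ -q_adj -/(q u) subr_ge0.
  by rewrite mulrC ler_pdivrMr // mulrC; exact: bz.
have Ah : A h by apply/(cpairZ AB)/(cpairM AB) => //; exact: (cpair_adj AB).
have Lh : L h = k^-1 * q (adj z xi).
  rewrite /L opZ inZl ReZ -rr -orz adjM sr [in RHS]opM q_adj sr; congr (_ * _).
have Th : T h = k^-1 * q (z xi) by rewrite /T opZ inZl ReZ -q_adj.
apply: lim_eps => e e0.
have e1 : 0 < e / k by rewrite divr_gt0.
have [n hn] := half_small (q_ge0 xi) e1.
have hz v : z v = 0 -> h v = 0 by move=> zv; rewrite opZ opM zv b0 scaler0.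
have := claim n h Ah ph ph1 hz; rewrite Lh Th => h1.
have : k^-1 * q (adj z xi) <= K * (k^-1 * q (z xi)) + e / k by lra.
rewrite -(ler_pM2l k0) mulVKf ?gt_eqF // mulrDr => h2.
apply: le_trans h2 _; rewrite mulrCA mulVKf ?gt_eqF // lerD2l mulrCA divff ?gt_eqF // mulr1 //.
Qed.

End spectral_halving.

Section trace_vectors.
Context {R : realType} {H : hilbertType R}.
Implicit Types (u v xi eta : H) (w p e h z : bop H) (A B C : set (bop H)).
Local Notation "''[' u , v ]" := (inner u v).

(** A partial isometry [v] from [p] into [p], completed by the identity on [e - p], maps [e] into
    [e]; finiteness of [e] makes it onto. *)
Lemma finproj_sub A B e p : cpair A B -> A e -> A p -> proj e -> proj p -> e * p = p ->
  finproj A e -> finproj A p.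
Proof.
move=> AB Ae Ap [ee ea] [pp pa] ep fe v Av vp pv.
have pe : p * e = p by rewrite -{1}pa -ea -adjM ep pa.
have vpv : v * p = v.
  apply/eqP; rewrite -subr_eq0 -{2}[v]mulr1 -mulrBr; apply/eqP/bop_ext => u.
  by apply: q_eq0; rewrite opM q_adj vp -opM mulrBr mulr1 pp subrr op0 in0l.
have vvv : v * adj v * v = v by rewrite -mulrA vp.
have pvv : p * v = v by rewrite -{1}vvv mulrA pv vvv.
have [f fE] : exists f, f = e - p by exists (e - p).
have [ff fa] : proj f by rewrite fE; exact: projB.
have fp : f * p = 0 by rewrite fE mulrBl ep pp subrr.
have pf : p * f = 0 by rewrite fE mulrBr pe pp subrr.
have ef : e * f = f by rewrite fE mulrBr ee ep.
have avp : adj v * p = adj v by rewrite -pa -adjM pvv.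
have vf : v * f = 0 by rewrite -vpv -mulrA pf mulr0.
have fav : f * adj v = 0 by rewrite -vpv adjM pa mulrA fp mul0r.
have avf : adj v * f = 0 by rewrite -avp -mulrA pf mulr0.
have fv : f * v = 0 by rewrite -pvv mulrA fp mul0r.
have h1 : adj (v + f) * (v + f) = e.
  by rewrite adjD fa mulrDl !mulrDr vp ff avf fv addr0 add0r fE addrC subrK.
have h2 : (v + f) * adj (v + f) = v * adj v + f.
  by rewrite adjD fa mulrDl !mulrDr ff vf fav addr0 add0r.
have := fe (v + f); rewrite h1 h2 => h.
have : v * adj v + f = e.
  apply: h => //.
  - by apply: (cpairD AB) => //; rewrite fE; exact: (cpairB AB).
  - by rewrite mulrDr ef -{1}pvv !mulrA ep pvv.
by rewrite fE => /(canRL (addrK _)); rewrite opprB addrCA subrr addr0.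
Qed.

Lemma pisomM (x y : bop H) : pisom x -> pisom y -> adj x * x * y = y -> pisom (x * y).
Proof.
move=> px py xy; rewrite /pisom adjM -!mulrA; congr (_ * _).
by rewrite [adj x * _]mulrA xy mulrA py.
Qed.

(** An auxiliary vector is compared with [xi] through the ratio of [q (adj w eta)] to [q (w xi)],
    for partial isometries [w]. Successive uses of [pisom_exhaust] confine this ratio to the
    interval from [m] to [m K], on a corner [P3]. The lower bound for the final projection
    [w * adj w] and the upper bound for [w] have the same numerator; comparing them eliminates the
    auxiliary vector and leaves the trace inequality for [xi]. *)
Lemma trace_vector A B e (K : R) : cpair A B -> scalar_center A B -> A e -> proj e ->
  e != 0 -> finproj A e -> 1 < K ->
  exists p xi, [/\ A p, proj p, xi != 0, p xi = xi &
    forall z, A z -> p * z = z -> z * p = z -> q (adj z xi) <= K * q (z xi)].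
Proof.
move=> AB sc Ae pe e_neq0 fe K1.
have [u0 eu0] : exists u, e u != 0.
  apply: contrapT => n; case/eqP: e_neq0; apply: bop_ext => u; apply/eqP.
  by apply: contrapT => /negP xu; apply: n; exists u.
pose xi := e u0; have [p0 [Ap0 pp0] [_ p0xi p00]] := cyc_proj AB xi.
have [p00p p0a] := pp0.
have exi : e xi = xi by rewrite /xi -opM; case: pe => ->.
have ep0 : e * p0 = p0.
  have h : p0 * e = p0.
    apply/eqP; rewrite -subr_eq0 -{2}[p0]mulr1 -mulrBr; apply/eqP/bop_ext => u.
    rewrite opM; apply: p00 => b Bb; have [_ ea] := pe.
    rewrite -exi -(cpairCv AB _ Ae Bb) -{2}ea -adjP -opM mulrBr mulr1.
    by case: pe => -> _; rewrite subrr in0l.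
  by have := congr1 adj h; rewrite adjM p0a; case: pe => _ ->.
have fp0 := finproj_sub AB Ae Ap0 pe pp0 ep0 fe.
have faithful w : A w -> w * p0 = w -> w xi = 0 -> w = 0.
  move=> Aw wp wxi; rewrite -[w]adjK -wp adjM p0a.
  suff -> : p0 * adj w = 0 by exact: adj0.
  apply: bop_ext => u; rewrite opM; apply: p00 => b Bb.
  by rewrite adjP' (cpairCv AB _ Aw Bb) wxi b0 in0r.
have qxi : 0 < q xi by exact: q_gt0.
(* Any factor strictly between 0 and 1 would do in place of [1/2]: it bounds the ratios away from 0,
   so that their infimum [m] is positive. *)
have [|o1 [[Ao1 pi1 o10 po1 o1p] H1]] :=
    @pisom_exhaust R H A B p0 xi xi 1 (- 2^-1) AB sc Ap0 pp0 fp0.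
  by rewrite p0xi; lra.
set P1 := adj o1 * o1 in H1.
have AP1 : A P1 by apply: (cpairM AB) => //; exact: (cpair_adj AB).
have pP1 : proj P1 by exact: pisom_init.
have P1p0 : P1 * p0 = P1 by rewrite -mulrA o1p.
pose D w := [/\ A w, pisom w, w * P1 = w & P1 * w = w].
pose eta1 := adj o1 xi.
have Dq w : D w -> w != 0 -> 0 < q (w xi).
  move=> [Aw _ wP _] w0; apply: q_gt0; apply: contra_neq w0; apply: faithful => //.
  by rewrite -wP -mulrA P1p0.
have {}H1 w : D w -> 2^-1 * q (w xi) <= q (adj w eta1).
  by move=> [Aw piw wP Pw]; have := H1 w Aw piw wP Pw; rewrite -/eta1; lra.
pose S := [set q (adj w eta1) / q (w xi) | w in [set w | D w /\ w != 0]].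
have P1_0 : P1 != 0.
  by apply: contra_neq o10 => P10; rewrite -pi1 -mulrA -/P1 P10 mulr0.
have iS : has_inf S.
  split.
    exists (q (adj P1 eta1) / q (P1 xi)), P1 => //; split=> //.
    by split=> //; [exact: proj_pisom|case: pP1|case: pP1].
  exists 0 => _ [w _ <-]; by rewrite divr_ge0 // q_ge0.
pose m := inf S.
have m_le w : D w -> m * q (w xi) <= q (adj w eta1).
  move=> Dw; have [->|w0] := eqVneq w 0; first by rewrite op0 q0 mulr0 q_ge0.
  rewrite -ler_pdivlMr ?Dq //; apply: ge_inf; first by case: iS.
  by exists w.
have m0 : 2^-1 <= m.
  apply: lb_le_inf; first by case: iS.
  by move=> _ [w [Dw w0] <-]; rewrite ler_pdivlMr ?Dq // H1.
have mK : 0 < m * (K - 1) by rewrite mulr_gt0 //; lra.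
(* A [w2] whose ratio is below [m K]; the next exhaustion spreads this upper bound over a whole
   corner under its initial projection. *)
have [_ [w2 [Dw2 w20] <-] hw2] := inf_adherent mK iS.
have {}hw2 : q (adj w2 eta1) < m * K * q (w2 xi).
  rewrite -ltr_pdivrMr ?Dq //; apply: lt_le_trans hw2 _.
  by rewrite -/m; lra.
have [Aw2 pi2 w2P1 P1w2] := Dw2.
set P2 := adj w2 * w2.
have AP2 : A P2 by apply: (cpairM AB) => //; exact: (cpair_adj AB).
have pP2 : proj P2 by exact: pisom_init.
have p0P1 : p0 * P1 = P1.
  by have := congr1 adj P1p0; rewrite adjM p0a; case: pP1 => _ ->.
have P2P1 : P2 * P1 = P2 by rewrite -mulrA w2P1.
have P1P2 : P1 * P2 = P2.
  by have := congr1 adj P2P1; rewrite adjM; case: pP1 => _ ->; case: pP2 => _ ->.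
have p0P2 : p0 * P2 = P2 by rewrite -P1P2 mulrA p0P1.
have fP2 := finproj_sub AB Ap0 AP2 pp0 pP2 p0P2 fp0.
pose eta2 := adj w2 eta1.
have P2eta : P2 eta2 = eta2.
  by rewrite /eta2 -opM; have := pisom_adj pi2; rewrite /pisom adjK => ->.
have [|o3 [[Ao3 pi3 o30 P2o3 o3P2] H3]] :=
    @pisom_exhaust R H A B P2 xi eta2 (-1) (m * K) AB sc AP2 pP2 fP2.
  by rewrite P2eta -(q_init _ pi2); move: hw2; rewrite -/eta2; lra.
set P3 := adj o3 * o3 in H3.
have AP3 : A P3 by apply: (cpairM AB) => //; exact: (cpair_adj AB).
have pP3 : proj P3 by exact: pisom_init.
pose eta3 := adj o3 eta2.
have up w : A w -> pisom w -> P3 * w = w -> w * P3 = w -> q (adj w eta3) <= m * K * q (w xi).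
  by move=> Aw piw Pw wP; have := H3 w Aw piw wP Pw; rewrite -/eta3; lra.
have P3P2 : P3 * P2 = P3 by rewrite -mulrA o3P2.
have P3P1 : P3 * P1 = P3 by rewrite -P3P2 -mulrA P2P1.
(* The lower bound survives the changes of vector, since [w2 o3 w] was among the competitors for
   [m]. *)
have low w : A w -> pisom w -> P3 * w = w -> w * P3 = w -> m * q (w xi) <= q (adj w eta3).
  move=> Aw piw Pw wP.
  have pi4 : pisom (o3 * w) by apply: pisomM.
  have P2ow : P2 * (o3 * w) = o3 * w by rewrite mulrA P2o3.
  have pi5 : pisom (w2 * (o3 * w)) by exact: pisomM.
  have := m_le (w2 * (o3 * w)); rewrite opM (q_init _ pi2) -/P2 -(opM P2) P2ow.
  rewrite opM (q_init _ pi3) -/P3 -opM Pw !adjM !opM; apply; split=> //.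
  - by apply: (cpairM AB) => //; exact: (cpairM AB).
  - by rewrite -wP -2!mulrA -(mulrA w) P3P1.
  - by rewrite mulrA P1w2.
have trP3 w : A w -> pisom w -> P3 * w = w -> w * P3 = w -> q (adj w xi) <= K * q (w xi).
  move=> Aw piw Pw wP; have pv := pisom_final piw.
  have e1 : q (adj w xi) = q ((w * adj w) xi) by rewrite (q_init _ (pisom_adj piw)) adjK.
  have h : m * q (adj w xi) <= q (adj (w * adj w) eta3).
    rewrite e1; apply: low.
    - by apply: (cpairM AB) => //; exact: (cpair_adj AB).
    - exact: proj_pisom.
    - by rewrite mulrA Pw.
    - by rewrite -mulrA (proj_mulC pP3 Pw).
  have := up w Aw piw Pw wP.
  have -> : q (adj w eta3) = q (adj (w * adj w) eta3).
    by rewrite (q_init _ (pisom_adj piw)) adjK; case: pv => _ ->.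
  move=> h2; have m00 : 0 < m by lra.
  rewrite -(ler_pM2l m00) mulrA; exact: le_trans h h2.
exists P3, (P3 xi); split=> //.
- have P3_0 : P3 != 0.
    by apply: contra_neq o30 => P30; rewrite -pi3 -mulrA -/P3 P30 mulr0.
  apply: contra_neq P3_0; apply: faithful => //.
  by rewrite -P3P1 -mulrA P1p0.
- by rewrite -opM; case: pP3 => ->.
- have K0 : 0 <= K by lra.
  move=> z Az Pz zP; rewrite -!opM zP (proj_mulC pP3 Pz).
  exact: (trace_ineq_ext AB AP3 pP3 K0 trP3).
Qed.

(* The vector state of xi is almost tracial, both on the corner [pAp] and on [rBr]. *)
Definition trace_data A B (K : R) xi := exists p r,
  [/\ A p, B r, proj p, proj r & p xi = xi] /\ [/\ r xi = xi,
    forall u, (forall b, B b -> '[u, b xi] = 0) -> p u = 0,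
    forall u, (forall a, A a -> '[u, a xi] = 0) -> r u = 0,
    forall z, A z -> p * z = z -> z * p = z -> q (adj z xi) <= K * q (z xi) &
    forall z, B z -> r * z = z -> z * r = z -> q (adj z xi) <= K * q (z xi)].

Lemma trace_data_sym A B K xi : trace_data A B K xi -> trace_data B A K xi.
Proof. by move=> [p [r [[? ? ? ? ?] [? ? ? ? ?]]]]; exists r, p. Qed.

(** Cutting [p] down to the projection onto the closure of [B xi] preserves the inequality on [A].
    It passes to [B] by duality: for commuting [x] and [z], ['[adj z xi, x xi] = '[adj x xi, z xi]],
    and the right-hand side is bounded by Cauchy-Schwarz and the inequality for [x]. *)
Lemma trace_dataI A B p xi (K : R) : cpair A B -> 0 <= K -> A p -> proj p -> p xi = xi ->
  (forall z, A z -> p * z = z -> z * p = z -> q (adj z xi) <= K * q (z xi)) ->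
  trace_data A B K xi.
Proof.
move=> AB K0 Ap pp pxi tr.
have [p1 [Ap1 pp1] [p1b p1xi p10]] := cyc_proj AB xi.
have BA := cpair_sym AB.
have [r [Br pr] [ra rxi r0]] := cyc_proj BA xi.
have pp1' : p * p1 = p1.
  have h : p1 * p = p1.
    apply/eqP; rewrite -subr_eq0 -{2}[p1]mulr1 -mulrBr; apply/eqP/bop_ext => u.
    rewrite opM; apply: p10 => b Bb; have [_ pa] := pp.
    rewrite -pxi -(cpairCv AB _ Ap Bb) -{2}pa -adjP -opM mulrBr mulr1.
    by case: pp => -> _; rewrite subrr in0l.
  by have := congr1 adj h; rewrite adjM; case: pp => _ ->; case: pp1 => _ ->.
have p1p : p1 * p = p1.
  by have := congr1 adj pp1'; rewrite adjM; case: pp => _ ->; case: pp1 => _ ->.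
have trA z : A z -> p1 * z = z -> z * p1 = z -> q (adj z xi) <= K * q (z xi).
  by move=> Az pz zp; apply: tr => //; [rewrite -pz mulrA pp1'|rewrite -zp -mulrA p1p].
exists p1, r; split; split=> //.
move=> z Bz rz zr.
have Baz : B (adj z) by exact: (cpair_adj BA).
have raz : r * adj z = adj z by case: pr => _ h; rewrite -{1}h -adjM zr.
have qz0 := q_ge0 (z xi).
(* Test [z^* xi] against [x xi], x in pAp: these vectors are dense in the range of p r. *)
have key x : A x -> cm '[adj z xi, x xi] <= K * q (z xi) * q (x xi).
  move=> Ax; pose y := p1 * x * p1.
  have Ay : A y by do 2 apply: (cpairM AB) => //.
  have h1 : '[adj z xi, x xi] = '[adj z xi, y xi].
    rewrite /y !opM p1xi -[in RHS]adjP'; case: pp1 => _ ->.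
    by rewrite (cpairCv AB _ Ap1 Baz) p1xi.
  have h2 : q (y xi) <= q (x xi).
    by rewrite /y !opM p1xi; have := proj_bnd pp1 (x xi); rewrite mul1r.
  have h3 : '[adj z xi, y xi] = '[adj y xi, z xi].
    by rewrite adjP' -(cpairCv AB _ Ay Bz) -adjP'.
  have h4 : q (adj y xi) <= K * q (y xi).
    have [p1p1 _] := pp1; apply: trA => //; first by rewrite /y !mulrA p1p1.
    by rewrite /y -!mulrA p1p1.
  rewrite h1 h3; apply: le_trans (cauchy_schwarz _ _) _.
  apply: le_trans (ler_wpM2r qz0 h4) _; rewrite mulrAC; apply: ler_wpM2l => //.
  by rewrite mulr_ge0.
have sX : subspace [set a xi | a in A].
  split; first by exists 0 => //; exact: (cpair0 AB).
  move=> c _ _ [a Aa <-] [b Ab <-]; exists (c *: a + b) => //.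
  by apply: (cpairD AB) => //; exact: (cpairZ AB).
apply: (@q_le_dense _ _ [set a xi | a in A]); first by rewrite mulr_ge0.
  move=> e; apply: (dense_proj sX pr).
  - by move=> w hw; apply: r0 => a Aa; apply: hw; exists a.
  - by move=> _ [a Aa <-]; exact: ra.
  - by rewrite -opM raz.
by move=> _ [a Aa <-]; exact: key.
Qed.

End trace_vectors.

(** * The value of a vector *)

Section conversion_value.
Context {R : realType} {H : hilbertType R}.
Implicit Types (u v xi eta chi phi : H) (w p e h z : bop H) (A B C : set (bop H)).
Implicit Types (s : seq (bop H * bop H)) (t : seq (bop H)).
Local Notation "''[' u , v ]" := (inner u v).

Definition column A t := (forall x, x \in t -> A x) /\ forall u, \sum_(x <- t) q (x u) <= q u.

(* One-way protocols: a measurement in [A], the outcome of each branch being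
   followed by a contraction of [B]. *)
Definition protocol A B s := (forall x, x \in s -> [/\ A x.1, B x.2 & bnd 1 x.2]) /\
  forall u, \sum_(x <- s) q (x.1 u) <= q u.

Definition score phi s chi := \sum_(x <- s) cm '[x.2 (x.1 chi), phi].

Definition value A B phi chi := sup [set score phi s chi | s in protocol A B].

Lemma score_ub A B phi s chi : protocol A B s -> score phi s chi <= q phi * q chi.
Proof.
move=> [hs cs]; apply: le_trans (ler_wpM2l (q_ge0 phi) (cs chi)).
rewrite mulr_sumr /score big_seq [X in _ <= X]big_seq; apply: ler_sum => x /hs[_ _ bx].
apply: le_trans (cauchy_schwarz _ _) _; rewrite mulrC; apply: ler_wpM2l; first exact: q_ge0.
by have := bx (x.1 chi); rewrite mul1r.
Qed.

Lemma protocol_nil A B : protocol A B [::].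
Proof. by split=> // u; rewrite big_nil q_ge0. Qed.

Lemma value_has_sup A B phi chi : has_sup [set score phi s chi | s in protocol A B].
Proof.
split; first by exists (score phi [::] chi), [::] => //; exact: protocol_nil.
by exists (q phi * q chi) => _ [s ps <-]; exact: (score_ub phi chi ps).
Qed.

Lemma value_ub A B phi s chi : protocol A B s -> score phi s chi <= value A B phi chi.
Proof. by move=> ps; apply: (sup_upper_bound (value_has_sup A B phi chi)); exists s. Qed.

Lemma value_le A B phi chi (M : R) :
  (forall s, protocol A B s -> score phi s chi <= M) -> value A B phi chi <= M.
Proof.
move=> h; apply: sup_le_ub; first by case: (value_has_sup A B phi chi).
by move=> _ [s ps <-]; exact: h.
Qed.

Lemma value_ge0 A B phi chi : 0 <= value A B phi chi.
Proof.
by have := value_ub phi chi (@protocol_nil A B); rewrite /score big_nil.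
Qed.

Lemma value_approx A B phi chi (e : R) : 0 < e ->
  exists2 s, protocol A B s & value A B phi chi < score phi s chi + e.
Proof.
move=> e0; have [_ [s ps <-] hs] := sup_adherent e0 (value_has_sup A B phi chi).
by exists s => //; rewrite -ltrBlDr.
Qed.

(** Each score is a sum of squares [cm] of linear functionals, so Young's inequality applies term by
    term. This is the continuity that later allows [chi] to be replaced by nearby vectors. *)
Lemma value_perturb A B phi u v (d : R) : 0 < d ->
  value A B phi (u + v) <= (1 + d) * value A B phi u + (1 + d^-1) * (q phi * q v).
Proof.
move=> d0; apply: value_le => s ps.
have i0 : 0 < d^-1 by rewrite invr_gt0.
have h1 := value_ub phi u ps; have h2 := score_ub phi v ps.
have : score phi s (u + v) <= (1 + d) * score phi s u + (1 + d^-1) * score phi s v.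
  rewrite /score !mulr_sumr -big_split /=; apply: ler_sum => x _.
  by rewrite !bD inDl; exact: cmD_le.
nra.
Qed.

Lemma valueZ A B phi c u : value A B phi (c *: u) <= cm c * value A B phi u.
Proof.
apply: value_le => s ps; rewrite /score.
under eq_bigr => x _ do rewrite !bZ inZl cmM.
by rewrite -mulr_sumr; apply: ler_wpM2l; [exact: cm_ge0|exact: value_ub].
Qed.

Section pair.
Variables A B : set (bop H).
Hypothesis AB : cpair A B.
Variable phi : H.
Let V := value A B phi.

(** [b] commutes with the measurement in [A] and is absorbed into the corrections. *)
Lemma value_contrB b chi : B b -> bnd 1 b -> V (b chi) <= V chi.
Proof.
move=> Bb bb; apply: value_le => s [hs cs].
have -> : score phi s (b chi) = score phi [seq (x.1, x.2 * b) | x <- s] chi.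
  rewrite /score big_map big_seq [RHS]big_seq; apply: eq_bigr => x /hs[Ax _ _].
  by rewrite /= (cpairCv AB _ Ax Bb).
apply: value_ub; split; last by move=> u; rewrite big_map.
move=> _ /mapP[x /hs[Ax Bx bx] ->] /=; split=> //; first exact: (cpairM (cpair_sym AB)).
by have := bndM ler01 bx bb; rewrite mul1r.
Qed.

Lemma value_column t chi : column A t -> \sum_(a <- t) V (a chi) <= V chi.
Proof.
move=> [At ct]; apply: lim_eps => e e0.
(* The error [e] is shared among the branches; the [+ 1] covers the empty family. *)
have n0 : 0 < (size t)%:R + 1 :> R by rewrite ltr_wpDl.
have e'0 : 0 < e / ((size t)%:R + 1) by rewrite divr_gt0.
pose f (a : bop H) := sval (cid2 (value_approx A B phi (a chi) e'0)).
have fP (a : bop H) : protocol A B (f a) /\ V (a chi) < score phi (f a) (a chi) + e / ((size t)%:R + 1).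
  by rewrite /f; case: cid2.
pose s := flatten [seq [seq (x.1 * a, x.2) | x <- f a] | a <- t].
have ss G : \sum_(x <- s) G x = \sum_(a <- t) \sum_(x <- f a) G (x.1 * a, x.2) :> R.
  by rewrite big_flatten big_map; apply: eq_bigr => a _; rewrite big_map.
have ps : protocol A B s.
  split.
    move=> _ /flatten_mapP[a at_ /mapP[x xf ->]] /=.
    have [[hf _] _] := fP a; have [Ax Bx bx] := hf _ xf; split=> //.
    by apply: (cpairM AB) => //; exact: At.
  move=> u; rewrite ss; apply: le_trans (ct u); apply: ler_sum => a _.
  by have [[_ cf] _] := fP a; exact: cf.
have := value_ub phi chi ps; rewrite /score ss => h.
apply: (@le_trans _ _ (\sum_(a <- t) (score phi (f a) (a chi) + e / ((size t)%:R + 1)))).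
  by apply: ler_sum => a _; have [_ /ltW] := fP a.
rewrite big_split /=; apply: lerD; first exact: h.
rewrite big_const_seq count_predT iter_addr_0 -(mulr_natr (e / _)) mulrAC ler_pdivrMr //.
by apply: ler_wpM2l; [exact: ltW|rewrite lerDl].
Qed.

Lemma value_columnK t chi (K : R) : 0 < K -> (forall a, a \in t -> A a) ->
  (forall u, \sum_(a <- t) q (a u) <= K * q u) -> \sum_(a <- t) V (a chi) <= K * V chi.
Proof.
move=> K0 At ct; pose c := (Num.sqrt K)^-1.
have s2 : Num.sqrt K ^+ 2 = K by rewrite sqr_sqrtr // ltW.
have sn0 : Num.sqrt K != 0 by rewrite sqrtr_eq0 -ltNge.
have c2 : cm c%:C = K^-1 by rewrite cm_real exprVn s2.
have col : column A [seq c%:C *: a | a <- t].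
  split; first by move=> _ /mapP[a at_ ->]; apply: (cpairZ AB); exact: At.
  move=> u; rewrite big_map; under eq_bigr => a _ do rewrite opZ qZ c2.
  by rewrite -mulr_sumr mulrC ler_pdivrMr // mulrC.
have := value_column chi col; rewrite big_map => h.
apply: le_trans (ler_wpM2l (ltW K0) h); rewrite mulr_sumr; apply: ler_sum => a _.
rewrite -[X in V (X)](scale1r (a chi)) -(_ : (Num.sqrt K)%:C * c%:C = 1).
  rewrite -scalerA; apply: le_trans (valueZ _ _ _ _ _) _.
  by rewrite cm_real s2 -opZ.
by rewrite -rmorphM /= divff.
Qed.

Lemma value_bndA a chi (K : R) : 0 < K -> A a -> bnd K a -> V (a chi) <= K * V chi.
Proof.
move=> K0 Aa ba; have := @value_columnK [:: a] chi K K0; rewrite !big_cons !big_nil addr0.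
apply; first by move=> x; rewrite inE => /eqP->.
by move=> u; rewrite big_cons big_nil addr0; exact: ba.
Qed.

End pair.
End conversion_value.

(** * Transposition from [B] to [A] through an almost tracial vector *)

Section transposition.
Context {R : realType} {H : hilbertType R}.
Implicit Types (u v eta chi phi : H) (w e h z b a c x y : bop H).
Local Notation "''[' u , v ]" := (inner u v).
Variables A B : set (bop H).
Hypothesis AB : cpair A B.
Variables (K : R) (xi : H) (p r : bop H).
Hypotheses (K1 : 1 <= K) (Ap : A p) (Br : B r) (pp : proj p) (pr : proj r).
Hypotheses (pxi : p xi = xi) (rxi : r xi = xi).
Hypothesis p_perp : forall u, (forall b, B b -> '[u, b xi] = 0) -> p u = 0.
Hypothesis trB : forall z, B z -> r * z = z -> z * r = z -> q (adj z xi) <= K * q (z xi).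

Let BA := cpair_sym AB.
Let K0 : 0 <= K. Proof. exact: le_trans ler01 K1. Qed.

(** On the orbit [B xi], [a] is right multiplication by [b]; the condition [a * p = a] makes it
    vanish off the closure of that orbit. *)
Definition transposes b a :=
  [/\ A a, forall c, B c -> a (c xi) = c (b xi) & a * p = a].

Lemma pB b : B b -> p (b xi) = b xi.
Proof. by move=> Bb; rewrite (cpairCv AB _ Ap Bb) pxi. Qed.

(** [m = |c r|]. On vectors fixed by [r], such as [xi], it has the same norms as [c], but it is
    self-adjoint and lies in the corner, where the trace inequality is available. *)
Lemma abs_corner c : B c -> exists m, [/\ B m, r * m = m, m * r = m, adj m = m &
  forall v, q (m v) = q (c (r v))].
Proof.
move=> Bc; have [|||m [ o [[Bm _ pm mm] [_ _ _ _ [_ _ mr _]]]]] :=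
  @polar_corner _ _ B A (c * r) r 1 BA (cpairM BA Bc Br) pr.
- by split; [rewrite mulr1|exact: adj1].
- by rewrite mul1r.
- by rewrite -mulrA; case: pr => ->.
have ma := posop_sa pm; exists m; split=> //.
  by have := congr1 adj mr; rewrite adjM ma; case: pr => _ ->.
by move=> v; rewrite -opM !q_adj ma mm.
Qed.

(** The map [c xi |-> c b xi] is bounded: with [m = |c r|], [q (m b xi) = q (adj (adj b * m) xi) <=
    K q (adj b (m xi)) <= K k q (m xi)]. The two outer terms are [q (c b xi)] and [K k q (c xi)]. *)
Lemma transposes_ex b (k : R) : 0 <= k -> B b -> r * b = b -> b * r = b -> bnd k b ->
  exists2 a, transposes b a & bnd (K * k) a.
Proof.
move=> k0 Bb rb br bb.
pose D := [set x : H * H | exists2 c, B c & x = (c xi, c (b xi))].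
have D1 : linrel D.
  split; first by exists 0 => //; exact: (cpair0 BA).
  move=> s _ _ [c Bc ->] [d Bd ->]; exists (s *: c + d) => //.
  by apply: (cpairD BA) => //; exact: (cpairZ BA).
have [||a [ba aD a0 _ aC]] := @ext_op _ _ D (K * k) _ D1.
- by rewrite mulr_ge0.
- move=> _ [c Bc ->] /=; have [m [Bm rm mr ma mq]] := abs_corner Bc.
  have rbx : r (b xi) = b xi by rewrite -opM rb.
  rewrite -[in X in X <= _]rbx -mq -{2}rxi -mq -opM.
  have -> : m * b = adj (adj b * m) by rewrite adjM adjK ma.
  have rab : r * adj b = adj b by case: pr => _ h; rewrite -{1}h -adjM br.
  apply: le_trans (trB _ _ _) _.
  + by apply: (cpairM BA) => //; exact: (cpair_adj BA).
  + by rewrite mulrA rab.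
  + by rewrite -mulrA mr.
  + by rewrite -mulrA ler_wpM2l // opM; exact: bnd_adj.
exists a => //; split.
- apply: (cpairI AB) => y By; apply: aC => _ [c Bc ->] /=.
    by exists (y * c) => //; exact: (cpairM BA).
  by exists (adj y * c) => //; apply: (cpairM BA) => //; exact: (cpair_adj BA).
- by move=> c Bc; apply: (aD (c xi, c (b xi))); exists c.
- apply/eqP; rewrite -subr_eq0 -{2}[a]mulr1 -mulrBr; apply/eqP/bop_ext => u.
  have perp c : B c -> '[(p - 1) u, c xi] = 0.
    move=> Bc; rewrite -(pB Bc); case: pp => p2 pa; rewrite -{2}pa -adjP -opM mulrBr mulr1.
    by rewrite p2 subrr in0l.
  rewrite opM; apply: a0 => _ [c Bc ->]; exact: perp.
Qed.

(* In terms of states: if b_i are measurement operators of [B], their transposes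
   measure in [A]. *)
Lemma transposes_column (s : seq (bop H * bop H)) :
  (forall x : bop H * bop H, x \in s -> [/\ B x.1, adj x.1 = x.1, r * x.1 = x.1 & transposes x.1 x.2]) ->
  (forall u, \sum_(x <- s) q (x.1 u) <= q u) ->
  forall u, \sum_(x <- s) q (x.2 u) <= K * q u.
Proof.
move=> hs cs u.
pose T := \sum_(x <- s) adj x.2 * x.2.
have Tq v : complex.Re '[T v, v] = \sum_(x <- s) q (x.2 v).
  by rewrite /T op_sum in_suml Re_sum; apply: eq_bigr => x _; rewrite -q_adj.
have pT : posop T.
  apply: (big_ind (@posop R H)); [exact: posop0|exact: posopD|move=> x _; exact: posop_adj_mul].
(* The root [g] turns the sum of squares into the norm of a single operator, so that the bound on
   [B xi] extends to its closure by continuity. *)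
have [g [pg gg _]] := sqrt_ex pT.
have gq v : q (g v) = \sum_(x <- s) q (x.2 v) by rewrite -Tq q_adj (posop_sa pg) gg.
(* At [c xi] the transpose of [b] gives [c b xi], of squared norm [q (m b xi)]; the trace inequality
   exchanges [m b] with its adjoint [b m], and the [b] form a column at the vector [m xi]. *)
have onB c : B c -> q (g (c xi)) <= K * q (c xi).
  move=> Bc; rewrite gq; have [m [Bm rm mr ma mq]] := abs_corner Bc.
  rewrite -{2}rxi -mq; apply: le_trans (_ : K * \sum_(x <- s) q (x.1 (m xi)) <= _).
    rewrite mulr_sumr big_seq [X in _ <= X]big_seq; apply: ler_sum => x /hs[Bx xa rx [_ -> // _]].
    rewrite -{1}rx opM -mq -!opM.
    have xr : x.1 * r = x.1 by case: pr => _ h; rewrite -{1}xa -{1}h -adjM rx.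
    have -> : m * x.1 = adj (x.1 * m) by rewrite adjM ma xa.
    apply: trB; first exact: (cpairM BA).
      by rewrite mulrA rx.
    by rewrite -mulrA mr.
  by apply: ler_wpM2l.
have gp v : g v = g (p v).
  apply/eqP; rewrite -subr_eq0 -bB; apply/eqP/q_eq0; rewrite gq big_seq big1 // => x.
  by move=> /hs[_ _ _ [_ _ <-]]; rewrite opM bB -opM; case: pp => -> _; rewrite subrr b0 q0.
have sX : subspace [set b xi | b in B].
  split; first by exists 0 => //; exact: (cpair0 BA).
  move=> c _ _ [a Aa <-] [b Ab <-]; exists (c *: a + b) => //.
  by apply: (cpairD BA) => //; exact: (cpairZ BA).
rewrite -gq gp; have := proj_bnd pp u; rewrite mul1r => h.
apply: le_trans (ler_wpM2l K0 h).
have ex n : exists c, B c /\ q (p u - c xi) < n.+1%:R^-1.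
  have [||||_ [c Bc <-] hc] := @dense_proj _ _ _ p (p u) n.+1%:R^-1 sX pp; last by exists c.
  - by move=> v hv; apply: p_perp => b Bb; apply: hv; exists b.
  - by move=> _ [b Bb <-]; exact: pB.
  - by rewrite -opM; case: pp => ->.
  - by rewrite invr_gt0.
pose f n := sval (cid (ex n)).
have fP n : B (f n) /\ q (p u - f n xi) < n.+1%:R^-1 by rewrite /f; case: cid.
have cv : qcv (fun n => f n xi) (p u).
  move=> e e0; have [N hN] := invS_small e0; exists N => n /hN.
  by rewrite qBC; apply: lt_trans; case: (fP n).
by apply: qcv_le2 K0 cv (qcv_bop g cv) _ => n; apply: onB; case: (fP n).
Qed.

End transposition.

(** * Measurements of [B] on the vectors [x y xi] *)

Section swap.
Context {R : realType} {H : hilbertType R}.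
Implicit Types (u v eta chi phi : H) (w e h z a b c x y : bop H).
Local Notation "''[' u , v ]" := (inner u v).
Variables A B : set (bop H).
Hypothesis AB : cpair A B.
Variables (K : R) (xi phi : H) (p r : bop H).
Hypotheses (K1 : 1 <= K) (Ap : A p) (Br : B r) (pp : proj p) (pr : proj r).
Hypotheses (pxi : p xi = xi) (rxi : r xi = xi).
Hypothesis p_perp : forall u, (forall b, B b -> '[u, b xi] = 0) -> p u = 0.
Hypothesis r_perp : forall u, (forall a, A a -> '[u, a xi] = 0) -> r u = 0.
Hypothesis trA : forall z, A z -> p * z = z -> z * p = z -> q (adj z xi) <= K * q (z xi).
Hypothesis trB : forall z, B z -> r * z = z -> z * r = z -> q (adj z xi) <= K * q (z xi).

Let BA := cpair_sym AB.
Let K0 : 0 < K. Proof. exact: lt_le_trans ltr01 K1. Qed.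
Local Notation V := (value A B phi).
Let toA := transposes_ex AB K1 Ap Br pp pr pxi rxi trB.
Let toB := transposes_ex BA K1 Br Ap pr pp rxi pxi trA.
Let proj1 : proj (1 : bop H). Proof. by split; [rewrite mulr1|exact: adj1]. Qed.

Let toA1 b : B b -> r * b = b -> b * r = b -> bnd 1 b ->
  exists a, [/\ A a, bnd K a & forall c, B c -> a (c xi) = c (b xi)].
Proof.
move=> Bb rb br bb; have [a [Aa ha _] ba] := toA ler01 Bb rb br bb.
by exists a; split=> //; move: ba; rewrite mulr1.
Qed.

(** For [z = o m], the contraction [o] is dropped at no cost, and
    [m xi = adj z (o xi) = a (adj z xi)] for the transpose [a] of [o], which costs [K]. *)
Lemma value_adj z : B z -> r * z = z -> z * r = z -> V (z xi) <= K * V (adj z xi).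
Proof.
move=> Bz rz zr.
have [m [ o [[Bm Bo pm mm] [ omz oz pio bo [ro or _ _]]]]] := polar_corner BA Bz pr pr rz zr.
have [a [Aa ba ha]] := toA1 Bo ro or bo.
have -> : z xi = o (m xi) by rewrite -opM omz.
apply: le_trans (value_contrB AB _ _ Bo bo) _.
have -> : m xi = a (adj z xi).
  have Baz := cpair_adj BA Bz.
  by rewrite (ha _ Baz) -opM -{1}(posop_sa pm) -oz adjM adjK.
exact: value_bndA.
Qed.

(** Polar decompositions reduce [chi] to [s xi], with [s] positive in the corner of [B]; then each
    [b] becomes a positive [tb] of that corner, and the transposes of these measure in [A]. The
    exponent 4 counts one [K] for passing to [s xi], one for [a1] and one for [value_adj] in each
    branch, and one for the measurement by transposes. *)
Lemma swap_value x y t : A x -> B y -> column B t ->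
  \sum_(b <- t) V (b (x (y xi))) <= K ^+ 4 * V (x (y xi)).
Proof.
move=> Ax By [Bt ct]; set chi := x (y xi).
have [rr ra] := pr; have [p2 pa] := pp.
(* [y r = w k], where [k] lies in the corner of [B], so that its transpose [h] moves it into [A]. *)
have [k [w [[Bk Bw pk kk] [wk wz piw bw [_ wr kr _]]]]] :
    exists k w, [/\ B k, B w, posop k & k * k = adj (y * r) * (y * r)] /\
    [/\ w * k = y * r, adj w * (y * r) = k, pisom w, bnd 1 w &
      [/\ 1 * w = w, w * r = w, k * r = k & forall v, (y * r) v = 0 -> w v = 0]].
  by apply: polar_corner BA _ pr proj1 _ _; rewrite ?mul1r // -?mulrA ?rr //; exact: (cpairM BA).
have ka := posop_sa pk.
have rk : r * k = k by have := congr1 adj kr; rewrite adjM ka ra.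
have [kb kb0 bk] := bop_bnd k.
have [h [Ah hk _] _] := toA (ltW kb0) Bk rk kr bk.
have hxi : h xi = k xi by have := hk 1 (cpair1 BA).
(* Now [x h p = u g] in [A], so [chi = w u g xi] with [g] positive in the corner of [A]: a kind of
   Schmidt form. *)
have [g [u [[Ag Au pg gg] [ug uz piu bu [_ up gp _]]]]] :
    exists g u : bop H, [/\ A g, A u, posop g & g * g = adj (x * h * p) * (x * h * p)] /\
    [/\ u * g = x * h * p, adj u * (x * h * p) = g, pisom u, bnd 1 u &
      [/\ 1 * u = u, u * p = u, g * p = g & forall v, (x * h * p) v = 0 -> u v = 0]].
  apply: polar_corner AB _ pp proj1 _ _; rewrite ?mul1r // -?[_ * p * p]mulrA ?p2 //.
  by apply: (cpairM AB) => //; exact: (cpairM AB).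
have ga := posop_sa pg.
have pgg : p * g = g by have := congr1 adj gp; rewrite adjM ga pa.
have yxi : y xi = w (k xi) by rewrite -opM wk opM rxi.
have ugxi : u (g xi) = x (k xi) by rewrite -opM ug !opM pxi hxi.
have chiE : chi = w (u (g xi)) by rewrite ugxi /chi yxi (cpairCv AB _ Ax Bw).
have gxi : g xi = adj w (adj u chi).
  have -> : g xi = adj u (u (g xi)) by rewrite -(opM u) ug -opM uz.
  rewrite -(cpairCv AB _ (cpair_adj AB Au) (cpair_adj BA Bw)); congr (adj u _).
  rewrite /chi -(cpairCv AB _ Ax (cpair_adj BA Bw)) ugxi; congr (x _).
  by rewrite -{1}wz !opM rxi.
have Vg : V (g xi) <= V chi.
  rewrite gxi; apply: le_trans (value_contrB AB _ _ (cpair_adj BA Bw) (bnd_adj ler01 bw)) _.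
  have := value_bndA AB phi chi ltr01 (cpair_adj AB Au) (bnd_adj ler01 bu).
  by rewrite mul1r.
have [gb gb0 bg] := bop_bnd g.
(* Since [xi] is only almost tracial, the transpose of the positive [g] need not be positive. It is
   compressed to the corner and decomposed once more, as [l = s * adj o]. *)
have [l0 [Bl0 l0g _] _] := toB (ltW gb0) Ag pgg gp bg.
pose l := r * l0 * r.
have Bl : B l by apply: (cpairM BA) => //; exact: (cpairM BA).
have lxi : l xi = g xi.
  have l0xi : l0 xi = g xi by have := l0g 1 (cpair1 AB).
  by rewrite /l !opM rxi l0xi -(cpairCv AB _ Ag Br) rxi.
have rl : r * l = l by rewrite /l !mulrA rr.
have lr : l * r = l by rewrite /l -!mulrA rr.
have ral : r * adj l = adj l by rewrite -{1}ra -adjM lr.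
have alr : adj l * r = adj l by rewrite -{1}ra -adjM rl.
have [s [ o [[Bs Bo ps ss] [ os oz pio bo [ro or sr _]]]]] :=
  polar_corner BA (cpair_adj BA Bl) pr pr ral alr.
have sa := posop_sa ps.
have rs : r * s = s by have := congr1 adj sr; rewrite adjM sa ra.
have rao : r * adj o = adj o by rewrite -{1}ra -adjM or.
have aor : adj o * r = adj o by rewrite -{1}ra -adjM ro.
(* The transposes [a1] of [adj o] and [a2] of [o] lead from [s xi] to [g xi] and back. *)
have [a1 [Aa1 ba1 ha1]] := toA1 (cpair_adj BA Bo) rao aor (bnd_adj ler01 bo).
have [a2 [Aa2 ba2 ha2]] := toA1 Bo ro or bo.
have gs : g xi = a1 (s xi).
  have e : l = s * adj o by rewrite -[l]adjK -os adjM sa.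
  by rewrite ha1 // -lxi e.
have sg : s xi = a2 (g xi).
  have e : s = l * o by rewrite -[LHS]sa -oz adjM !adjK.
  by rewrite -lxi ha2 // {1}e.
have Vs : V (s xi) <= K * V chi.
  rewrite sg; apply: le_trans (value_bndA AB _ _ K0 Aa2 ba2) _.
  by rewrite ler_pM2l.
(* Here [b chi = u a1 ob (tb s xi)], where [b w r = ob tb]. By [value_adj], [tb s] may be replaced
   by its adjoint [s tb], and [s tb xi = ab s xi] for the transpose [ab] of [tb]. The pair [(0, 0)]
   is a default for [b] outside [t]. *)
have each b : exists ta : bop H * bop H, b \in t ->
    [/\ B ta.1, adj ta.1 = ta.1, r * ta.1 = ta.1 & transposes A B xi p ta.1 ta.2] /\
    [/\ (forall v, q (ta.1 v) = q (b (w (r v)))) & V (b chi) <= K ^+ 2 * V (ta.2 (s xi))].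
  have [bt|_] := boolP (b \in t); last by exists (0, 0).
  have Bb := Bt _ bt.
  have [|||tb [ob [[Btb Bob ptb tt] [ otz _ _ bob [_ _ tr _]]]]] :=
      @polar_corner _ _ B A (b * w * r) r 1 BA _ pr proj1.
  - by apply: (cpairM BA) => //; exact: (cpairM BA).
  - by rewrite mul1r.
  - by rewrite -mulrA rr.
  have tba := posop_sa ptb.
  have rt : r * tb = tb by have := congr1 adj tr; rewrite adjM tba ra.
  have [tk tk0 btk] := bop_bnd tb.
  have [ab tab _] := toA (ltW tk0) Btb rt tr btk.
  exists (tb, ab) => _ /=; split=> //; split.
    by move=> v; rewrite q_adj tba tt -q_adj !opM.
  have e1 : b chi = u (b (w (g xi))).
    by rewrite chiE -(cpairCv AB _ Au Bw) -(cpairCv AB _ Au Bb).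
  have e2 : b (w (g xi)) = a1 (ob (tb (s xi))).
    rewrite gs -(cpairCv AB _ Aa1 Bw) -(cpairCv AB _ Aa1 Bb); congr (a1 _).
    by rewrite -(opM ob) otz !opM -{1}rs opM.
  have [Aab hab _] := tab.
  have abxi : ab xi = tb xi by have := hab 1 (cpair1 BA).
  have e3 : adj (tb * s) xi = ab (s xi).
    by rewrite adjM sa tba opM -abxi (cpairCv AB _ Aab Bs).
  have h1 : V (b chi) <= V (b (w (g xi))).
    by rewrite e1; have := value_bndA AB phi (b (w (g xi))) ltr01 Au bu; rewrite mul1r.
  apply: le_trans h1 _; rewrite e2 expr2 -mulrA.
  apply: le_trans (value_bndA AB _ _ K0 Aa1 ba1) _; apply: ler_wpM2l; first exact: ltW.
  apply: le_trans (value_contrB AB _ _ Bob bob) _; rewrite -e3 -opM; apply: value_adj.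
  - exact: (cpairM BA).
  - by rewrite mulrA rt.
  - by rewrite -mulrA sr.
pose f b := sval (cid (each b)).
have fP b : b \in t ->
    [/\ B (f b).1, adj (f b).1 = (f b).1, r * (f b).1 = (f b).1 & transposes A B xi p (f b).1 (f b).2] /\
    [/\ (forall v, q ((f b).1 v) = q (b (w (r v)))) & V (b chi) <= K ^+ 2 * V ((f b).2 (s xi))].
  by rewrite /f; case: cid.
have col : forall v, \sum_(ta <- [seq f b | b <- t]) q (ta.2 v) <= K * q v.
  apply: (transposes_column AB K1 Ap Br pp pr pxi rxi p_perp trB).
    by move=> _ /mapP[b bt ->]; case: (fP _ bt).
  move=> v; rewrite big_map big_seq.
  rewrite (eq_bigr (fun b : bop H => q (b (w (r v))))); last first.
    by move=> b bt; have [_ [-> _]] := fP b bt.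
  rewrite -big_seq; apply: le_trans (ct _) _.
  have := bw (r v); have := proj_bnd pr v; rewrite !mul1r => h5 h6; first exact: (le_trans h6 h5).
have := @value_columnK _ _ _ _ AB phi [seq (f b).2 | b <- t] (s xi) K K0 _ _.
rewrite !big_map => h4.
have {}h4 : \sum_(b <- t) V ((f b).2 (s xi)) <= K * V (s xi).
  apply: h4; last by move=> v; have := col v; rewrite !big_map.
  by move=> _ /mapP[b bt ->]; case: (fP _ bt) => -[_ _ _ []].
apply: (@le_trans _ _ (K ^+ 2 * \sum_(b <- t) V ((f b).2 (s xi)))).
  rewrite mulr_sumr big_seq [X in _ <= X]big_seq; apply: ler_sum => b bt.
  by case: (fP _ bt) => _ [].
have -> : K ^+ 4 * V chi = K ^+ 2 * (K * (K * V chi)) by ring.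
apply: ler_wpM2l; first exact: sqr_ge0.
by apply: le_trans h4 _; rewrite ler_pM2l.
Qed.

End swap.

(** A name of its own for the finite functions, to carry the [l^2] norm and inner product. *)
Definition hsum {R : realType} (H : hilbertType R) (I : finType) : Type := {ffun I -> H}.

(** * Amplification *)

Section hilbert_sum.
Context {R : realType} {H : hilbertType R} {I : finType}.
Local Notation "''[' u , v ]" := (inner u v).

HB.instance Definition _ := GRing.Lmodule.copy (hsum H I) {ffun I -> H}.

Implicit Types u v : hsum H I.

Lemma hsumE u v i : (u + v) i = u i + v i.
Proof. by rewrite ffunE. Qed.

Lemma hsumZ a u i : (a *: u) i = a *: u i.
Proof. by rewrite ffunE. Qed.

Lemma hsumN u i : (- u) i = - u i.
Proof. by rewrite ffunE. Qed.

Lemma hsum0 i : (0 : hsum H I) i = 0.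
Proof. by rewrite ffunE. Qed.

Definition hq u : R := \sum_i q (u i).

Lemma hq_ge0 u : 0 <= hq u.
Proof. by apply: sumr_ge0 => i _; exact: q_ge0. Qed.

Lemma hq_eq0 u : hq u = 0 -> u = 0.
Proof.
move=> /eqP; rewrite psumr_eq0 => [/allP h|i _]; last exact: q_ge0.
apply/ffunP => i; rewrite hsum0; apply: q_eq0; apply/eqP.
by apply: h; rewrite mem_index_enum.
Qed.

Lemma hq_le u i : q (u i) <= hq u.
Proof.
rewrite /hq (bigD1 i) //= lerDl; apply: sumr_ge0 => j _; exact: q_ge0.
Qed.

Let hrp u v : R := \sum_i rp (u i) (v i).

Lemma hrp_le u v : hrp u v <= Num.sqrt (hq u) * Num.sqrt (hq v).
Proof.
have u0 := hq_ge0 u; have v0 := hq_ge0 v.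
have [/hq_eq0 ->|un0] := eqVneq (hq u) 0.
  rewrite /hrp big1 => [|i _]; last by rewrite hsum0 /rp in0l.
  by rewrite mulr_ge0 ?sqrtr_ge0.
have [/hq_eq0 ->|vn0] := eqVneq (hq v) 0.
  rewrite /hrp big1 => [|i _]; last by rewrite hsum0 /rp in0r.
  by rewrite mulr_ge0 ?sqrtr_ge0.
set a := Num.sqrt (hq u); set b := Num.sqrt (hq v).
have a0 : 0 < a by rewrite sqrtr_gt0 lt_neqAle eq_sym un0.
have b0 : 0 < b by rewrite sqrtr_gt0 lt_neqAle eq_sym vn0.
have d0 : 0 < b / a by rewrite divr_gt0.
have : hrp u v *+ 2 <= (b / a) * hq u + (b / a)^-1 * hq v.
  rewrite /hrp -sumrMnl /hq !mulr_sumr -big_split; apply: ler_sum => i _; exact: rp_le.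
have -> : hq u = a ^+ 2 by rewrite sqr_sqrtr.
have -> : hq v = b ^+ 2 by rewrite sqr_sqrtr.
have -> : b / a * a ^+ 2 + (b / a)^-1 * b ^+ 2 = (a * b) *+ 2.
  by field; rewrite ?gt_eqF.
by rewrite lerMn2r.
Qed.

Definition hnorm u : R[i] := (Num.sqrt (hq u))%:C.

Lemma hnormD u v : hnorm (u + v) <= hnorm u + hnorm v.
Proof.
rewrite -rmorphD lecR /= -[leRHS]ger0_norm ?addr_ge0 ?sqrtr_ge0 // -sqrtr_sqr.
apply: ler_wsqrtr; have -> : hq (u + v) = hq u + hq v + hrp u v *+ 2.
  rewrite /hq /hrp -sumrMnl -!big_split; apply: eq_bigr => i _.
  by rewrite hsumE qD.
have := hrp_le u v; rewrite sqrrD !sqr_sqrtr ?hq_ge0 // mulr2n mulr2n; lra.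
Qed.

Lemma hqZ (a : R[i]) u : hq (a *: u) = cm a * hq u.
Proof. by rewrite /hq mulr_sumr; apply: eq_bigr => i _; rewrite hsumZ qZ. Qed.

Lemma hnormZ (a : R[i]) u : hnorm (a *: u) = `|a| * hnorm u.
Proof. by rewrite /hnorm hqZ norm_cm sqrtrM ?cm_ge0 // rmorphM. Qed.

Lemma hnorm0 u : hnorm u = 0 -> u = 0.
Proof.
move=> /(congr1 (@complex.Re R))/= /eqP; rewrite sqrtr_eq0 => h; apply: hq_eq0.
by apply/eqP; rewrite eq_le h hq_ge0.
Qed.

HB.instance Definition _ := Lmodule_isNormed.Build R[i] (hsum H I) hnormD hnormZ hnorm0.

Lemma hsum_norm u : `|u| = (Num.sqrt (hq u))%:C.
Proof. by []. Qed.

Lemma hsum_complete (F : set_system (hsum H I)) : ProperFilter F -> cauchy F -> cvg F.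
Proof.
move=> PF /cauchy_ballP cF.
have lt_hq u (r : R) : 0 < r -> (`|u| < r%:C) = (hq u < r ^+ 2).
  move=> r0; rewrite hsum_norm ltcR -[X in _ < X](gtr0_norm r0) -sqrtr_sqr ltr_sqrt //.
  by rewrite exprn_gt0.
have ci i : cvg ((fun u : hsum H I => u i) @ F).
  apply/cauchy_cvgP/cauchy_ballP => e /ltc0P[r r0 ->].
  have := cF r%:C; rewrite ltcR => /(_ r0)[[P Q] /= [FP FQ] PQ].
  exists ([set u i | u in P], [set u i | u in Q]).
    by split; [apply: (filterS _ FP)|apply: (filterS _ FQ)] => u Pu; exists u.
  move=> [_ _] /= [[u Pu <-] [v Qv <-]].
  have := PQ (u, v); rewrite /= -!ball_normE /= => /(_ (conj Pu Qv)).
  rewrite lt_hq // norm_ltq //; apply: le_lt_trans.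
  by have := hq_le (u - v) i; rewrite hsumE hsumN.
pose l : hsum H I := [ffun i => lim ((fun u : hsum H I => u i) @ F)].
apply/cvg_ex; exists l; apply/cvgrPdist_lt => e /ltc0P[r r0 ->].
have k0 : 0 < #|I|%:R + 1 :> R by rewrite ltr_wpDl.
pose d := Num.sqrt (r ^+ 2 / (#|I|%:R + 1)).
have d0 : 0 < d by rewrite sqrtr_gt0 divr_gt0 // exprn_gt0.
have : F [set u : hsum H I | forall i, `|l i - u i| < d%:C].
  apply: filter_forall => i; rewrite ffunE.
  by have /cvgrPdist_lt/(_ d%:C) := ci i; rewrite ltcR; apply.
apply: filterS => u hu; rewrite lt_hq //.
apply: (@le_lt_trans _ _ (#|I|%:R * (r ^+ 2 / (#|I|%:R + 1)))).
  rewrite mulr_natl -sumr_const; apply: ler_sum => i _.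
  have := hu i; rewrite norm_ltq // sqr_sqrtr; last by rewrite divr_ge0 ?sqr_ge0 // ltW.
  by move=> h; apply: ltW; rewrite hsumE hsumN.
rewrite mulrCA gtr_pMr ?exprn_gt0 // ltr_pdivrMr // mul1r; lra.
Qed.

HB.instance Definition _ := Uniform_isComplete.Build (hsum H I) hsum_complete.

Definition hinner u v : R[i] := \sum_i '[u i, v i].

Lemma hinner_bilinear : bilinear_for (GRing.Scale.Law.clone _ _ *%R _)
  (GRing.Scale.Law.clone _ _ (@Num.conj R[i] \; *%R) _) hinner.
Proof.
split=> w a u v; rewrite /hinner /= mulr_sumr -big_split; apply: eq_bigr => i _ /=.
  by rewrite hsumE hsumZ inDl inZl.
by rewrite hsumE hsumZ inDr inZr.
Qed.

HB.instance Definition _ := bilinear_isBilinear.Build R[i] (hsum H I) (hsum H I) R[i]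
  *%R (@Num.conj R[i] \; *%R) hinner hinner_bilinear.

Lemma hinner_hermitian u v : hinner u v = (-1) ^+ false * Num.conj (hinner v u).
Proof.
rewrite expr0 mul1r /hinner rmorph_sum; apply: eq_bigr => i _; exact: inC.
Qed.

HB.instance Definition _ := isHermitianSesquilinear.Build R[i] (hsum H I) false
  (@Num.conj R[i]) hinner hinner_hermitian.

Lemma hinnerq u : hinner u u = (hq u)%:C.
Proof. by rewrite /hinner /hq rmorph_sum; apply: eq_bigr => i _; rewrite inq. Qed.

Lemma hinner_gt0 u : u != 0 -> 0 < hinner u u.
Proof.
move=> u0; rewrite hinnerq ltcR lt_neqAle hq_ge0 andbT eq_sym.
by apply: contra_neq u0; exact: hq_eq0.
Qed.

HB.instance Definition _ := isDotProduct.Build R[i] (hsum H I) hinner hinner_gt0.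

Lemma hinner_norm u : hinner u u = `|u| ^+ 2.
Proof.
by rewrite hinnerq hsum_norm -rmorphXn /= sqr_sqrtr // hq_ge0.
Qed.

HB.instance Definition _ := isHilbert.Build R (hsum H I) hinner_norm.

Lemma hsum_inner u v : inner u v = \sum_i '[u i, v i].
Proof. by []. Qed.

Lemma hsum_q u : q u = hq u.
Proof. by rewrite /q hsum_inner Re_sum. Qed.

End hilbert_sum.

Section amplification.
Context {R : realType} {H : hilbertType R} (J : finType) (j0 : J).
Local Notation HH := (hsum H (Datatypes_prod__canonical__fintype_Finite J J)).
Implicit Types (u v w : HH) (a b : bop H).
Local Notation "''[' u , v ]" := (inner u v).

Lemma hffunE (F : J * J -> H) i : ([ffun i => F i] : HH) i = F i.
Proof. by rewrite ffunE. Qed.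

Lemma hext (u v : HH) : (forall i, u i = v i) -> u = v.
Proof. by move=> h; apply/ffunP. Qed.

(* Sums in [HH] are stated with the instance of [hsum]: they are convertible, but not
   syntactically equal, to those found through its [hilbertType] structure. *)
Let dgf (x : bop H) (u : HH) : HH := [ffun i => x (u i)].

Lemma dg_linear x (c : R[i]) u v : dgf x (c *: u + v) = c *: dgf x u + dgf x v.
Proof.
by apply: hext => i; rewrite hsumE hsumZ !hffunE ?hsumE ?hsumZ bop_linear.
Qed.

Lemma dg_ex (x : bop H) : exists X : bop HH, forall u i, X u i = x (u i).
Proof.
have [K K0 bx] := bop_bnd x.
have [|X hX] := @mkbop _ _ (dgf x) K (@dg_linear x).
  move=> u; rewrite !hsum_q /hq mulr_sumr; apply: ler_sum => i _.
  by rewrite hffunE; exact: bx.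
by exists X => u i; rewrite hX hffunE.
Qed.

Definition dg (x : bop H) : bop HH := sval (cid (dg_ex x)).

Lemma dgE x u i : dg x u i = x (u i).
Proof. by rewrite /dg; case: cid. Qed.

Let shf (P : pred (J * J)%type) (f : J * J -> J * J) (u : HH) : HH :=
  [ffun i => if P i then u (f i) else 0].

Lemma sh_linear P f (c : R[i]) u v : shf P f (c *: u + v) = c *: shf P f u + shf P f v.
Proof.
apply: hext => i; rewrite hsumE hsumZ !hffunE /=.
by case: ifP => _; rewrite ?hsumE ?hsumZ ?scaler0 ?addr0.
Qed.

Lemma sh_ex (P : pred (J * J)%type) (f : J * J -> J * J) : {in P &, injective f} ->
  exists X : bop HH, forall u i, X u i = if P i then u (f i) else 0.
Proof.
move=> fI; have [|X hX] := mkbop (K := 1) (@sh_linear P f).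
  move=> u; rewrite mul1r !hsum_q /hq.
  rewrite (eq_bigr (fun i => if P i then q (u (f i)) else 0)); last first.
    by move=> i _; rewrite hffunE; case: ifP; rewrite ?q0.
  rewrite -big_mkcond -(big_imset (fun i => q (u i))) /=; last exact: fI.
  rewrite [X in _ <= X](bigID (mem (f @: P))) /= lerDl; apply: sumr_ge0 => i _; exact: q_ge0.
by exists X => u i; rewrite hX hffunE.
Qed.

Lemma shL_inj (k l : J) : {in [pred i : J * J | i.1 == k] &, injective (fun i => (l, i.2))}.
Proof. by move=> [i j] [i' j'] /eqP /= -> /eqP /= -> [->]. Qed.

Lemma shR_inj (k l : J) : {in [pred i : J * J | i.2 == k] &, injective (fun i => (i.1, l))}.
Proof. by move=> [i j] [i' j'] /eqP /= -> /eqP /= -> [->]. Qed.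

(* The matrix units of the two copies of the matrix algebra over J. *)
Definition shL k l : bop HH := sval (cid (sh_ex (@shL_inj k l))).
Definition shR k l : bop HH := sval (cid (sh_ex (@shR_inj k l))).

Lemma shLE k l u i j : shL k l u (i, j) = if i == k then u (l, j) else 0.
Proof. by rewrite /shL; case: cid => X /= ->. Qed.

Lemma shRE k l u i j : shR k l u (i, j) = if j == k then u (i, l) else 0.
Proof. by rewrite /shR; case: cid => X /= ->. Qed.

Lemma dgM x y : dg (x * y) = dg x * dg y.
Proof. by apply: bop_ext => u; apply: hext => i; rewrite opM !dgE. Qed.

Lemma dg_comm (x y : bop H) : x * y = y * x -> dg x * dg y = dg y * dg x.
Proof. by move=> h; rewrite -!dgM h. Qed.

Lemma dg_shL x k l : dg x * shL k l = shL k l * dg x.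
Proof.
apply: bop_ext => u; apply: hext => -[i j]; rewrite !opM dgE !shLE dgE.
by case: ifP => _; rewrite ?b0.
Qed.

Lemma dg_shR x k l : dg x * shR k l = shR k l * dg x.
Proof.
apply: bop_ext => u; apply: hext => -[i j]; rewrite !opM dgE !shRE dgE.
by case: ifP => _; rewrite ?b0.
Qed.

Lemma shL_shR k l k' l' : shL k l * shR k' l' = shR k' l' * shL k l.
Proof.
apply: bop_ext => u; apply: hext => -[i j]; rewrite !opM shLE !shRE shLE.
by case: ifP => _; case: ifP.
Qed.

Lemma adj_dg x : adj (dg x) = dg (adj x).
Proof.
apply: adj_uniq => u v; rewrite !hsum_inner; apply: eq_bigr => i _.
by rewrite !dgE adjP.
Qed.

Lemma sum_pairs (T : nmodType) (G : J * J -> T) : \sum_i G i = \sum_i \sum_j G (i, j).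
Proof. by rewrite pair_bigA /=; apply: eq_bigr => -[]. Qed.

Lemma adj_shL k l : adj (shL k l) = shL l k.
Proof.
apply: adj_uniq => u v; rewrite !hsum_inner !sum_pairs.
rewrite (bigD1 k) //= [X in _ + X]big1 ?addr0; last first.
  by move=> i ik; apply: big1 => j _; rewrite shLE (negbTE ik) in0l.
rewrite [RHS](bigD1 l) //= [X in _ = _ + X]big1 ?addr0; last first.
  by move=> i ik; apply: big1 => j _; rewrite shLE (negbTE ik) in0r.
by apply: eq_bigr => j _; rewrite !shLE !eqxx.
Qed.

Definition iota (k l : J) (v : H) : HH := [ffun i => if i == (k, l) then v else 0].

Lemma iotaE k l (v : H) i j : iota k l v (i, j) = if (i == k) && (j == l) then v else 0.
Proof. by rewrite ffunE xpair_eqE. Qed.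

Lemma iota_linear k l (a : R[i]) (v v' : H) : iota k l (a *: v + v') = a *: iota k l v + iota k l v'.
Proof.
apply: hext => -[i j]; rewrite hsumE hsumZ !iotaE.
by case: ifP => _ //; rewrite scaler0 addr0.
Qed.

Lemma inner_iota k l u (v : H) : '[u, iota k l v] = '[u (k, l), v].
Proof.
rewrite hsum_inner (bigD1 (k, l)) //= big1 ?addr0 => [|[i j] ij].
  by rewrite iotaE !eqxx.
by rewrite iotaE -xpair_eqE (negbTE ij) in0r.
Qed.

Lemma q_iota k l (v : H) : q (iota k l v) = q v.
Proof. by rewrite /q inner_iota iotaE !eqxx. Qed.

Lemma dg_iota (x : bop H) k l (v : H) : dg x (iota k l v) = iota k l (x v).
Proof.
by apply: hext => -[i j]; rewrite dgE !iotaE; case: ifP => _ //; rewrite b0.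
Qed.

Lemma corner_ex (X : bop HH) (k l m : J) :
  exists x : bop H, forall v : H, x v = X (iota l m v) (k, m).
Proof.
have [K K0 bX] := bop_bnd X.
apply: (@mkbop _ _ _ K).
  move=> a v v'; have e : X (iota l m (a *: v + v')) = a *: X (iota l m v) + X (iota l m v') :> HH.
    by rewrite iota_linear; exact: bop_linear.
  by rewrite e hsumE hsumZ.
move=> v; apply: le_trans (hq_le _ _) _; rewrite -hsum_q -(q_iota l m v); exact: bX.
Qed.

(** The [(k, l)] matrix entry for the first copy of the matrix algebra, read in position [m] of the
    second copy. Elements of [ampA] commute with the second copy, so their entries do not depend on
    [m]. *)
Definition corner (X : bop HH) k l m : bop H := sval (cid (corner_ex X k l m)).

Lemma cornerE X k l m (v : H) : corner X k l m v = X (iota l m v) (k, m).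
Proof. by rewrite /corner; case: cid. Qed.

Lemma corner_bnd X k l m (c : R) : bnd c X -> bnd c (corner X k l m).
Proof.
move=> bX v; rewrite cornerE; apply: le_trans (hq_le _ _) _.
by rewrite -hsum_q -(q_iota l m v); exact: bX.
Qed.

Lemma corner_comm X k l m b : dg b * X = X * dg b -> b * corner X k l m = corner X k l m * b.
Proof.
move=> h; apply: bop_ext => v; rewrite !opM !cornerE -dg_iota -(opM X) -h opM dgE //.
Qed.

Variables A B : set (bop H).
Hypothesis AB : cpair A B.
Let BA := cpair_sym AB.

(** [HH] is [H] tensored with two copies of the space over [J]; [A] is amplified by matrices on the
    first copy and [B] by matrices on the second. Taking a commutant and a bicommutant makes the
    amplified algebras a pair at once, without a description of their elements as matrices. *)
Definition amp_gen : set (bop HH) := [set X | (exists2 x, A x & X = dg x) \/ exists k l, X = shL k l].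
Definition ampB := commutant amp_gen.
Definition ampA := commutant ampB.

Lemma amp_gen_star : star amp_gen.
Proof.
move=> _ [[x Ax ->]|[k [l ->]]].
  by left; exists (adj x); [exact: (cpair_adj AB)|rewrite adj_dg].
by right; exists l, k; rewrite adj_shL.
Qed.

Lemma amp_genA X : amp_gen X -> ampA X.
Proof. by move=> gX Y BY; rewrite BY. Qed.

Lemma amp_cpair : cpair ampA ampB.
Proof.
split=> //; first exact/star_commutant/star_commutant/amp_gen_star.
  exact/star_commutant/amp_gen_star.
apply/seteqP; split=> X hX Y.
  by move=> gY; apply: hX; exact: amp_genA.
by move=> AY; rewrite AY.
Qed.

Lemma dg_ampA x : A x -> ampA (dg x).
Proof. by move=> Ax; apply: amp_genA; left; exists x. Qed.

Lemma shL_ampA k l : ampA (shL k l).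
Proof. by apply: amp_genA; right; exists k, l. Qed.

Lemma dg_ampB x : B x -> ampB (dg x).
Proof.
move=> Bx _ [[y Ay ->]|[k [l ->]]]; last by rewrite dg_shL.
by apply: dg_comm; exact: (cpairC AB).
Qed.

Lemma shR_ampB k l : ampB (shR k l).
Proof. by move=> _ [[y Ay ->]|[k' [l' ->]]]; [rewrite dg_shR|rewrite shL_shR]. Qed.

Lemma corner_ampA X k l m : ampA X -> A (corner X k l m).
Proof.
move=> AX; apply: (cpairI AB) => b Bb; apply: corner_comm.
by apply: AX; exact: dg_ampB.
Qed.

Lemma corner_ampB X k l m : ampB X -> B (corner X k l m).
Proof.
move=> BX; apply: (cpairI BA) => a Aa; apply: corner_comm.
by apply: BX; left; exists a.
Qed.

(** [X] commutes with [shR j0 j0], so it keeps the second index at [j0]. It may spread the first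
    index, but [Y] commutes with [shL j0 j0], and only the component [j0] overlaps with the
    target. *)
Lemma score_corner X Y (chi phi : H) : ampA X -> ampB Y ->
  '[Y (X (iota j0 j0 chi)), iota j0 j0 phi] =
  '[corner Y j0 j0 j0 (corner X j0 j0 j0 chi), phi].
Proof.
move=> AX BY; rewrite !cornerE inner_iota; congr '[_, _].
have <- : shL j0 j0 (X (iota j0 j0 chi)) = iota j0 j0 (X (iota j0 j0 chi) (j0, j0)).
  have e : iota j0 j0 chi = shR j0 j0 (iota j0 j0 chi).
    apply: hext => -[i j]; rewrite shRE !iotaE eqxx andbT.
    by case: (j == j0); rewrite ?andbT ?andbF.
  apply: hext => -[i j]; rewrite shLE iotaE.
  case: ifP => //= _; rewrite {1}e -(opM X) -(AX _ (shR_ampB j0 j0)) opM shRE.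
  by case: ifP => // /eqP ->.
by rewrite -[in RHS](opM Y) -(BY _ (or_intror (ex_intro _ j0 (ex_intro _ j0 erefl)))) opM shLE eqxx.
Qed.

Lemma value_amp_le (phi chi : H) :
  value ampA ampB (iota j0 j0 phi) (iota j0 j0 chi) <= value A B phi chi.
Proof.
apply: value_le => s [hs cs].
have -> : score (iota j0 j0 phi) s (iota j0 j0 chi) =
    score phi [seq (corner x.1 j0 j0 j0, corner x.2 j0 j0 j0) | x <- s] chi.
  rewrite /score big_map big_seq [RHS]big_seq; apply: eq_bigr => x /hs[AX BX _].
  by rewrite score_corner.
apply: value_ub; split.
  move=> _ /mapP[x /hs[AX BX bX] ->] /=; split; [exact: corner_ampA|exact: corner_ampB|].
  exact: corner_bnd.
move=> v; rewrite big_map -(q_iota j0 j0 v); apply: le_trans (cs _); apply: ler_sum => x _.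
by rewrite /= cornerE; apply: le_trans (hq_le _ _) _; rewrite -hsum_q.
Qed.

Lemma column_dg (t : seq (bop H)) : (forall u : H, \sum_(x <- t) q (x u) <= q u) ->
  forall u, \sum_(x <- t) q (dg x u) <= q u.
Proof.
move=> ct u; under eq_bigr => x _ do rewrite hsum_q /hq.
rewrite exchange_big hsum_q /hq; apply: ler_sum => i _; apply: le_trans (ct _).
by apply: ler_sum => x _; rewrite dgE.
Qed.

Lemma value_le_amp (phi chi : H) :
  value A B phi chi <= value ampA ampB (iota j0 j0 phi) (iota j0 j0 chi).
Proof.
apply: value_le => s [hs cs].
have -> : score phi s chi =
    score (iota j0 j0 phi) [seq (dg x.1, dg x.2) | x <- s] (iota j0 j0 chi).
  rewrite /score big_map; apply: eq_bigr => x _.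
  by rewrite /= !dg_iota inner_iota iotaE !eqxx.
apply: value_ub; split.
  move=> _ /mapP[x /hs[Ax Bx bx] ->] /=; split; [exact: dg_ampA|exact: dg_ampB|].
  move=> u; rewrite mul1r !hsum_q; apply: ler_sum => i _; rewrite dgE.
  by have := bx (u i); rewrite mul1r.
move=> u; rewrite big_map.
have h (v : H) : \sum_(x <- [seq x.1 | x <- s]) q (x v) <= q v by rewrite big_map.
by have := column_dg h u; rewrite big_map.
Qed.

(** [xi] tensored with an unnormalized maximally entangled vector of the two copies, itself a
    tracial vector for each matrix algebra. *)
Definition diag_vec (xi : H) : HH := [ffun i => if i.1 == i.2 then xi else 0].

Lemma diag_vecE (xi : H) i j : diag_vec xi (i, j) = if i == j then xi else 0.
Proof. by rewrite ffunE. Qed.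

Lemma ampA_diag X (xi : H) i k : ampA X -> X (diag_vec xi) (i, k) = corner X i k j0 xi.
Proof.
move=> AX; rewrite cornerE.
have -> : X (diag_vec xi) (i, k) = shR j0 k (X (diag_vec xi)) (i, j0).
  by rewrite shRE eqxx.
rewrite -(opM (shR _ _)) (AX _ (shR_ampB _ _)) opM; congr (X _ _).
apply: hext => -[i' j']; rewrite shRE diag_vecE iotaE.
by case: (j' == j0); rewrite ?andbT ?andbF.
Qed.

Lemma corner_adj X i k : corner (adj X) i k j0 = adj (corner X k i j0).
Proof.
apply/esym/adj_uniq => u v; rewrite !cornerE -inner_iota adjP.
by rewrite [RHS]inC -inner_iota -inC.
Qed.

(** [q (z (diag_vec xi))] is the sum of [q (x xi)] over the matrix entries [x] of [z], and taking
    adjoints transposes the matrix. The inequality for each entry therefore adds up with the same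
    [K]. *)
Lemma amp_trace_data (K : R) xi : 0 <= K -> trace_data A B K xi ->
  trace_data ampA ampB K (diag_vec xi).
Proof.
move=> K0 [p [r [[Ap _ [pp pa] _ pxi] [_ _ _ tr _]]]].
apply: (@trace_dataI _ _ _ _ (dg p) _ _ amp_cpair K0).
- exact: dg_ampA.
- by split; [rewrite -dgM pp|rewrite adj_dg pa].
- by apply: hext => -[i j]; rewrite dgE !diag_vecE; case: ifP; rewrite ?b0.
move=> z Az pz zp; have Aaz : ampA (adj z) by exact: (cpair_adj amp_cpair).
rewrite !hsum_q /hq !sum_pairs exchange_big mulr_sumr.
apply: ler_sum => i _; rewrite mulr_sumr; apply: ler_sum => k _.
rewrite !ampA_diag // corner_adj; apply: tr.
- exact: corner_ampA.
- by apply: bop_ext => v; rewrite opM !cornerE -dgE -opM pz.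
- by apply: bop_ext => v; rewrite opM !cornerE -dg_iota -opM zp.
Qed.

(** The entangled vector contracts a row of operators [x l] against the operators [y l]: the sum
    becomes a single product of an element of [ampA] and one of [ampB]. *)
Lemma iota_amp (x y : J -> bop H) xi :
  iota j0 j0 (\sum_l x l (y l xi)) =
  (\sum_l dg (x l) * shL j0 l) ((\sum_l dg (y l) * shR j0 l) (diag_vec xi)).
Proof.
apply: hext => -[i j]; rewrite iotaE.
have opsum (F : J -> bop HH) u : (\sum_l F l) u = \sum_l F l u :> HH by exact: op_sum.
have sumE (F : J -> HH) k : (\sum_l F l) k = \sum_l F l k.
  by elim/big_rec2: _ => [|l u v _ <-]; rewrite ?hsum0 ?hsumE.
rewrite opsum sumE; under [RHS]eq_bigr => l _ do rewrite opM dgE shLE.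
case: (eqVneq i j0) => [_|_] /=; last by rewrite big1 // => l _; rewrite b0.
have e l : (\sum_k dg (y k) * shR j0 k) (diag_vec xi) (l, j) = if j == j0 then y l xi else 0.
  rewrite opsum sumE; under eq_bigr => k _ do rewrite opM dgE shRE diag_vecE.
  case: ifP => _; last by rewrite big1 // => k _; rewrite b0.
  rewrite (bigD1 l) //= eqxx big1 ?addr0 // => k kl.
  by rewrite eq_sym (negbTE kl) b0.
under [RHS]eq_bigr => l _ do rewrite e.
by case: ifP => // _; rewrite big1 // => l _; rewrite b0.
Qed.

Lemma swap_value_sum (K : R) xi phi (x y : J -> bop H) (t : seq (bop H)) : 1 <= K ->
  trace_data A B K xi -> (forall l, A (x l)) -> (forall l, B (y l)) -> column B t ->
  \sum_(b <- t) value A B phi (b (\sum_l x l (y l xi))) <=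
  K ^+ 4 * value A B phi (\sum_l x l (y l xi)).
Proof.
move=> K1 tr Ax By [Bt ct]; set chi := \sum_l _.
have K0 : 0 <= K by exact: le_trans ler01 K1.
have [p [r [[Ap Br pp pr pxi] [rxi pperp _ trA trB]]]] := amp_trace_data K0 tr.
have XA : ampA (\sum_l dg (x l) * shL j0 l).
  apply: (cpair_sum amp_cpair) => l; apply: (cpairM amp_cpair); [exact: dg_ampA|exact: shL_ampA].
have YB : ampB (\sum_l dg (y l) * shR j0 l).
  have BAh := cpair_sym amp_cpair.
  apply: (cpair_sum BAh) => l; apply: (cpairM BAh); [exact: dg_ampB|exact: shR_ampB].
have col : column ampB [seq dg b | b <- t].
  split; first by move=> _ /mapP[b bt ->]; apply: dg_ampB; exact: Bt.
  by move=> u; rewrite big_map; exact: column_dg.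
have := swap_value amp_cpair (iota j0 j0 phi) K1 Ap Br pp pr pxi rxi pperp trA trB XA YB col.
rewrite -iota_amp -/chi big_map => h.
apply: le_trans (_ : _ <= K ^+ 4 * value ampA ampB (iota j0 j0 phi) (iota j0 j0 chi)) _; last first.
  by apply: ler_wpM2l; [exact: exprn_ge0|exact: value_amp_le].
apply: le_trans h; apply: ler_sum => b _; rewrite dg_iota; exact: value_le_amp.
Qed.

End amplification.

(** * Measurements of [B] on arbitrary vectors *)

Section swap_all.
Context {R : realType} {H : hilbertType R}.
Implicit Types (u v w xi phi chi : H) (t : seq (bop H)).
Local Notation "''[' u , v ]" := (inner u v).
Variables A B : set (bop H).
Hypothesis AB : cpair A B.
Hypothesis sc : scalar_center A B.

Lemma swap_value_seq (K : R) xi phi (s : seq (bop H * bop H)) t : 1 <= K ->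
  trace_data A B K xi -> (forall x, x \in s -> A x.1 /\ B x.2) -> column B t ->
  \sum_(b <- t) value A B phi (b (\sum_(x <- s) x.1 (x.2 xi))) <=
  K ^+ 4 * value A B phi (\sum_(x <- s) x.1 (x.2 xi)).
Proof.
(* The extra index receives the default pair [(0, 0)] and keeps the index type inhabited when [s] is
   empty. *)
move=> K1 tr hs col; pose f (l : 'I_(size s).+1) := nth (0, 0) s l.
have e : \sum_(x <- s) x.1 (x.2 xi) = \sum_l (f l).1 ((f l).2 xi).
  rewrite big_ord_recr /= [X in _ + X](_ : _ = 0) ?addr0; last by rewrite /f nth_default.
  by rewrite (big_nth (0, 0)) big_mkord.
have hf l : A (f l).1 /\ B (f l).2.
  have [h|h] := ltnP l (size s); first by apply: hs; exact: mem_nth.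
  by rewrite /f nth_default //; split; [exact: (cpair0 AB)|exact: (cpair0 (cpair_sym AB))].
rewrite e; apply: (@swap_value_sum _ _ _ (ord0 : 'I_(size s).+1) _ _ AB K xi phi
  (fun l => (f l).1) (fun l => (f l).2)) => //.
  by move=> l; case: (hf l).
by move=> l; case: (hf l).
Qed.

(** In a factor, [factor_total] makes the vectors [a b xi] total as soon as [xi] is nonzero. *)
Lemma trace_vector_cyclic xi chi (e : R) : xi != 0 -> 0 < e ->
  exists2 s : seq (bop H * bop H), forall x, x \in s -> A x.1 /\ B x.2 &
    q (chi - \sum_(x <- s) x.1 (x.2 xi)) < e.
Proof.
move=> xi0 e0; have BA := cpair_sym AB.
pose S := [set v | exists2 s : seq (bop H * bop H), forall x, x \in s -> A x.1 /\ B x.2 &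
  v = \sum_(x <- s) x.1 (x.2 xi)].
have sS : subspace S.
  split; first by exists [::] => //; rewrite big_nil.
  move=> a u v [s hs ->] [t ht ->].
  exists ([seq (a *: x.1, x.2) | x <- s] ++ t).
    move=> x; rewrite mem_cat => /orP[/mapP[y ys ->]|/ht //] /=.
    by have [Ay By] := hs _ ys; split=> //; exact: (cpairZ AB).
  by rewrite big_cat big_map /= scaler_sumr.
have [|_ [s hs ->] h] := dense_perp chi sS _ e0; last by exists s.
move=> w hw; pose X := [set v | exists a b, [/\ A a, B b & v = a (b xi)]].
apply: (@factor_total _ _ A B X AB sc).
- by move=> x u Ax [a [b [Aa Bb ->]]]; exists (x * a), b; split=> //; exact: (cpairM AB).
- move=> x u Bx [a [b [Aa Bb ->]]]; exists a, (x * b); split=> //; first exact: (cpairM BA).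
  by rewrite opM (cpairCv AB _ Aa Bx).
- exists xi => //; exists 1, 1; split; [exact: (cpair1 AB)|exact: (cpair1 BA)|by []].
- move=> u [a [b [Aa Bb ->]]]; apply: hw; exists [:: (a, b)]; last by rewrite big_seq1.
  by move=> x; rewrite inE => /eqP ->.
Qed.

(* A measurement of [B] is simulated, up to local contractions, by one of [A]. *)
Lemma value_swap phi chi t :
  (forall K : R, 1 < K -> exists2 xi : H, xi != 0 & trace_data A B K xi) ->
  column B t -> \sum_(b <- t) value A B phi (b chi) <= value A B phi chi.
Proof.
move=> htr col; set V := value A B phi.
have V0 : 0 <= V chi by exact: value_ge0.
apply: lim_eps => e e0.
(* The loss is [(1 + d) ^+ 6]: four factors from the swap with [K = 1 + d], and two from replacing
   [chi] by [z] and back. For [d <= 1] it is at most [1 + 63 d], where [63 = 2^6 - 1]; as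
   [126 = 2 * 63], it accounts for at most [e / 2]. *)
pose d : R := Num.min 1 (e / (126 * (V chi + 1))).
have k0 : 0 < 126 * (V chi + 1) by rewrite mulr_gt0 //; lra.
have dp : 0 < e / (126 * (V chi + 1)) by rewrite divr_gt0.
have d0 : 0 < d by rewrite lt_min ltr01 dp.
have d1 : d <= 1 by rewrite ge_min lexx.
have de : d * (126 * (V chi + 1)) <= e.
  by rewrite -ler_pdivlMr // ge_min lexx orbT.
have i0 : 0 < d^-1 by rewrite invr_gt0.
have phi0 := q_ge0 phi.
have [|xi xi0 tr] := htr (1 + d); first by rewrite ltrDl.
(* The coefficient of [q (chi - z)] collected from the two perturbations; the approximation of [chi]
   is chosen after it, to cost at most [e / 2]. *)
pose C := (1 + d) ^+ 5 * ((1 + d^-1) * q phi) + (1 + d^-1) * q phi.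
have C1 : 0 <= (1 + d^-1) * q phi by rewrite mulr_ge0 // addr_ge0 // ltW.
have C0 : 0 <= C by rewrite addr_ge0 // mulr_ge0 // exprn_ge0 // addr_ge0 // ltW.
have [|s hs hd] := @trace_vector_cyclic xi chi (e / (2 * (C + 1))) xi0.
  by rewrite divr_gt0 //; lra.
set z := \sum_(x <- s) _ in hd.
have K1 : 1 <= 1 + d by rewrite lerDl ltW.
have swz := swap_value_seq phi K1 tr hs col; rewrite -/z -/V in swz.
have V1 : V z <= (1 + d) * V chi + (1 + d^-1) * (q phi * q (chi - z)).
  have := value_perturb A B phi chi (z - chi) d0.
  by rewrite addrC subrK qBC.
have V2 (b : bop H) : V (b chi) <= (1 + d) * V (b z) + (1 + d^-1) * (q phi * q (b (chi - z))).
  have := value_perturb A B phi (b z) (b (chi - z)) d0.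
  by rewrite -bD addrC subrK.
have V3 : \sum_(b <- t) V (b chi) <=
    (1 + d) * \sum_(b <- t) V (b z) + (1 + d^-1) * (q phi * q (chi - z)).
  apply: le_trans (ler_sum _ (fun b _ => V2 b)) _.
  rewrite big_split /= -!mulr_sumr; apply: lerD => //.
  by rewrite !mulrA; apply: ler_wpM2l => //; case: col.
have d01 : 0 <= 1 + d by lra.
have V4 : \sum_(b <- t) V (b chi) <= (1 + d) ^+ 6 * V chi + C * q (chi - z).
  apply: le_trans V3 _.
  apply: le_trans (lerD (ler_wpM2l d01 swz) (lexx _)) _.
  have K40 : 0 <= (1 + d) * (1 + d) ^+ 4 by rewrite mulr_ge0 ?exprn_ge0.
  rewrite mulrA; apply: le_trans (lerD (ler_wpM2l K40 V1) (lexx _)) _.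
  by rewrite le_eqVlt /C; apply/orP; left; apply/eqP; ring.
have V5 : C * q (chi - z) <= e / 2.
  move: hd; rewrite ltr_pdivlMr; last lra.
  by have := q_ge0 (chi - z); nra.
have V6 : (1 + d) ^+ 6 <= 1 + 63 * d.
  have h2 : d ^+ 2 <= d by rewrite expr2; nra.
  have h3 : d ^+ 3 <= d by rewrite exprS; nra.
  have h4 : d ^+ 4 <= d by rewrite exprS; nra.
  have h5 : d ^+ 5 <= d by rewrite exprS; nra.
  have h6 : d ^+ 6 <= d by rewrite exprS; nra.
  have -> : (1 + d) ^+ 6 = 1 + 6 * d + 15 * d ^+ 2 + 20 * d ^+ 3 + 15 * d ^+ 4 + 6 * d ^+ 5 + d ^+ 6 by ring.
  lra.
have V7 : (1 + d) ^+ 6 * V chi <= (1 + 63 * d) * V chi by apply: ler_wpM2r.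
nra.
Qed.

End swap_all.

Section factor_trace.
Context {R : realType} {H : hilbertType R}.
Implicit Types (A : set (bop H)).

Lemma factor_cpair A : is_factor A -> cpair A (commutant A) /\ scalar_center A (commutant A).
Proof.
move=> [[sA bA] cA]; have stA : star A.
  by move=> x Ax; apply: (sA x) => // u v; exact: adjP.
split; first by split=> //; exact: star_commutant.
move=> c Ac Bc; have : vn_center A c by [].
by rewrite cA => -[k _ <-]; exists k.
Qed.

(** Semi-finiteness, applied to the central projection 1, supplies the nonzero finite projection; 1
    is nonzero because [H] is. *)
Lemma factor_trace A (K : R) : is_factor A -> is_semifinite A -> (exists v : H, v != 0) -> 1 < K ->
  exists2 xi : H, xi != 0 & trace_data A (commutant A) K xi.
Proof.
move=> fA sfA [v v0] K1; have [AB sc] := factor_cpair fA.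
have c1 : vn_center A 1 by split; [exact: (cpair1 AB)|exact: commutant1].
have p1 : projection (1 : bop H) by apply/projE; split; [rewrite mulr1|exact: adj1].
have n1 : (1 : bop H) != 0.
  by apply: contra_neq v0 => /(congr1 (fun x : bop H => x v)).
have [e [[Ae /projE pe fe] e0 _]] := sfA _ c1 p1 n1.
have fpe : finproj A e.
  move=> w Aw we ew; have [ee ea] := pe.
  apply: fe; first by apply: (cpairM AB) => //; exact: (cpair_adj AB).
  - apply/projE/pisom_final; rewrite /pisom -mulrA we.
    apply/eqP; rewrite -subr_eq0 -{2}[w]mulr1 -mulrBr; apply/eqP/bop_ext => u.
    by apply: q_eq0; rewrite opM q_adj we -opM mulrBr mulr1 ee subrr op0 in0l.
  - exact: ew.
  - by exists w, (adj w); split=> // u u'; exact: adjP.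
have [p [xi [Ap pp xi0 pxi tr]]] := trace_vector AB sc Ae pe e0 fpe K1.
exists xi => //; apply: (trace_dataI AB _ Ap pp pxi tr).
by apply: ltW; exact: lt_trans ltr01 K1.
Qed.

End factor_trace.

(** * Kraus decomposition *)

Section completely_positive_forms.
Context {R : realType} {H : hilbertType R}.
Implicit Types (u v w g h eta : H) (x y k : bop H) (C : set (bop H)) (Psi : bop H -> bop H).
Local Notation "''[' u , v ]" := (inner u v).

Definition cp_form Psi n (x : 'I_n -> bop H) (z : 'I_n -> H) : R[i] :=
  \sum_i \sum_j '[Psi (adj (x i) * x j) (z j), z i].

(** Complete positivity tested on the matrices with entries [adj (x i) * x j], without normality:
    this form is convenient for the remainders left when Kraus terms are subtracted. *)
Definition cp_map Psi := (forall a x y, Psi (a *: x + y) = a *: Psi x + Psi y) /\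
  forall n (x : 'I_n -> bop H) z, 0 <= cp_form Psi x z.

Lemma normal_cp_map Psi : normal_cp Psi -> cp_map Psi.
Proof.
move=> [lP _ cP]; split=> // n x z.
have := cP n (\matrix_(i, j) (adj (x i) * x j)).
have -> : cp_form Psi x z = \sum_i \sum_j
    '[(map_mx Psi (\matrix_(i, j) (adj (x i) * x j))) i j (z j), z i].
  by apply: eq_bigr => i _; apply: eq_bigr => j _; rewrite !mxE.
apply=> xi.
have -> : \sum_i \sum_j '[(\matrix_(i, j) (adj (x i) * x j)) i j (xi j), xi i] =
    '[\sum_j x j (xi j), \sum_i x i (xi i)].
  rewrite in_sumr; apply: eq_bigr => i _; rewrite in_suml; apply: eq_bigr => j _.
  by rewrite mxE opM adjP'.
by rewrite inq ler0c q_ge0.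
Qed.

Section one_map.
Variable Psi : bop H -> bop H.
Hypothesis cP : cp_map Psi.

Lemma cpD x y : Psi (x + y) = Psi x + Psi y.
Proof. by have := cP.1 1 x y; rewrite !scale1r. Qed.

Lemma cp0 : Psi 0 = 0.
Proof. by apply: (addIr (Psi 0)); rewrite -cpD !add0r. Qed.

Lemma cpZ a x : Psi (a *: x) = a *: Psi x.
Proof. by rewrite -[a *: x]addr0 cP.1 cp0 addr0. Qed.

Lemma cpN x : Psi (- x) = - Psi x.
Proof. by rewrite -scaleN1r cpZ scaleN1r. Qed.

Lemma cpB x y : Psi (x - y) = Psi x - Psi y.
Proof. by rewrite cpD cpN. Qed.

Lemma cp_sum (I : Type) (s : seq I) (P : pred I) (F : I -> bop H) :
  Psi (\sum_(i <- s | P i) F i) = \sum_(i <- s | P i) Psi (F i).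
Proof. by elim/big_rec2: _ => [|i y x _ <-]; rewrite ?cp0 ?cpD. Qed.

Lemma cp_pos_mul x : posop (Psi (adj x * x)).
Proof.
move=> u; have := cP.2 1%N (fun=> x) (fun=> u).
by rewrite /cp_form !big_ord_recl !big_ord0 !addr0.
Qed.

Lemma cp_pos x : posop x -> posop (Psi x).
Proof.
by move=> px; have [r [pr <- _]] := sqrt_ex px; rewrite -{1}(posop_sa pr); exact: cp_pos_mul.
Qed.

(** The images of [adj (x + c) * (x + c)], for the scalars [c = 1] and [c = i], are self-adjoint;
    the terms linear in [x] yield two relations that determine [Psi (adj x)]. *)
Lemma cp_adj x : Psi (adj x) = adj (Psi x).
Proof.
have key (c : R[i]) X : X = c^* *: x + c *: adj x -> adj (Psi X) = Psi X.
  move=> XE; pose y := c *: (1 : bop H).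
  have e1 : adj (x + y) * (x + y) = adj x * x + X + (c^* * c) *: (1 : bop H).
    rewrite /y adjD adjZ adj1 mulrDl !mulrDr mulZr mulr1 mulZl mul1r mulZl mul1r scalerA.
    by rewrite XE -!addrA; congr (_ + _); rewrite addrCA.
  have := posop_sa (cp_pos_mul (x + y)); rewrite e1 !cpD !adjD (posop_sa (cp_pos_mul x)) cpZ adjZ.
  by rewrite (posop_sa (cp_pos posop1)) rmorphM /= conjCK [c * _]mulrC => /addIr /addrI.
have h1 := key 1 _ erefl; have h2 := key 'i%C _ erefl.
rewrite conjC1 !scale1r in h1.
move: h1 h2; rewrite !cpD !cpZ !adjD !adjZ conjCK => h1 h2.
have i0 : 'i%C != 0 :> R[i] by rewrite eq_complex /= oner_eq0 andbF.
have ci : ('i%C)^* = - 'i%C :> R[i] by apply/eqP; rewrite eq_complex /= oppr0 !eqxx.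
have h3 : adj (Psi x) - adj (Psi (adj x)) = Psi (adj x) - Psi x.
  apply: (scalerI i0); rewrite !scalerBr; move: h2; rewrite ci !scaleNr.
  by rewrite [RHS]addrC.
have h4 : adj (Psi x) + adj (Psi x) = Psi (adj x) + Psi (adj x).
  have := congr2 +%R h1 h3; rewrite addrACA subrr addr0 => ->.
  by rewrite [Psi x + _]addrC addrACA subrr addr0.
have n2 : 2 != 0 :> R[i] by rewrite pnatr_eq0.
by apply/esym/(scalerI n2); rewrite !scaler_nat !mulr2n.
Qed.

End one_map.
End completely_positive_forms.

Section kraus.
Context {R : realType} {H : hilbertType R}.
Implicit Types (u v w g h eta : H) (x y k : bop H) (C : set (bop H)) (Psi : bop H -> bop H).
Local Notation "''[' u , v ]" := (inner u v).

Lemma adj_rank1 g h : adj (rank1 g h) = rank1 h g.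
Proof.
by apply: adj_uniq => u v; rewrite !rank1E inZl inZr -inC mulrC.
Qed.

Lemma rank1_mul g h x : rank1 g h * x = rank1 g (adj x h).
Proof. by apply: bop_ext => u; rewrite opM !rank1E adjP. Qed.

Lemma mul_rank1 g h x : x * rank1 g h = rank1 (x g) h.
Proof. by apply: bop_ext => u; rewrite opM !rank1E bZ. Qed.

Lemma posop_rank1 g : posop (rank1 g g).
Proof. by move=> u; rewrite rank1E inZl inC mulrC mulJc ler0c cm_ge0. Qed.

(** Positivity for the family enlarged by the pair of [y] and [conj c *: eta] is a nonnegative
    quadratic form in [c], to which [cs_num] applies. *)
Lemma cp_cs Psi n (x : 'I_n -> bop H) (z : 'I_n -> H) y eta : cp_map Psi ->
  cm (\sum_j '[Psi (adj y * x j) (z j), eta]) <=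
  complex.Re (cp_form Psi x z) * complex.Re '[Psi (adj y * y) eta, eta].
Proof.
move=> cP; set Z := \sum_j _.
apply: cs_num; first exact: posopRe (cp_pos_mul cP y) eta.
move=> c; pose d := c^*.
pose x' (i : 'I_n.+1) := if unlift ord0 i is Some j then x j else y.
pose z' (i : 'I_n.+1) := if unlift ord0 i is Some j then z j else d *: eta.
have x0 : x' ord0 = y by rewrite /x' unlift_none.
have z0 : z' ord0 = d *: eta by rewrite /z' unlift_none.
have xl i : x' (lift ord0 i) = x i by rewrite /x' liftK.
have zl i : z' (lift ord0 i) = z i by rewrite /z' liftK.
have := cP.2 _ x' z'; rewrite /cp_form big_ord_recl big_ord_recl x0 z0.
under eq_bigr => i _ do rewrite xl zl inZr.
under [X in _ <= _ + X]eq_bigr => i _ do rewrite big_ord_recl xl zl x0 z0 bZ inZl.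
rewrite big_split /= => h; move: h; rewrite lecE => /andP[_].
rewrite !ReD [complex.Re 0]/= bZ inZl inZr mulrA mulJc ReZ /d cmJ.
have -> : \sum_(i < n) (c^*)^* * '[Psi (adj y * x i) (z i), eta] = c * Z.
  by rewrite conjCK mulr_sumr.
have -> : \sum_(i < n) c^* * '[Psi (adj (x i) * y) eta, z i] = (c * Z)^*.
  rewrite rmorphM rmorph_sum /= mulr_sumr; apply: eq_bigr => i _; congr (_ * _).
  by rewrite -inC -adjP' -(cp_adj cP) adjM adjK.
have -> : \sum_(i < n) \sum_(i0 < n) '[Psi (adj (x i) * x' (lift ord0 i0)) (z' (lift ord0 i0)), z i] =
    cp_form Psi x z.
  by apply: eq_bigr => i _; apply: eq_bigr => j _; rewrite xl zl.
rewrite ReJ mulr2n; lra.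
Qed.

(* One elimination step of a Cholesky decomposition of Psi, with pivot
   <Psi(|g><g|) eta, eta>. *)
Lemma kraus_step Psi g eta : cp_map Psi -> exists k : bop H,
  [/\ cp_map (fun x => Psi x - adj k * x * k),
      '[(Psi (rank1 g g) - adj k * rank1 g g * k) eta, eta] = 0 &
      forall C, star C -> (forall x a, C a -> Psi (x * a) = Psi x * a) -> commutant C k].
Proof.
move=> cP; set c := complex.Re '[Psi (rank1 g g) eta, eta].
have pE := cp_pos cP (posop_rank1 g).
have c0 : 0 <= c by exact: posopRe.
have cE : '[Psi (rank1 g g) eta, eta] = c%:C by exact: Re_ge0 (pE eta).
have [cz|cn] := eqVneq c 0.
  exists 0; split.
  - have e : (fun x => Psi x - adj 0 * x * 0) = Psi.
      by apply/funext => x; rewrite mulr0 subr0.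
    by rewrite e.
  - by rewrite mulr0 subr0 cE cz.
  - by move=> C _ _; exact: commutant0.
have {}cn : 0 < c by rewrite lt_neqAle eq_sym cn.
pose s := (Num.sqrt c)^-1.
have s0 : 0 < s by rewrite invr_gt0 sqrtr_gt0.
have s2 : s ^+ 2 * c = 1 by rewrite exprVn sqr_sqrtr ?ltW // mulVf ?gt_eqF.
have sc : s * c = Num.sqrt c.
  by rewrite -{1}(sqr_sqrtr c0) expr2 mulKf // gt_eqF // sqrtr_gt0.
have rE h : adj (rank1 h g) = rank1 g h by exact: adj_rank1.
have rr h : adj (rank1 h g) * rank1 h g = (q h)%:C *: rank1 g g.
  by apply: bop_ext => u; rewrite rE opM opZ !rank1E inZl inq scalerA mulrC.
(* Cauchy-Schwarz against [rank1 h g], the pivot being normalized by [s]. This inequality is exactly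
   the positivity of the remainder after subtraction of the Kraus term. *)
have cs n (x : 'I_n -> bop H) z h : cm (s%:C * \sum_j '[Psi (rank1 g h * x j) (z j), eta]) <=
    complex.Re (cp_form Psi x z) * q h.
  rewrite cmM cm_real; have := cp_cs x z (rank1 h g) eta cP.
  rewrite rr (cpZ cP) opZ inZl ReZ -/c rE => hh.
  apply: le_trans (ler_wpM2l (sqr_ge0 s) hh) _.
  by rewrite mulrCA [s ^+ 2 * _]mulrCA s2 mulr1.
have form1 z : cp_form Psi (fun _ : 'I_1 => 1) (fun=> z) = '[Psi 1 z, z].
  by rewrite /cp_form !big_ord_recl !big_ord0 !addr0 adj1 mulr1.
have cs1 z h : cm (s%:C * '[Psi (rank1 g h) z, eta]) <= complex.Re '[Psi 1 z, z] * q h.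
  by have := cs 1%N (fun=> 1) (fun=> z) h; rewrite form1 big_ord_recl big_ord0 addr0 mulr1.
have r1lin a h h' : rank1 g (a *: h + h') = a^* *: rank1 g h + rank1 g h'.
  by apply: bop_ext => u; rewrite opD opZ !rank1E inDr inZr scalerDl scalerA.
(* The vector [k z] represents the row of the pivot, divided by the square root of the pivot as in a
   Cholesky factor. *)
have ex z : exists w : H, forall h, '[w, h] = s%:C * '[Psi (rank1 g h) z, eta].
  have [|h|w hw] := @riesz _ _ (fun h => (s%:C * '[Psi (rank1 g h) z, eta])^*) (complex.Re '[Psi 1 z, z]).
  - move=> a h h'; rewrite r1lin cP.1 opD opZ inDl inZl mulrDr rmorphD /= mulrCA.
    by rewrite [(a^* * _)^*]rmorphM /= conjCK.
  - by rewrite (cmJ (s%:C * '[Psi (rank1 g h) z, eta])); exact: cs1.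
  by exists w => h; rewrite inC -hw conjCK.
pose f z := sval (cid (ex z)).
have fP z h : '[f z, h] = s%:C * '[Psi (rank1 g h) z, eta] by rewrite /f; case: cid.
have [K K0 bK] := bop_bnd (Psi 1).
have [||k kf] := @mkbop _ _ f (K + 1).
- move=> a u v; apply: in_ext => h; rewrite inDl inZl !fP bD bZ inDl inZl; ring.
- move=> z; apply: q_le_test => [|h].
    by rewrite mulr_ge0 ?q_ge0 //; lra.
  rewrite fP; apply: le_trans (cs1 z h) _; apply: ler_wpM2r; first exact: q_ge0.
  have qz := q_ge0 z; have qx := q_ge0 (Psi 1 z); have := @rp_le _ _ (Psi 1 z) z 1 ltr01.
  have := bK z; rewrite /rp invr1; lra.
have kP z h : '[k z, h] = s%:C * '[Psi (rank1 g h) z, eta] by rewrite kf fP.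
exists k; split.
- split.
    move=> a x y; rewrite cP.1 mulrDr mulrDl mulZr mulZl scalerBr opprD addrACA //.
  move=> n x z.
  have -> : cp_form (fun x => Psi x - adj k * x * k) x z =
      cp_form Psi x z - '[\sum_j x j (k (z j)), \sum_i x i (k (z i))].
    rewrite /cp_form in_sumr -sumrB; apply: eq_bigr => i _.
    rewrite in_suml -sumrB; apply: eq_bigr => j _.
    by rewrite opB inBl !opM !adjP'.
  rewrite inq (Re_ge0 (cP.2 _ x z)) -rmorphB ler0c subr_ge0.
  apply: q_le_test => [|h].
    by have := cP.2 _ x z; rewrite lecE => /andP[].
  have -> : '[\sum_j x j (k (z j)), h] = s%:C * \sum_j '[Psi (rank1 g h * x j) (z j), eta].
    rewrite in_suml mulr_sumr; apply: eq_bigr => j _.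
    by rewrite adjP kP rank1_mul.
  exact: cs.
- rewrite opB inBl cE !opM adjP' rank1E inZl.
  have kg : '[k eta, g] = (Num.sqrt c)%:C by rewrite kP cE -rmorphM sc.
  by rewrite [X in _ * X]inC kg mulJc cm_real sqr_sqrtr // subrr.
- move=> C sC hC b Cb; apply: op_ext => z h; rewrite !opM adjP !kP.
  by rewrite -rank1_mul hC // opM.
Qed.

End kraus.

(** * Weak* convergence *)

Section weak_star.
Context {R : realType} {H : hilbertType R}.
Implicit Types (u v : H) (x y : bop H) (omega : bop H -> R[i]).
Local Notation "''[' u , v ]" := (inner u v).

Lemma weakstar_cvgP (T : Type) (F : set_system T) (f : T -> weakstar H) (l : weakstar H) :
  Filter F -> f @ F --> l <->
  forall omega, predual_functional omega ->
    (fun t => omega (f t) : R[i]^o) @ F --> (omega l : R[i]^o).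
Proof.
move=> FF; split=> [/cvg_sup h omega po U Ul|h].
  apply: (h (exist _ omega po) (omega @^-1` U)) => /=. rewrite (@nbhsE (initial_topology (omega : bop H -> R[i]^o))).
  move: Ul; rewrite nbhsE => -[V [oV Vl] VU].
  exists (omega @^-1` V); last by move=> y; exact: VU.
  by split=> //; exists V.
apply/cvg_sup => -[omega po] U; rewrite nbhsE => -[W [[V oV WE] Wl]] WU.
move: WE Wl WU => <- Wl WU; apply: (filterS WU); apply: (h omega po); exact: open_nbhs_nbhs.
Qed.

Definition ccv (z : nat -> R[i]) (l : R[i]) :=
  forall e : R, 0 < e -> exists N, forall n, (N <= n)%N -> cm (z n - l) < e.

Lemma ccv_cvg z l : ccv z l <-> (z : nat -> R[i]^o) @ \oo --> (l : R[i]^o).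
Proof.
have nc (w : R[i]) (r : R) : 0 < r -> (`|w| < r%:C) = (cm w < r ^+ 2).
  move=> r0; rewrite norm_cm ltcR -[X in _ < X](gtr0_norm r0) -sqrtr_sqr ltr_sqrt //.
  by rewrite exprn_gt0.
split=> [h|/cvgrPdist_lt h e e0].
  apply/cvgrPdist_lt => e /ltc0P[r r0 ->].
  have [N hN] := h _ (exprn_gt0 2 r0).
  by exists N => // n /= Nn; rewrite distrC nc //; exact: hN.
have s0 : 0 < Num.sqrt e by rewrite sqrtr_gt0.
have [|N _ hN] := h (Num.sqrt e)%:C; first by rewrite ltcR.
exists N => n Nn; have := hN n Nn; rewrite /= distrC nc // sqr_sqrtr //; exact: ltW.
Qed.

Lemma square_summable_ev0 (xi : nat -> H) : (forall n, (0 < n)%N -> xi n = 0) ->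
  square_summable xi.
Proof.
move=> h; apply: (@is_cvg_near_cst _ _ (`|xi 0%N| ^+ 2 : R[i]^o)).
exists 1%N => // n /= n1; rewrite /series /= (big_ltn n1) big_nat_cond big1 ?addr0 //.
by move=> i; rewrite andbT => /andP[i0 _]; rewrite (h i i0) normr0 expr0n.
Qed.

Lemma predual_inner u v : predual_functional (fun x : bop H => '[x u, v]).
Proof.
pose d (w : H) n := if n is 0%N then w else 0.
exists (d u), (d v); split; try by apply: square_summable_ev0 => -[].
move=> x; apply/ccv_cvg => e e0; exists 1%N => n n1; rewrite /series /= (big_ltn n1).
rewrite big_nat_cond big1 ?addr0 ?subrr ?cm0 // => -[|i]; rewrite andbT // => _.
by rewrite in0r.
Qed.

Lemma weakstar_ccv (X : nat -> bop H) l : ((X : nat -> weakstar H) @ \oo --> (l : weakstar H)) ->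
  forall u v, ccv (fun n => '[X n u, v]) '[l u, v].
Proof.
move=> /(weakstar_cvgP _ _ _) h u v; apply/ccv_cvg; exact: (h _ (predual_inner u v)).
Qed.

End weak_star.

Section weak_star_limits.
Context {R : realType} {H : hilbertType R}.
Implicit Types (u v : H) (x y : bop H) (omega : bop H -> R[i]).
Local Notation "''[' u , v ]" := (inner u v).

Lemma series_qE (xi : nat -> H) n :
  series (fun n => `|xi n| ^+ 2) n = (\sum_(0 <= k < n) q (xi k))%:C.
Proof.
rewrite /series /= rmorph_sum /=; apply: eq_bigr => k _.
by rewrite -inner_norm inq.
Qed.

Lemma square_summableP (xi : nat -> H) :
  square_summable xi <-> exists M : R, forall n, \sum_(0 <= k < n) q (xi k) <= M.
Proof.
have mono m n : (m <= n)%N -> \sum_(0 <= k < m) q (xi k) <= \sum_(0 <= k < n) q (xi k).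
  move=> mn; rewrite (big_cat_nat _ mn) //= lerDl.
  by apply: sumr_ge0 => k _; exact: q_ge0.
split=> [/cvg_ex[l /ccv_cvg h]|[M hM]].
  have [N hN] := h 1 ltr01; exists (complex.Re l + 1) => n.
  have := hN (maxn n N) (leq_maxr _ _); rewrite series_qE => h1.
  apply: le_trans (mono n (maxn n N) (leq_maxl _ _)) _.
  have := le_lt_trans (Re_le_cm _) h1; rewrite ReD ReN /=; set s := \sum_(_ <= _ < _) _.
  by move=> h2; nra.
have : cvgn (fun n => \sum_(0 <= k < n) q (xi k)).
  apply: nondecreasing_is_cvgn => [m n|]; first exact: mono.
  by exists M => _ [n _ <-]; exact: hM.
move=> /cvg_ex[l /cvgrPdist_lt hl]; apply/cvg_ex; exists l%:C.
apply/ccv_cvg => e e0; have s0 : 0 < Num.sqrt e by rewrite sqrtr_gt0.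
have [N _ hN] := hl _ s0; exists N => n Nn; rewrite series_qE -rmorphB cm_real.
have := hN n Nn; rewrite /= distrC => h.
rewrite -(sqr_sqrtr (ltW e0)) -real_normK ?num_real //.
by rewrite ltr_pXn2r // nnegrE ltW.
Qed.

Lemma square_summable_bop x xi : square_summable xi -> square_summable (fun n => x (xi n)).
Proof.
move=> /square_summableP[M hM]; apply/square_summableP.
have [K K0 hK] := bop_bnd x; exists (K * M) => n.
apply: le_trans (ler_wpM2l (ltW K0) (hM n)); rewrite mulr_sumr.
by apply: ler_sum => k _; exact: hK.
Qed.

Lemma predual_mul omega x y : predual_functional omega ->
  predual_functional (fun z => omega (adj x * z * y)).
Proof.
move=> [xi [eta [sx se h]]]; exists (fun n => y (xi n)), (fun n => x (eta n)); split.
- exact: square_summable_bop.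
- exact: square_summable_bop.
- move=> z; have e n : '[z (y (xi n)), x (eta n)] = '[(adj x * z * y) (xi n), eta n].
    by rewrite !opM adjP'.
  by rewrite (funext e); exact: h.
Qed.

Lemma ccv_uniq z (a b : R[i]) : ccv z a -> ccv z b -> a = b.
Proof.
move=> ha hb; apply/eqP; rewrite -subr_eq0; apply/eqP/cm_small => e e0.
have e4 : 0 < e / 4 by lra.
have [N hN] := ha _ e4; have [M hM] := hb _ e4.
have h1 := hN (maxn N M) (leq_maxl _ _); have h2 := hM (maxn N M) (leq_maxr _ _).
have -> : a - b = (z (maxn N M) - b) + - (z (maxn N M) - a) by ring.
have := @cmD_le _ (z (maxn N M) - b) (- (z (maxn N M) - a)) 1 ltr01.
rewrite cmN invr1; lra.
Qed.

Lemma ccvD z w (a b : R[i]) : ccv z a -> ccv w b -> ccv (fun n => z n + w n) (a + b).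
Proof. by move=> /ccv_cvg za /ccv_cvg wb; apply/ccv_cvg; exact: (cvgD za wb). Qed.

Lemma ccv_cst (a : R[i]) : ccv (fun=> a) a.
Proof. by move=> e e0; exists 0%N => n _; rewrite subrr cm0. Qed.

Lemma ccv_sum (I : Type) (s : seq I) (F : I -> nat -> R[i]) l : (forall i, ccv (F i) (l i)) ->
  ccv (fun n => \sum_(i <- s) F i n) (\sum_(i <- s) l i).
Proof.
move=> h; elim: s => [|i s IH].
  by rewrite big_nil (_ : (fun n => _) = fun=> 0); [exact: ccv_cst|apply/funext => n; rewrite big_nil].
rewrite big_cons (_ : (fun n => _) = fun n => F i n + \sum_(j <- s) F j n); first exact: ccvD.
by apply/funext => n; rewrite big_cons.
Qed.

Lemma predual_linear omega : predual_functional omega -> forall a x y,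
  omega (a *: x + y) = a * omega x + omega y.
Proof.
move=> [xi [eta [_ _ h]]] a x y.
apply: (@ccv_uniq (series (fun n => '[(a *: x + y) (xi n), eta n]))).
  by apply/ccv_cvg; exact: h.
apply/ccv_cvg.
have -> : series (fun n => '[(a *: x + y) (xi n), eta n]) =
    (fun n => a *: (series (fun n => '[x (xi n), eta n]) n : R[i]^o) +
      (series (fun n => '[y (xi n), eta n]) n : R[i]^o)).
  have e k : '[(a *: x + y) (xi k), eta k] = a * '[x (xi k), eta k] + '[y (xi k), eta k].
    by rewrite opD opZ inDl inZl.
  apply/funext => n; transitivity (\sum_(0 <= k < n) (a * '[x (xi k), eta k] + '[y (xi k), eta k])).
    by apply: eq_bigr => k _; exact: e.
  by rewrite big_split -mulr_sumr.
by apply: cvgD; [apply: cvgZl_tmp; exact: h|exact: h].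
Qed.

Lemma cm_sum_le (z : nat -> R[i]) (r : nat -> R) m n : (forall k, 0 <= r k) ->
  (forall k, cm (z k) <= r k ^+ 2) ->
  cm (\sum_(m <= k < n) z k) <= (\sum_(m <= k < n) r k) ^+ 2.
Proof.
move=> r0 h; have nz k : `|z k| <= (r k)%:C.
  rewrite norm_cm lecR -[leRHS](ger0_norm (r0 k)) -sqrtr_sqr; exact: ler_wsqrtr.
have : `|\sum_(m <= k < n) z k| <= (\sum_(m <= k < n) r k)%:C.
  by rewrite rmorph_sum; apply: le_trans (ler_norm_sum _ _ _) _; apply: ler_sum.
have s0 : 0 <= \sum_(m <= k < n) r k by apply: sumr_ge0.
rewrite norm_cm lecR -[leRHS](ger0_norm s0) -sqrtr_sqr ler_sqrt //; exact: sqr_ge0.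
Qed.

(** A predual functional is a series ['[x (xi k), eta k]]. Its tail is small uniformly over the
    bounded sequence, the terms being dominated by the summable [r k]; each of the finitely many
    remaining terms converges strongly. *)
Lemma weakstar_strong (X : nat -> bop H) (Y : bop H) (K : R) : (forall n, bnd K (X n)) ->
  (forall u, qcv (fun n => X n u) (Y u)) -> (X : nat -> weakstar H) @ \oo --> (Y : weakstar H).
Proof.
move=> hK hX; apply/weakstar_cvgP => omega po; apply/ccv_cvg => e e0.
have [L L0 hL] := bop_bnd Y.
have {}hK n : bnd (2 * K + 2 * L) (X n - Y).
  move=> u; rewrite opB; apply: le_trans (qD_le2 _ _) _; rewrite qN.
  have := hK n u; have := hL u; lra.
set C := 2 * K + 2 * L in hK.
have lin n : omega (X n) - omega Y = omega (X n - Y).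
  by rewrite [LHS]addrC -mulN1r -(predual_linear po) scaleN1r addrC.
have [xi [eta [/square_summableP[M1 s1] /square_summableP[M2 s2] h]]] := po.
pose r k := `|C| * q (xi k) + q (eta k).
have r0 k : 0 <= r k by rewrite addr_ge0 ?mulr_ge0 ?q_ge0.
pose d : R := Num.sqrt (e / 16).
have e8 : 0 < e / 16 by lra.
have d0 : 0 < d by rewrite sqrtr_gt0.
have d2 : d ^+ 2 = e / 16 by rewrite sqr_sqrtr ?ltW.
have [|n|N hN] := @monotone_cauchy _ (fun n => \sum_(0 <= k < n) r k) (`|C| * M1 + M2) _ _ _ d0.
- by move=> n; rewrite big_nat_recr //= lerDl.
- by rewrite big_split -mulr_sumr /=; apply: lerD => //; apply: ler_wpM2l.
have tail n m : (N <= m)%N -> cm (\sum_(N <= k < m) '[(X n - Y) (xi k), eta k]) <= d ^+ 2.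
  move=> Nm; apply: le_trans (cm_sum_le N m r0 _) _.
    move=> k; apply: le_trans (cauchy_schwarz _ _) _.
    have h1 := hK n (xi k); have h2 := q_ge0 (eta k); have h3 := q_ge0 (xi k).
    apply: (@le_trans _ _ (`|C| * q (xi k) * q (eta k))).
      apply: ler_wpM2r => //; apply: le_trans h1 _; apply: ler_wpM2r => //; exact: ler_norm.
    rewrite /r; have : 0 <= `|C| * q (xi k) by rewrite mulr_ge0.
    move: (`|C| * q (xi k)) => t t0; nra.
  have := hN m N; rewrite leqnn Nm => /(_ isT) /andP[].
  rewrite (big_cat_nat _ Nm) //= [X in X - _]addrC addrK => h1 h2.
  by rewrite ler_pXn2r ?nnegrE //; exact: ltW.
have head : exists M, forall n, (M <= n)%N ->
    cm (\sum_(0 <= k < N) '[(X n - Y) (xi k), eta k]) <= e / 16.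
  have : ccv (fun n => \sum_(0 <= k < N) '[(X n - Y) (xi k), eta k]) 0.
    have := @ccv_sum _ (index_iota 0 N) (fun k n => '[(X n - Y) (xi k), eta k]) (fun=> 0).
    rewrite big1 //; apply => k f f0.
    have [M hM] := qcv_in (eta k) (hX (xi k)) f0.
    by exists M => n Mn; rewrite subr0 opB inBl; exact: hM.
  by move=> /(_ _ e8)[M hM]; exists M => n Mn; have := hM n Mn; rewrite subr0 => /ltW.
have [M hM] := head; exists M => n Mn; rewrite lin.
have /ccv_cvg /(_ _ e8)[P hP] := h (X n - Y).
have := hP (maxn N P) (leq_maxr _ _); have Nm := leq_maxl N P.
rewrite /series /= (big_cat_nat _ Nm) //=.
have := tail n _ Nm; have := hM n Mn.
move: (\sum_(0 <= k < N) _) (\sum_(N <= k < _) _) (omega _) => a b c ha hb hc.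
have -> : c = (a + b) + - (a + b - c) by ring.
have h1 := @cmD_le _ (a + b) (- (a + b - c)) 1 ltr01.
have h2 := @cmD_le _ a b 1 ltr01.
rewrite d2 in hb; move: h1 h2; rewrite cmN invr1; lra.
Qed.

Lemma normal_ccv (Phi : bop H -> bop H) (X : nat -> bop H) (Y : bop H) (K : R) :
  normal_map Phi -> (forall n, bnd K (X n)) ->
  (forall u, qcv (fun n => X n u) (Y u)) -> forall u v, ccv (fun n => '[Phi (X n) u, v]) '[Phi Y u, v].
Proof.
move=> nP hK hX; apply: (@weakstar_ccv _ _ (fun n => Phi (X n))).
exact: (continuous_cvg _ (nP _) (weakstar_strong hK hX)).
Qed.

End weak_star_limits.

Section gram_schmidt.
Context {R : realType} {H : hilbertType R}.
Implicit Types (u v x y : H) (p : bop H).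
Local Notation "''[' u , v ]" := (inner u v).

Lemma dense_seq : separable_space H -> exists d : nat -> H,
  forall u (e : R), 0 < e -> exists k, q (u - d k) < e.
Proof.
move=> [D /pcard_leP[f] dD].
pose d n := if pselect (exists x, D x /\ f x = n) is left h then sval (cid h) else 0.
exists d => u e e0; have r0 : 0 < (Num.sqrt e)%:C :> R[i] by rewrite ltcR sqrtr_gt0.
have [||x [/= hx Dx]] := dD (ball u (Num.sqrt e)%:C).
- by exists u; exact: ballxx.
- exact: ball_open.
exists (f x); rewrite /d; case: pselect => [h|[]]; last by exists x.
case: cid => y /= [Dy fy]; have -> : y = x by apply: (@inj _ _ _ f) => //; rewrite inE.
move: hx; rewrite -ball_normE /= norm_ltq ?sqrtr_gt0 // sqr_sqrtr //; exact: ltW.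
Qed.

(** A vector depending on its predecessors yields [e n = 0], since [nrm 0 = 0]. The zero vectors are
    kept, which is why the result speaks of partial sums of projections rather than of an
    orthonormal basis. *)
Lemma gram_schmidt : separable_space H -> exists e : nat -> H,
  (forall n, proj (\sum_(0 <= k < n) rank1 (e k) (e k))) /\
  forall u, qcv (fun n => (\sum_(0 <= k < n) rank1 (e k) (e k)) u) u.
Proof.
move=> /dense_seq[d dd].
pose nrm u := (Num.sqrt (q u))^-1%:C *: u.
pose P := fix P n := if n is m.+1 then
  P m + rank1 (nrm ((1 - P m) (d m))) (nrm ((1 - P m) (d m))) else 0 : bop H.
pose e n := nrm ((1 - P n) (d n)).
have PE n : \sum_(0 <= k < n) rank1 (e k) (e k) = P n.
  by elim: n => [|n IH]; [rewrite big_geq|rewrite big_nat_recr //= IH].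
have PS n : P n.+1 = P n + rank1 (e n) (e n) by [].
have P0 : P 0%N = 0 by [].
have eE n : e n = nrm ((1 - P n) (d n)) by [].
clearbody e P.
have ne u : u != 0 -> q (nrm u) = 1 /\ '[u, nrm u] *: nrm u = u.
  move=> u0; have qu := q_gt0 u0; have su : (Num.sqrt (q u))^-1 ^+ 2 * q u = 1.
    by rewrite exprVn sqr_sqrtr ?mulVf ?gt_eqF // ltW.
  by rewrite /nrm qZr su inZr conj_real inq scalerA -!rmorphM /= mulrAC -expr2 su scale1r.
have ne0 : nrm 0 = 0 by rewrite /nrm scaler0.
have Pp n : proj (P n).
  elim: n => [|n [pp pa]]; first by rewrite P0; split; rewrite ?mulr0 ?adj0.
  have Pe : P n (e n) = 0 by rewrite eE bZ -opM mulrBr mulr1 pp subrr op0 scaler0.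
  rewrite PS; split; last by rewrite adjD pa adj_rank1.
  rewrite mulrDl !mulrDr pp mul_rank1 Pe rank1_mul pa Pe mul_rank1 rank1E.
  have r0 v : rank1 v 0 = 0 by apply: bop_ext => u; rewrite rank1E in0r scale0r op0.
  have l0 v : rank1 0 v = 0 by apply: bop_ext => u; rewrite rank1E scaler0 op0.
  rewrite r0 l0 addr0 add0r inq; congr (_ + _).
  have [w0|w0] := eqVneq ((1 - P n) (d n)) 0; first by rewrite eE w0 ne0 scaler0 l0.
  by rewrite {1}eE (ne _ w0).1 scale1r.
have Pd k n : (k < n)%N -> P n (d k) = d k.
  elim: n => // n IH; rewrite ltnS leq_eqVlt PS opD rank1E => /orP[/eqP kn|kn].
    have [pp pa] := Pp n; have Pe : P n (e n) = 0.
      by rewrite eE bZ -opM mulrBr mulr1 pp subrr op0 scaler0.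
    have dE : d k = (1 - P n) (d k) + P n (d k) by rewrite opB op1 subrK.
    have -> : '[d k, e n] = '[(1 - P n) (d k), e n].
      have z : '[P n (d k), e n] = 0 by rewrite -pa adjP' Pe in0r.
      by rewrite {1}dE inDl z addr0.
    rewrite eE -kn; have [w0|w0] := eqVneq ((1 - P k) (d k)) 0.
      by rewrite w0 ne0 scaler0 addr0; move/eqP: w0; rewrite opB op1 subr_eq0 => /eqP.
    by rewrite (ne _ w0).2 opB op1 addrC subrK.
  have [pp pa] := Pp n; have Pe : P n (e n) = 0.
    by rewrite eE bZ -opM mulrBr mulr1 pp subrr op0 scaler0.
  have z : '[P n (d k), e n] = 0 by rewrite -pa adjP' Pe in0r.
  by rewrite IH // -{2}(IH kn) z scale0r addr0.
exists e; split=> [n|u r r0]; first by rewrite PE.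
have [k hk] := dd u r r0; exists k.+1 => n kn; rewrite PE qBC.
have -> : u - P n u = (1 - P n) (u - d k) by rewrite opB op1 bB Pd // opprB addrA subrK.
by apply: le_lt_trans hk; have := proj_bnd (projC (Pp n)) (u - d k); rewrite mul1r.
Qed.

End gram_schmidt.

Section kraus_decomposition.
Context {R : realType} {H : hilbertType R}.
Implicit Types (u v w z : H) (x y k : bop H) (C : set (bop H)) (Phi : bop H -> bop H).
Local Notation "''[' u , v ]" := (inner u v).
Local Notation ex x u := (complex.Re '[x u, u]).

Lemma posop_le x : posop x -> exists2 c : R, 0 < c & posop (c%:C *: (1 : bop H) - x).
Proof.
move=> px; have [K K0 bK] := bop_bnd x; exists (K + 1); first lra.
move=> u; rewrite opB opZ op1 inBl inZl inq (Re_ge0 (px u)) -rmorphM -rmorphB /= ler0c subr_ge0.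
have := @rp_le _ _ (x u) u 1 ltr01; rewrite invr1 /rp.
have := bK u; have := q_ge0 u; have := q_ge0 (x u); lra.
Qed.

Lemma posop_qD x u v : posop x -> ex x (u + v) <= 2 * ex x u + 2 * ex x v.
Proof.
move=> px; have := posopRe px (u - v); rewrite bB bD !inDl !inDr !inNl !inNr !ReD !ReN.
set a := complex.Re _; lra.
Qed.

(** Elimination with pivots given by all pairs [(e i, d j)]. A treated pivot stays 0, as the
    remainders decrease. Hence the remainder at [P N] eventually vanishes on [d j], while at
    [1 - P N] it is at most [Phi (1 - P N)], small by normality. Density of the [d j] and [x <= c]
    extend this to all [z] and positive [x]. *)
Lemma kraus_decomposition C Phi : separable_space H -> star C -> C 1 -> CP C Phi ->
  exists k : nat -> bop H, (forall n, commutant C (k n)) /\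
  forall x z, posop x -> (forall n, \sum_(0 <= i < n) ex x (k i z) <= ex (Phi x) z) /\
    forall e : R, 0 < e -> exists N, forall n, (N <= n)%N ->
      ex (Phi x) z <= \sum_(0 <= i < n) ex x (k i z) + e.
Proof.
move=> sH sC C1 [nP bP]; have cP := normal_cp_map nP.
have [e [eP ecv]] := gram_schmidt sH; have [d dd] := dense_seq sH.
have step Psi : exists k : H -> H -> bop H, cp_map Psi -> forall g eta,
  [/\ cp_map (fun x => Psi x - adj (k g eta) * x * k g eta),
      '[(Psi (rank1 g g) - adj (k g eta) * rank1 g g * k g eta) eta, eta] = 0 &
      (forall x a, C a -> Psi (x * a) = Psi x * a) -> commutant C (k g eta)].
  have [cp|ncp] := pselect (cp_map Psi); last by exists (fun _ _ => 0) => /ncp.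
  exists (fun g eta => sval (cid (kraus_step g eta cp))) => _ g eta.
  by case: cid => k [h1 h2 h3]; split=> // hC; exact: h3.
pose kk Psi := sval (cid (step Psi)).
have kkP Psi : cp_map Psi -> forall g eta,
  [/\ cp_map (fun x => Psi x - adj (kk Psi g eta) * x * kk Psi g eta),
      '[(Psi (rank1 g g) - adj (kk Psi g eta) * rank1 g g * kk Psi g eta) eta, eta] = 0 &
      (forall x a, C a -> Psi (x * a) = Psi x * a) -> commutant C (kk Psi g eta)].
  by rewrite /kk; case: cid.
clearbody kk.
(* Every pair occurs, at its own [pickle] code; numbers coding no pair repeat [(0, 0)]. *)
pose pr n := odflt (0%N, 0%N) (unpickle n : option (nat * nat)).
pose Psi := fix Psi n := if n is m.+1 then
  fun x => Psi m x - adj (kk (Psi m) (e (pr m).1) (d (pr m).2)) * x * kk (Psi m) (e (pr m).1) (d (pr m).2)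
  else Phi.
pose k n := kk (Psi n) (e (pr n).1) (d (pr n).2).
have PS n : Psi n.+1 = fun x => Psi n x - adj (k n) * x * k n by [].
have inv n : cp_map (Psi n) /\ forall x a, C a -> Psi n (x * a) = Psi n x * a.
  elim: n => [|n [IH1 IH2]].
    by split=> // x a Ca; have := bP 1 a x C1 Ca; rewrite !mul1r.
  have [h1 _ h3] := kkP _ IH1 (e (pr n).1) (d (pr n).2).
  split=> [|x a Ca]; first by rewrite PS.
  rewrite PS IH2 // mulrBl; congr (_ - _).
  by rewrite -!mulrA; congr (_ * (_ * _)); exact: (h3 IH2 a Ca).
have cPn n := (inv n).1.
have kC n : commutant C (k n) by have [_ _] := kkP _ (cPn n) (e (pr n).1) (d (pr n).2); apply; exact: (inv n).2.
have PE n x z : ex (Psi n x) z = ex (Phi x) z - \sum_(0 <= i < n) ex x (k i z).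
  elim: n => [|n IH]; first by rewrite big_geq // subr0.
  rewrite PS opB inBl ReD ReN IH big_nat_recr //= opprD addrA; congr (_ - _).
  by rewrite adjP'.
have P0 n x z : posop x -> 0 <= ex (Psi n x) z.
  by move=> px; apply: posopRe; exact: cp_pos.
have dec m n x z : (m <= n)%N -> posop x -> ex (Psi n x) z <= ex (Psi m x) z.
  move=> mn px; rewrite !PE lerD2l lerN2 (big_cat_nat _ mn) //= lerDl.
  by apply: sumr_ge0 => i _; exact: posopRe.
have Ee i j n : (pickle (i, j) < n)%N -> ex (Psi n (rank1 (e i) (e i))) (d j) = 0.
  move=> h; apply/eqP; rewrite eq_le P0 ?andbT; last exact: posop_rank1.
  apply: le_trans (dec _ _ _ _ h (posop_rank1 _)) _; rewrite PS.
  have [_ + _] := kkP _ (cPn (pickle (i, j))) (e (pr (pickle (i, j))).1) (d (pr (pickle (i, j))).2).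
  by rewrite -/(k _) /pr pickleK /= => ->.
pose P n := \sum_(0 <= k < n) rank1 (e k) (e k).
have EP N j : exists M, forall n, (M <= n)%N -> ex (Psi n (P N)) (d j) = 0.
  exists (\max_(i < N) (pickle (i : nat, j)).+1)%N => n Mn.
  rewrite (cp_sum (cPn n)) op_sum in_suml Re_sum big_mkord big1 // => i _.
  by apply: Ee; apply: leq_trans Mn; exact: (@leq_bigmax _ (fun i : 'I_N => (pickle (i : nat, j)).+1) i).
have Pp N : posop (1 - P N) by exact: posop_proj (projC (eP N)).
have small j (r : R) : 0 < r -> exists M, forall n, (M <= n)%N -> ex (Psi n 1) (d j) <= r.
  move=> r0; have [_ nm _] := nP.
  have ecv1 u : qcv (fun n => (\sum_(0 <= k < n) rank1 (e k) (e k)) u) ((1 : bop H) u) by exact: ecv.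
  have [N hN] := normal_ccv nm (fun n => proj_bnd (eP n)) ecv1 (d j) (d j) (exprn_gt0 2 r0).
  have [M hM] := EP N j; exists M => n Mn.
  have -> : 1 = (1 - P N) + P N by rewrite subrK.
  rewrite (cpD (cPn n)) opD inDl ReD hM // addr0.
  apply: le_trans (dec 0%N n _ _ (leq0n _) (Pp N)) _.
  rewrite [Psi 0%N _]/= (cpB cP) opB inBl ReD ReN.
  have := le_lt_trans (Re_le_cm _) (hN N (leqnn N)); rewrite ReD ReN => h.
  by apply: ltW; nra.
exists k; split=> // x z px; split=> [n|r r0].
  by rewrite -subr_ge0 -PE; exact: P0.
have [c c0 cx] := posop_le px; have [L L0 Lx] := posop_le (cp_pos cP posop1).
have Lw w : ex (Phi 1) w <= L * q w.
  by have := posopRe Lx w; rewrite opB opZ op1 inBl inZl ReD ReZ ReN -/(q w); lra.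
(* The remainder at 1 is at most [t] both on [z - d j] and on [d j], and [c (2 t + 2 t) = r]. *)
pose s := r / (c * 4) / L; have s0 : 0 < s by rewrite !divr_gt0 // mulr_gt0 // ltr0n.
have [j hj] := dd z s s0.
pose t := r / (c * 4); have t0 : 0 < t by rewrite !divr_gt0 // mulr_gt0 // ltr0n.
have [M hM] := small j t t0; exists M => n Mn.
rewrite addrC -lerBlDr -PE.
have h1 : ex (Psi n x) z <= c * ex (Psi n 1) z.
  have := P0 n _ z cx; rewrite (cpB (cPn n)) (cpZ (cPn n)) opB opZ inBl inZl ReD ReZ ReN; lra.
have h2 : ex (Psi n 1) z <= 2 * ex (Psi n 1) (z - d j) + 2 * ex (Psi n 1) (d j).
  by rewrite -{1 2}[z](subrK (d j)); apply: posop_qD; exact: (cp_pos (cPn n) posop1).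
have h3 : ex (Psi n 1) (z - d j) <= t.
  apply: le_trans (dec 0%N n _ _ (leq0n _) posop1) _; apply: le_trans (Lw _) _.
  by apply: le_trans (ler_wpM2l (ltW L0) (ltW hj)) _; rewrite /s mulrC divfK ?gt_eqF.
have h4 := hM n Mn; apply: le_trans h1 _.
have -> : r = c * (4 * t) by rewrite /t; field; rewrite gt_eqF.
apply: ler_wpM2l; lra.
Qed.

End kraus_decomposition.

(** * LOCC protocols *)

Section locc_bound.
Context {R : realType} {H : hilbertType R}.
Implicit Types (u chi phi : H) (x X : bop H) (A B : set (bop H)).
Implicit Types (I J : nat -> bop H -> bop H) (T Phi Psi : bop H -> bop H).
Local Notation "''[' u , v ]" := (inner u v).
Local Notation ex x u := (complex.Re '[x u, u]).

Lemma eventually_sum (K : Type) (s : seq K) (l : K -> R) (F : K -> nat -> R) :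
  (forall i (e : R), 0 < e -> exists N, forall n, (N <= n)%N -> l i <= F i n + e) ->
  forall e : R, 0 < e -> exists N, forall n, (N <= n)%N ->
    \sum_(i <- s) l i <= \sum_(i <- s) F i n + e.
Proof.
move=> h; elim: s => [|i s IH] e e0.
  by exists 0%N => n _; rewrite !big_nil add0r ltW.
have e2 : 0 < e / 2 by lra.
have [N hN] := h i _ e2; have [M hM] := IH _ e2.
exists (maxn N M) => n; rewrite geq_max => /andP[/hN h1 /hM h2].
rewrite !big_cons; lra.
Qed.

Lemma le_eventually (l M : R) (F : nat -> R) :
  (forall e : R, 0 < e -> exists N, forall n, (N <= n)%N -> l <= F n + e) ->
  (forall n, F n <= M) -> l <= M.
Proof.
move=> h hM; apply: lim_eps => e /h[N /(_ N (leqnn N)) hN].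
by apply: le_trans hN _; rewrite lerD2r.
Qed.

Lemma point_sum_ex (S : set nat) I T X chi : (forall k, cp_map (I k)) -> posop X -> point_sum S I T ->
  (forall n, \sum_(0 <= k < n | k \in S) ex (I k X) chi <= ex (T X) chi) /\
  forall e : R, 0 < e -> exists N, forall n, (N <= n)%N ->
    ex (T X) chi <= \sum_(0 <= k < n | k \in S) ex (I k X) chi + e.
Proof.
move=> cI pX pS; have c := weakstar_ccv (pS X) chi chi.
have {}c e : 0 < e -> exists N, forall n, (N <= n)%N ->
    `|\sum_(0 <= k < n | k \in S) ex (I k X) chi - ex (T X) chi| <= e.
  move=> e0; have [N hN] := c _ (exprn_gt0 2 e0); exists N => n /hN.
  rewrite op_sum in_suml => h; have := le_lt_trans (Re_le_cm _) h.
  rewrite ReD ReN Re_sum => h1; rewrite -(@ler_pXn2r _ 2) ?nnegrE //; last exact: ltW.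
  by rewrite real_normK ?num_real // ltW.
have t0 k : 0 <= ex (I k X) chi by apply: posopRe; exact: cp_pos.
split=> [n|e e0].
  apply: lim_eps => e e0; have [N hN] := c e e0.
  have := hN (maxn n N) (leq_maxr _ _); rewrite ler_norml => /andP[_ h].
  apply: le_trans (_ : _ <= \sum_(0 <= k < maxn n N | k \in S) ex (I k X) chi) _; last first.
    by rewrite -lerBlDl.
  by rewrite (big_cat_nat _ (leq_maxl n N)) //= lerDl; exact: sumr_ge0.
have [N hN] := c e e0; exists N => n /hN; rewrite ler_norml => /andP[h _].
by move: h; set s := \sum_(_ <= _ < _ | _) _; lra.
Qed.

Lemma instrument_cp I : instrument I -> forall k, cp_map (I k).
Proof. by move=> [T [h _ _]] k; exact: normal_cp_map. Qed.

Lemma instrument_le1 I : instrument I -> forall n u, \sum_(0 <= k < n) ex (I k 1) u <= q u.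
Proof.
move=> iI; have cI := instrument_cp iI; have [T [_ pS [_ T1]]] := iI => n u.
have [h _] := point_sum_ex u cI posop1 pS.
apply: le_trans (_ : _ <= ex (T 1) u) _; last by rewrite T1.
by apply: le_trans (h n); rewrite big_mkcond /= [X in _ <= X]big_mkcond; apply: ler_sum => k _; rewrite in_setT.
Qed.

Lemma bimodule_one C Psi : C 1 -> bimodule_map C Psi -> commutant C (Psi 1).
Proof.
move=> C1 bP a Ca; have := bP a 1 1 Ca C1; have := bP 1 a 1 C1 Ca.
by rewrite !mul1r !mulr1 => -> ->.
Qed.

Section bound.
Variables (A : set (bop H)) (phi : H).
Let B := commutant A.
Let V := value A B phi.
Hypotheses (sepH : separable_space H) (AB : cpair A B).
Hypothesis swap : forall t chi, column B t -> \sum_(b <- t) V (b chi) <= V chi.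

(** In the Heisenberg picture [X] stands for the rest of a protocol applied to the target projection
    [rank1 phi phi]. *)
Definition dominated X := posop X /\ forall chi, ex X chi <= V chi.

Lemma dominated0 : dominated 0.
Proof. by split=> [|chi]; [exact: posop0|rewrite op0 in0l; exact: value_ge0]. Qed.

Lemma dominated_rank1 : dominated (rank1 phi phi).
Proof.
split=> [|chi]; first exact: posop_rank1.
have := @value_ub _ _ A B phi [:: (1, 1)] chi; rewrite /score big_seq1 /=.
rewrite rank1E inZl [X in _ * X]inC mulJc /=; apply.
split=> [_ /[!inE] /eqP -> /=|u]; last by rewrite big_seq1.
by split; [exact: (cpair1 AB)|exact: (cpair1 (cpair_sym AB))|exact: bnd1].
Qed.

Lemma column_pairs C (a : nat -> nat -> bop H) n m : (forall k j, C (a k j)) ->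
  (forall u, \sum_(0 <= k < n) \sum_(0 <= j < m) q (a k j u) <= q u) ->
  column C [seq a k j | k <- index_iota 0 n, j <- index_iota 0 m].
Proof.
move=> Ca h; split; first by move=> _ /allpairsP[p [_ _ ->]].
by move=> u; rewrite big_allpairs_dep; exact: h.
Qed.

Lemma column_seq C (a : nat -> bop H) m : (forall j, C (a j)) ->
  (forall u, \sum_(0 <= j < m) q (a j u) <= q u) -> column C [seq a j | j <- index_iota 0 m].
Proof.
move=> Ca h; split; first by move=> _ /mapP[p _ ->].
by move=> u; rewrite big_map; exact: h.
Qed.

(** The operator may differ from outcome to outcome: this is how the adaptivity of the later rounds
    enters the induction. *)
Definition sum_dominated I := forall X : nat -> bop H, (forall k, dominated (X k)) ->
  forall n chi, \sum_(0 <= k < n) ex (I k (X k)) chi <= V chi.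

Lemma sum_dominatedP I (X : nat -> bop H) n : instrument I -> sum_dominated I -> (forall k, dominated (X k)) ->
  dominated (\sum_(0 <= k < n) I k (X k)).
Proof.
move=> iI sI hX; have cI := instrument_cp iI; split=> [u|chi].
  rewrite op_sum in_suml; apply: sumr_ge0 => k _; apply: cp_pos => //; exact: (hX k).1.
by rewrite op_sum in_suml Re_sum; exact: sI.
Qed.

(* [a k j b k i], with [a k j] in [A] and [b k i] in the commutant, are Kraus
   operators for the [k]-th map of a one-way instrument. *)
Lemma kraus_dominated I (Phi Psi : nat -> bop H -> bop H) : instrument I ->
  (forall k, CP A (Phi k)) -> (forall k, CP B (Psi k)) -> (forall k, I k = Phi k \o Psi k) ->
  (forall (a b : nat -> nat -> bop H) n m l chi, (forall k j, A (a k j)) -> (forall k i, B (b k i)) ->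
     (forall k u, \sum_(0 <= j < l) q (a k j u) <= ex (Psi k 1) u) ->
     (forall k u, \sum_(0 <= i < m) q (b k i u) <= ex (Phi k 1) u) ->
     \sum_(0 <= k < n) \sum_(0 <= i < m) \sum_(0 <= j < l) V (a k j (b k i chi)) <= V chi) ->
  sum_dominated I.
Proof.
move=> iI hPhi hPsi IE hV X hX n chi.
have [sA sB eB eA] := AB.
have kP k := kraus_decomposition sepH sA (cpair1 AB) (hPhi k).
have kS k := kraus_decomposition sepH sB (cpair1 (cpair_sym AB)) (hPsi k).
pose b k := sval (cid (kP k)); pose a k := sval (cid (kS k)).
have bP k : (forall n, B (b k n)) /\ forall x z, posop x ->
    (forall n, \sum_(0 <= i < n) ex x (b k i z) <= ex (Phi k x) z) /\
    forall e : R, 0 < e -> exists N, forall n, (N <= n)%N ->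
      ex (Phi k x) z <= \sum_(0 <= i < n) ex x (b k i z) + e.
  by rewrite /b; case: cid.
have aP k : (forall n, A (a k n)) /\ forall x z, posop x ->
    (forall n, \sum_(0 <= i < n) ex x (a k i z) <= ex (Psi k x) z) /\
    forall e : R, 0 < e -> exists N, forall n, (N <= n)%N ->
      ex (Psi k x) z <= \sum_(0 <= i < n) ex x (a k i z) + e.
  by rewrite -eA /a; case: cid.
clearbody a b.
have pPsi k : posop (Psi k (X k)) by apply: cp_pos (hX k).1; apply: normal_cp_map; exact: (hPsi k).1.
apply: (le_eventually (F := fun m => \sum_(0 <= k < n) \sum_(0 <= i < m) ex (Psi k (X k)) (b k i chi))).
  apply: eventually_sum => k e e0; rewrite IE.
  exact: (((bP k).2 _ chi (pPsi k)).2 _ e0).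
move=> m.
apply: (le_eventually (F := fun l =>
  \sum_(0 <= k < n) \sum_(0 <= i < m) \sum_(0 <= j < l) ex (X k) (a k j (b k i chi)))).
  apply: eventually_sum => k; apply: eventually_sum => i e e0.
  exact: (((aP k).2 _ (b k i chi) (hX k).1).2 _ e0).
move=> l; apply: le_trans (hV a b n m l chi _ _ _ _).
- apply: ler_sum => k _; apply: ler_sum => i _; apply: ler_sum => j _; exact: (hX k).2.
- by move=> k j; exact: (aP k).1.
- by move=> k j; exact: (bP k).1.
- by move=> k u; exact: (((aP k).2 1 u posop1).1).
- by move=> k u; exact: (((bP k).2 1 u posop1).1).
Qed.

(** [Psi k 1] lies in [A], so the unital [A]-bimodule map [Phi k] fixes it and [I k 1 = Psi k 1].
    Thus the [a k j] together form one measurement of [A], followed in each branch by a measurement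
    of [B], which is handled by [swap]. *)
Lemma right_dominated I : right_instrument A I -> sum_dominated I.
Proof.
move=> [iI rI]; pose f k := cid (rI k); pose g k := cid (svalP (f k)).
have [Phi [Psi h]] : exists Phi Psi : nat -> bop H -> bop H, forall k,
    [/\ UCP A (Phi k), CP B (Psi k) & I k = Phi k \o Psi k].
  by exists (fun k => sval (f k)), (fun k => sval (g k)) => k; exact: (svalP (g k)).
clear f g.
have [sA sB eB eA] := AB; have A1 := cpair1 AB; have B1 := cpair1 (cpair_sym AB).
apply: (kraus_dominated (Phi := Phi) (Psi := Psi) iI).
- by move=> k; have [[[] ]] := h k.
- by move=> k; have [] := h k.
- by move=> k; have [] := h k.
move=> a b n m l chi Aa Bb ha hb.
have I1 k : I k 1 = Psi k 1.
  have [[[_ P1] bP] [_ bS] ->] := h k.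
  have : A (Psi k 1) by rewrite -eA; exact: bimodule_one.
  by move=> AP /=; have := bP _ 1 1 AP A1; rewrite P1 !mulr1.
have ca : column A [seq a k j | k <- index_iota 0 n, j <- index_iota 0 l].
  apply: column_pairs => // u; apply: le_trans (instrument_le1 iI n u).
  by apply: ler_sum => k _; rewrite I1; exact: ha.
apply: le_trans (value_column AB phi chi ca); rewrite big_allpairs_dep.
apply: ler_sum => k _; rewrite exchange_big /=; apply: ler_sum => j _.
have cb : column B [seq b k i | i <- index_iota 0 m].
  apply: column_seq => // u; apply: le_trans (hb k u) _.
  by have [[[_ ->] _] _ _] := h k.
have := swap (a k j chi) cb; rewrite big_map; apply: le_trans.
by apply: ler_sum => i _; rewrite (cpairCv AB _ (Aa k j) (Bb k i)).
Qed.

(** Now [I k 1 = Phi k 1], so it is the [b k i] that together form a measurement: [swap] is applied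
    first, then [value_column] in each branch. *)
Lemma left_dominated I : left_instrument A I -> sum_dominated I.
Proof.
move=> [iI rI]; pose f k := cid (rI k); pose g k := cid (svalP (f k)).
have [Phi [Psi h]] : exists Phi Psi : nat -> bop H -> bop H, forall k,
    [/\ CP A (Phi k), UCP B (Psi k) & I k = Phi k \o Psi k].
  by exists (fun k => sval (f k)), (fun k => sval (g k)) => k; exact: (svalP (g k)).
clear f g.
apply: (kraus_dominated (Phi := Phi) (Psi := Psi) iI).
- by move=> k; have [] := h k.
- by move=> k; have [_ [[]]] := h k.
- by move=> k; have [] := h k.
move=> a b n m l chi Aa Bb ha hb.
have I1 k : I k 1 = Phi k 1 by have [_ [[_ P1] _] ->] := h k; rewrite /= P1.
have cb : column B [seq b k i | k <- index_iota 0 n, i <- index_iota 0 m].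
  apply: column_pairs => // u; apply: le_trans (instrument_le1 iI n u).
  by apply: ler_sum => k _; rewrite I1; exact: hb.
apply: le_trans (swap chi cb); rewrite big_allpairs_dep.
apply: ler_sum => k _; apply: ler_sum => i _.
have ca : column A [seq a k j | j <- index_iota 0 l].
  apply: column_seq => // u; apply: le_trans (ha k u) _.
  by have [_ [[_ ->] _] _] := h k.
by have := value_column AB phi (b k i chi) ca; rewrite big_map.
Qed.

Lemma one_way_dominated I : one_way_instrument A I -> instrument I /\ sum_dominated I.
Proof.
by case=> h; (split; first by case: h); [exact: right_dominated|exact: left_dominated].
Qed.

Lemma sum_subseq_le (K : eqType) (s t : seq K) (F : K -> R) : uniq s -> uniq t ->
  {subset s <= t} -> (forall i, 0 <= F i) -> \sum_(i <- s) F i <= \sum_(i <- t) F i.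
Proof.
move=> us ut st F0; rewrite (perm_big [seq i <- t | i \in s]) /=; last first.
  apply: uniq_perm => //; first exact: filter_uniq.
  by move=> i; rewrite mem_filter; case: (boolP (i \in s)) => // /st ->.
by rewrite big_filter big_mkcond; apply: ler_sum => x _; case: ifP.
Qed.

Lemma linked_dominated I J : instrument I -> sum_dominated I -> linked A I J -> sum_dominated J.
Proof.
move=> iI sI [K [oK [e [g eK gK] [iIK iJ [S [tS _ pS]]]]]] X hX N chi.
set IK := (fun m => _) in iIK pS.
have cI := instrument_cp iI; have cK k := instrument_cp (one_way_dominated (oK k)).1.
have cIK := instrument_cp iIK.
apply: (le_eventually (F := fun M => \sum_(0 <= j < N) \sum_(0 <= m < M | m \in S j) ex (IK m (X j)) chi)).
  apply: eventually_sum => j r r0; exact: ((point_sum_ex chi cIK (hX j).1 (pS j)).2 _ r0).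
(* [Z] carries the operator of a block to the fine outcomes of that block. Outcomes in blocks beyond
   [N] receive 0, which is dominated as well. *)
move=> M; pose Z m := if [pick j : 'I_N | m \in S j] is Some j then X j else 0.
have dZ m : dominated (Z m) by rewrite /Z; case: pickP => [j _|_]; [exact: hX|exact: dominated0].
have ZE m : \sum_(j < N) (if m \in S j then ex (IK m (X j)) chi else 0) = ex (IK m (Z m)) chi.
  rewrite /Z; case: pickP => [j mj|mj].
    rewrite (bigD1 j) //= mj big1 ?addr0 // => i /negP ij; case: ifPn => // mi.
    case: ij; apply/eqP/val_inj; apply: (tS i j) => //; exists m.
    by split; [move: mi|move: mj]; rewrite inE.
  by rewrite (cp0 (cIK m)) op0 in0l big1 // => i _; rewrite mj.
under eq_bigr => j _ do rewrite big_mkcond.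
rewrite exchange_big /=; under eq_bigr => m _ do rewrite big_mkord ZE.
(* The first [M] pairs are enlarged to a square of side [L], at the cost of further nonnegative
   terms. Over the square, the inner sums are dominated operators by the bound for [K k], and the
   bound for [I] applies to them. *)
pose L := (\max_(m < M) maxn (e m).1 (e m).2).+1.
pose G (p : nat * nat) := ex (I p.1 (K p.1 p.2 (Z (g p)))) chi.
have -> : \sum_(0 <= m < M) ex (IK m (Z m)) chi = \sum_(p <- [seq e m | m <- index_iota 0 M]) G p.
  by rewrite big_map; apply: eq_bigr => m _; rewrite /G eK.
apply: (@le_trans _ _ (\sum_(p <- [seq (k, i) | k <- index_iota 0 L, i <- index_iota 0 L]) G p)).
  apply: sum_subseq_le.
  - by rewrite map_inj_uniq ?iota_uniq //; exact: can_inj eK.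
  - by apply: allpairs_uniq; rewrite ?iota_uniq // => -[? ?] [? ?].
  - move=> _ /mapP[m mM ->]; rewrite mem_index_iota in mM.
    have h : (maxn (e m).1 (e m).2 < L)%N.
      by rewrite ltnS; exact: (@leq_bigmax _ (fun m : 'I_M => maxn (e m).1 (e m).2) (Ordinal mM)).
    rewrite gtn_max in h; case/andP: h => h1 h2.
    by apply/allpairsP; exists (e m); rewrite !mem_index_iota h1 h2; split=> //; case: (e m).
  - move=> p; apply: posopRe; apply: (cp_pos (cI _)); apply: (cp_pos (cK _ _)); exact: (dZ _).1.
rewrite big_allpairs_dep.
apply: le_trans (_ : \sum_(0 <= k < L) ex (I k (\sum_(0 <= i < L) K k i (Z (g (k, i))))) chi <= _).
  apply: ler_sum => k _; rewrite (cp_sum (cI k)) op_sum in_suml Re_sum //.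
apply: (sI (fun k => \sum_(0 <= i < L) K k i (Z (g (k, i))))) => k.
have [iK sK] := one_way_dominated (oK k).
by apply: (@sum_dominatedP (K k) (fun i => Z (g (k, i)))).
Qed.

Lemma locc_le T chi : LOCC A T -> ex (T (rank1 phi phi)) chi <= V chi.
Proof.
move=> [n [I [oI lI iT]]].
have : instrument (I n) /\ sum_dominated (I n).
  elim: n lI {iT} => [|n IH] lI; first exact: one_way_dominated.
  have [|iI sI] := IH; first by move=> l ln; apply: lI; exact: ltnW.
  have lk := lI n (ltnSn n); split; last exact: linked_dominated lk.
  by have [K [_ [e _ [_ iJ _]]]] := lk.
move=> [iI sI]; have [_ pS _] := iT.
have [_ h] := point_sum_ex chi (instrument_cp iI) (posop_rank1 phi) pS.
apply: (le_eventually h) => m; rewrite (eq_bigl predT) => [|k]; last by rewrite in_setT.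
exact: (sI (fun=> rank1 phi phi) (fun=> dominated_rank1)).
Qed.

End bound.
End locc_bound.

(** * Instruments from finite protocols, and fidelity against norm *)

Section finite_protocols.
Context {R : realType} {H : hilbertType R}.
Implicit Types (u v psi phi : H) (x a b c : bop H) (A B C : set (bop H)).
Implicit Types (T Phi Psi : bop H -> bop H).
Local Notation "''[' u , v ]" := (inner u v).
Local Notation ex x u := (complex.Re '[x u, u]).

Definition Ad a x := adj a * x * a.

Lemma normal_mapP Phi : normal_map Phi <-> forall x omega, predual_functional omega ->
  (fun t => omega (Phi t) : R[i]^o) @ nbhs (x : weakstar H) --> (omega (Phi x) : R[i]^o).
Proof.
by split=> h x; apply/(weakstar_cvgP _ _ (nbhs_filter (x : weakstar H))); exact: h.
Qed.

Lemma normal_cp_Ad a : normal_cp (Ad a).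
Proof.
split=> [k x y||n x px xi].
- by rewrite /Ad mulrDr mulrDl mulZr mulZl.
- apply/normal_mapP => x omega po.
  have /normal_mapP h : normal_map (id : bop H -> bop H) by move=> ?; exact: cvg_id.
  exact: (h x _ (predual_mul a a po)).
- have := px (fun i => a (xi i)).
  under eq_bigr => i _ do under eq_bigr => j _ do rewrite -adjP'.
  by under [X in _ -> _ <= X]eq_bigr => i _ do under eq_bigr => j _ do rewrite mxE.
Qed.

Lemma normal_cpD Phi Psi : normal_cp Phi -> normal_cp Psi -> normal_cp (fun x => Phi x + Psi x).
Proof.
move=> [l1 /normal_mapP n1 c1] [l2 /normal_mapP n2 c2]; split=> [k x y||n x px xi].
- by rewrite l1 l2 scalerDr addrACA.
- apply/normal_mapP => x omega po.
  have oD y z : omega (y + z) = omega y + omega z.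
    by have := predual_linear po 1 y z; rewrite scale1r mul1r.
  rewrite oD; under eq_fun => y do rewrite oD.
  exact: (cvgD (n1 x _ po) (n2 x _ po)).
- have := addr_ge0 (c1 _ _ px xi) (c2 _ _ px xi); rewrite -big_split /=.
  under eq_bigr => i _.
    rewrite -big_split /=; under eq_bigr => j _ do rewrite !mxE -inDl -opD.
    over.
  by under [X in _ -> _ <= X]eq_bigr => i _ do under eq_bigr => j _ do rewrite mxE.
Qed.

Lemma normal_cp_sum (F : nat -> bop H -> bop H) n : (forall k, normal_cp (F k)) ->
  normal_cp (fun x => \sum_(0 <= k < n) F k x).
Proof.
move=> h; elim: n => [|n IH].
  rewrite (_ : (fun x => _) = Ad 0); first exact: normal_cp_Ad.
  by apply/funext => x; rewrite big_geq // /Ad mulr0.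
rewrite (_ : (fun x => _) = fun x => \sum_(0 <= k < n) F k x + F n x); first exact: normal_cpD.
by apply/funext => x; rewrite big_nat_recr.
Qed.

Lemma bimodule_Ad C a : commutant C a -> commutant C (adj a) -> bimodule_map C (Ad a).
Proof.
move=> ca ca' y z x Cy Cz; rewrite /Ad !mulrA -(ca' y Cy) -!mulrA; congr (_ * (_ * (_ * _))).
exact: ca.
Qed.

Lemma bimoduleD C Phi Psi : bimodule_map C Phi -> bimodule_map C Psi ->
  bimodule_map C (fun x => Phi x + Psi x).
Proof. by move=> h1 h2 y z x Cy Cz; rewrite h1 // h2 // mulrDr mulrDl. Qed.

(** Split [x = (1 - P) x + P x (1 - P) + P x P]. By Cauchy-Schwarz each of the first two terms
    contributes at most [sqrt d]; the last one differs from its target by at most [d <= sqrt d]. *)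
Lemma fidelity_norm T psi phi (d : R) : cp_map T -> T 1 = 1 -> q psi = 1 -> q phi = 1 ->
  0 < d -> d <= 1 -> 1 - d <= ex (T (rank1 phi phi)) psi ->
  (functional_norm (predual_map T (vector_functional psi) \- vector_functional phi)%R <=
    (3 * Num.sqrt d)%:E)%E.
Proof.
move=> cT T1 qpsi qphi d0 d1 hF; set P := rank1 phi phi.
have PP : P * P = P by rewrite /P mul_rank1 rank1E inq qphi scale1r.
have Pa : adj P = P by exact: adj_rank1.
have cs y z : cm '[T (adj y * z) psi, psi] <= ex (T (adj z * z)) psi * ex (T (adj y * y)) psi.
  have := @cp_cs _ _ T 1%N (fun=> z) (fun=> psi) y psi cT.
  by rewrite /cp_form !big_ord_recl !big_ord0 !addr0.
have T1x x : bnd 1 x -> ex (T (adj x * x)) psi <= 1.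
  move=> bx; have p1 : posop (1 - adj x * x).
    move=> u; rewrite opB op1 inBl opM adjP' !inq -rmorphB ler0c subr_ge0.
    by have := bx u; rewrite mul1r.
  have := posopRe (cp_pos cT p1) psi; rewrite (cpB cT) T1 opB op1 inBl ReD ReN -/(q psi) qpsi; lra.
have Qd : ex (T ((1 - P) * (1 - P))) psi <= d.
  rewrite mulrBr mulrBl mulr1 mul1r mulrBl PP mul1r subrr subr0.
  by rewrite (cpB cT) T1 opB op1 inBl ReD ReN -/(q psi) qpsi; lra.
have F1 : ex (T P) psi <= 1 by rewrite -PP -{1}Pa; apply: T1x; exact: proj_bnd.
apply: ge_ereal_sup => _ [x hx <-]; rewrite lee_fin.
have {}hx : bnd 1 x.
  move=> u; have := hx u; rewrite mul1r !q_norm lecR => h.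
  by move: (q_ge0 (x u)) (q_ge0 u) => ? ?; rewrite -ler_sqrt.
have hxa : bnd 1 (adj x) by exact: bnd_adj.
have nP : bnd 1 P by exact: proj_bnd.
pose w1 := '[T ((1 - P) * x) psi, psi]; pose w2 := '[T (P * x * (1 - P)) psi, psi].
pose w3 := '[x phi, phi] * ('[T P psi, psi] - 1).
have PxP : P * x * P = '[x phi, phi] *: P.
  apply: bop_ext => u; rewrite !opM opZ !rank1E !bZ inZl scalerA; congr (_ *: _); ring.
have -> : (predual_map T (vector_functional psi) \- vector_functional phi)%R x = w1 + w2 + w3.
  rewrite /predual_map /vector_functional /=.
  have xE : x = (1 - P) * x + P * x * (1 - P) + P * x * P.
    by rewrite mulrBl mul1r mulrBr mulr1 addrA subrK addrAC -addrA subrr addr0.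
  rewrite {1}xE PxP !(cpD cT) (cpZ cT) !opD opZ !inDl inZl /w1 /w2 /w3; ring.
have Qa : adj (1 - P) = 1 - P by rewrite adjB adj1 Pa.
have n1 : cm w1 <= d.
  apply: le_trans (_ : _ <= 1 * d) _; last by rewrite mul1r.
  rewrite /w1 -{1}Qa; apply: le_trans (cs _ _) _; rewrite Qa.
  apply: ler_pM => //; [exact: posopRe (cp_pos_mul cT x) _| |exact: T1x].
  by apply: posopRe; rewrite -{1}Qa; exact: cp_pos_mul.
have n2 : cm w2 <= d.
  apply: le_trans (_ : _ <= d * 1) _; last by rewrite mulr1.
  rewrite /w2 (_ : P * x = adj (adj x * P)); last by rewrite adjM adjK Pa.
  apply: le_trans (cs _ _) _; rewrite Qa.
  have b2 : bnd 1 (adj x * P) by have := bndM ler01 hxa nP; rewrite mul1r.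
  apply: ler_pM => //; [|exact: posopRe (cp_pos_mul cT _) _|exact: T1x].
  by apply: posopRe; rewrite -{1}Qa; exact: cp_pos_mul.
have n3 : cm w3 <= d.
  have PT : posop (T P) by rewrite -PP -{1}Pa; exact: cp_pos_mul.
  have h1 : cm '[x phi, phi] <= 1.
    by apply: le_trans (cauchy_schwarz _ _) _; have := hx phi; rewrite qphi !mulr1.
  rewrite /w3 cmM (Re_ge0 (PT psi)) -(rmorph1 (real_complex R)) -rmorphB cm_real.
  have h2 := cm_ge0 '[x phi, phi].
  apply: le_trans (ler_wpM2r (sqr_ge0 _) h1) _; rewrite mul1r.
  move: hF F1; rewrite -/P; set f := complex.Re _; nra.
have nn w : cm w <= d -> `|w| <= (Num.sqrt d)%:C.
  by move=> h; rewrite norm_cm lecR; exact: ler_wsqrtr.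
have : `|w1 + w2 + w3| <= (3 * Num.sqrt d)%:C.
  apply: le_trans (ler_normD _ _) _; rewrite (_ : 3 * _ = Num.sqrt d + Num.sqrt d + Num.sqrt d); last ring.
  rewrite !rmorphD; apply: lerD; last exact: nn.
  by apply: le_trans (ler_normD _ _) _; apply: lerD; exact: nn.
by rewrite norm_cm lecR.
Qed.

End finite_protocols.

Section converse.
Context {R : realType} {H : hilbertType R}.
Implicit Types (u v psi phi : H) (x y a b c : bop H) (A B C : set (bop H)).
Implicit Types (T Phi Psi : bop H -> bop H).
Local Notation "''[' u , v ]" := (inner u v).
Local Notation ex x u := (complex.Re '[x u, u]).

Lemma AdM a b x : Ad b (Ad a x) = Ad (a * b) x.
Proof. by rewrite /Ad adjM !mulrA. Qed.

Lemma ex_Ad_rank1 y phi psi : ex (Ad y (rank1 phi phi)) psi = cm '[y psi, phi].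
Proof. by rewrite /Ad !opM adjP' rank1E inZl [X in _ * X]inC mulJc. Qed.

Lemma commutant_sqrt A B x : cpair A B -> A x -> posop x -> exists2 r, A r & adj r * r = x.
Proof.
move=> [sA sB eA eB] Ax px; have [r [pr rr cr]] := sqrt_ex px.
exists r; last by rewrite (posop_sa pr).
rewrite -eB => y By; apply: cr.
by move: By; rewrite -eA => /(_ _ Ax).
Qed.

(** The measurement is completed by [r], a root of the defect, with trivial correction, and each
    contraction [b k] by a root [c k] of its own defect. The added terms can only raise the
    fidelity. Since [A] and [B] commute, [Phi k] and [Psi k] compose in either order, which later
    serves both the right and the left instruments. *)
Lemma protocol_instrument A B s : cpair A B -> protocol A B s ->
  exists (Phi Psi I : nat -> bop H -> bop H) T,
  [/\ forall k, [/\ UCP A (Phi k), CP B (Psi k), I k = Phi k \o Psi k & I k = Psi k \o Phi k],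
      instrument_with_sum I T &
      forall phi psi, score phi s psi <= ex (T (rank1 phi phi)) psi].
Proof.
move=> AB [hs cs]; have BA := cpair_sym AB; have [sA sB eA eB] := AB.
have As : A (1 - \sum_(x <- s) adj x.1 * x.1).
  apply: (cpairB AB); first exact: (cpair1 AB).
  rewrite big_seq; elim/big_rec: _ => [|x y /hs[Ax _ _] Ay]; first exact: (cpair0 AB).
  by apply: (cpairD AB) => //; apply: (cpairM AB) => //; exact: (cpair_adj AB).
have [|r Ar rE] := commutant_sqrt AB As.
  move=> u; rewrite opB op1 op_sum inBl in_suml.
  under eq_bigr => x _ do rewrite opM adjP' inq.
  by rewrite inq -rmorph_sum -rmorphB /= ler0c subr_ge0; exact: cs.
(* Beyond the list the default [(0, 1)] gives zero maps [I k], while [b k = 1] remains a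
   contraction, so [Phi k] is still unital. *)
pose s' := rcons s (r, 1); pose m := size s'.
pose a k := (nth (0, 1) s' k).1; pose b k := (nth (0, 1) s' k).2.
have sP k : [/\ A (a k), B (b k) & bnd 1 (b k)].
  have [km|km] := ltnP k m; last first.
    rewrite /a /b nth_default //=.
    by split; [exact: (cpair0 AB)|exact: (cpair1 BA)|exact: bnd1].
  have := mem_nth (0, 1) km; rewrite {1}/s' mem_rcons inE /a /b => /orP[/eqP ->|/hs //].
  by split=> //; [exact: (cpair1 BA)|exact: bnd1].
have a0 k : (m <= k)%N -> a k = 0 by move=> km; rewrite /a nth_default.
have sum_a : \sum_(0 <= k < m) adj (a k) * a k = 1.
  by rewrite -(big_nth (0, 1) predT (fun x : bop H * bop H => adj x.1 * x.1)) big_rcons /= rE addrC subrK.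
have cex k : exists2 c, B c & adj c * c = 1 - adj (b k) * b k.
  have [_ Bb bb] := sP k; apply: (commutant_sqrt BA).
    apply: (cpairB BA); first exact: (cpair1 BA).
    by apply: (cpairM BA) => //; exact: (cpair_adj BA).
  move=> u; rewrite opB op1 inBl opM adjP' !inq -rmorphB ler0c subr_ge0.
  by have := bb u; rewrite mul1r.
pose c k := sval (cid2 (cex k)).
have Bc k : B (c k) by rewrite /c; case: cid2.
have cE k : adj (c k) * c k = 1 - adj (b k) * b k by rewrite /c; case: cid2.
have Aa k : A (a k) by case: (sP k).
have Bb k : B (b k) by case: (sP k).
pose I k x := Ad (a k * b k) x + Ad (a k * c k) x.
have nI k : normal_cp (I k) by apply: normal_cpD; exact: normal_cp_Ad.
have bimA x : B x -> bimodule_map A (Ad x).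
  by move=> Bx; apply: bimodule_Ad; rewrite eA //; exact: (cpair_adj BA).
have bimB x : A x -> bimodule_map B (Ad x).
  by move=> Ax; apply: bimodule_Ad; rewrite eB //; exact: (cpair_adj AB).
have Ad1 x y : A x -> B y -> Ad (x * y) 1 = adj x * x * (adj y * y).
  move=> Ax By; rewrite /Ad mulr1 adjM.
  have Axx : A (adj x * x) by apply: (cpairM AB) => //; exact: (cpair_adj AB).
  by rewrite mulrA -[adj y * _ * _]mulrA -(cpairC AB Axx (cpair_adj BA By)) mulrA.
exists (fun k x => Ad (b k) x + Ad (c k) x).
exists (fun k => Ad (a k)).
exists I.
exists (fun x => \sum_(0 <= k < m) I k x).
split.
- move=> k; split.
  + split; last by apply: bimoduleD; exact: bimA.
    split; first by apply: normal_cpD; exact: normal_cp_Ad.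
    by rewrite /Ad !mulr1 cE addrC subrK.
  + by split; [exact: normal_cp_Ad|exact: bimB].
  + by apply/funext => x /=; rewrite !AdM.
  + apply/funext => x /=; rewrite /I (cpairC AB (Aa k) (Bb k)) (cpairC AB (Aa k) (Bc k)) -!AdM.
    by rewrite /Ad mulrDr mulrDl.
- split=> // [x|].
    apply: cvg_near_cst; exists m => // n /= mn.
    rewrite (eq_bigl predT) => [|k]; last by rewrite in_setT.
    have z : \sum_(m <= k < n) I k x = 0.
      rewrite big_nat_cond big1 // => k; rewrite andbT => /andP[/a0 ak _].
      by rewrite /I ak /Ad !mul0r !mulr0 addr0.
    by rewrite (big_cat_nat _ mn) //= z addr0.
  split; first exact: normal_cp_sum.
  rewrite -[RHS]sum_a; apply: eq_bigr => k _.
  by rewrite /I !Ad1 // -mulrDr cE addrC subrK mulr1.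
- move=> phi psi; rewrite op_sum in_suml Re_sum.
  have -> : score phi s psi = \sum_(x <- s) cm '[(x.1 * x.2) psi, phi].
    rewrite /score big_seq [RHS]big_seq; apply: eq_bigr => x /hs[Ax Bx _].
    by rewrite (cpairC AB Ax Bx) opM.
  apply: (@le_trans _ _ (\sum_(x <- s') cm '[(x.1 * x.2) psi, phi])).
    by rewrite /s' big_rcons /= lerDl cm_ge0.
  rewrite (big_nth (0, 1)); apply: ler_sum => k _.
  by rewrite /I opD inDl ReD !ex_Ad_rank1 lerDl cm_ge0.
Qed.

Lemma convertible_of_value A B (L : set (bop H -> bop H)) psi phi : cpair A B ->
  q psi = 1 -> q phi = 1 -> 1 <= value A B phi psi ->
  (forall (Phi Psi I : nat -> bop H -> bop H) T,
    (forall k, [/\ UCP A (Phi k), CP B (Psi k), I k = Phi k \o Psi k & I k = Psi k \o Phi k]) ->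
    instrument_with_sum I T -> L T) ->
  approx_convertible L psi phi.
Proof.
move=> AB qpsi qphi hV hL e e0.
(* Then [3 sqrt d <= 3 e / 4 < e]. *)
pose d := Num.min 1 ((e / 4) ^+ 2).
have e4 : 0 < e / 4 by lra.
have d0 : 0 < d by rewrite lt_min ltr01 exprn_gt0.
have [s ps hs] := value_approx A B phi psi d0.
have [Phi [Psi [I [T [h iT hT]]]]] := protocol_instrument AB ps.
exists T; first exact: hL h iT.
have [_ _ [nT T1]] := iT.
apply: le_lt_trans (fidelity_norm (normal_cp_map nT) T1 qpsi qphi d0 _ _) _.
- by rewrite ge_min lexx.
- have := hT phi psi; lra.
rewrite lte_fin; have : Num.sqrt d <= e / 4.
  rewrite -[leRHS](ger0_norm (ltW e4)) -sqrtr_sqr; apply: ler_wsqrtr.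
  by rewrite ge_min lexx orbT.
lra.
Qed.

(** The norm is tested on the contraction [rank1 phi phi], where the target state takes the value 1
    and the converted state the fidelity bounded by [locc_le]. *)
Lemma value_of_convertible A psi phi : separable_space H -> cpair A (commutant A) ->
  (forall t chi, column (commutant A) t ->
    \sum_(b <- t) value A (commutant A) phi (b chi) <= value A (commutant A) phi chi) ->
  q phi = 1 -> approx_convertible (LOCC A) psi phi -> 1 <= value A (commutant A) phi psi.
Proof.
move=> sH AB sw qphi h; apply: lim_eps => e e0; have [T LT hT] := h e e0.
have bP : forall xi, `|rank1 phi phi xi| <= `|xi|.
  move=> xi; rewrite !q_norm lecR; apply: ler_wsqrtr; rewrite rank1E qZ qphi mulr1.
  by have := cauchy_schwarz xi phi; rewrite qphi mulr1.
have : ((complex.Re `|(predual_map T (vector_functional psi) \- vector_functional phi)%R (rank1 phi phi)|)%:E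
    < e%:E)%E.
  by apply: le_lt_trans hT; apply: ereal_sup_ubound; exists (rank1 phi phi).
rewrite lte_fin norm_cm /= /predual_map /vector_functional /= rank1E inZl inq qphi mulr1 => h1.
have h2 := locc_le sH AB sw psi LT.
set z := _ - _ in h1; have : `|complex.Re z| <= Num.sqrt (cm z).
  by rewrite -sqrtr_sqr; apply: ler_wsqrtr; exact: Re_le_cm.
rewrite /z ReD ReN /= ler_norml => /andP[h3 _].
apply: le_trans (lerD h2 (lexx e)); lra.
Qed.

(** In a protocol [(a, b)] the [a] are seen as a measurement to be swapped for the pair [(B, A)]; in
    each branch the contraction [b] is then a one-term measurement of [B] with trivial
    correction. *)
Lemma value_sym_le A B psi phi : cpair A B ->
  (forall t chi, column A t -> \sum_(a <- t) value B A phi (a chi) <= value B A phi chi) ->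
  value A B phi psi <= value B A phi psi.
Proof.
move=> AB sw; apply: value_le => s [hs cs].
have ct : column A [seq x.1 | x : bop H * bop H <- s].
  split=> [_ /mapP[x /hs[Ax _ _] ->] //|u]; by rewrite big_map; exact: cs.
apply: le_trans (sw _ psi ct); rewrite big_map /score big_seq [X in _ <= X]big_seq.
apply: ler_sum => x /hs[Ax Bx bx].
have := @value_ub _ _ B A phi [:: (x.2, 1)] (x.1 psi); rewrite /score big_seq1 op1; apply.
split=> [_ /[!inE] /eqP -> /=|u].
  by split=> //; [exact: (cpair1 AB)|exact: bnd1].
by rewrite big_seq1 /=; have := bx u; rewrite mul1r.
Qed.

End converse.
Close Scope complex_scope.
Close Scope classical_set_scope.

Theorem corollary4p12 (R : realType) (H : hilbertType R)
    (sepH : separable_space H) (A : set (bop H))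
    (factorA : is_factor A) (semifiniteA : is_semifinite A)
    (psi phi : H) (unit_psi : `|psi| = 1) (unit_phi : `|phi| = 1) :
  [<-> approx_convertible (LOCC A) psi phi;
       approx_convertible (LOCCr A) psi phi;
       approx_convertible (LOCCl A) psi phi].
Proof.
have q1 (u : H) : `|u| = 1 -> q u = 1.
  by move=> u1; rewrite /q inner_norm u1 expr1n.
have qpsi := q1 _ unit_psi; have qphi := q1 _ unit_phi.
have [AB sc] := factor_cpair factorA; have BA := cpair_sym AB.
have v0 : exists v : H, v != 0.
  exists psi; apply/eqP => psi0; move: unit_psi; rewrite psi0 normr0 => /eqP.
  by rewrite eq_sym oner_eq0.
have tr := factor_trace factorA semifiniteA v0.
have swAB t chi := @value_swap _ _ _ _ AB sc phi chi t tr.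
have value1 L : (L `<=` LOCC A)%classic -> approx_convertible L psi phi ->
    1 <= value A (commutant A) phi psi.
  move=> LA h; apply: (value_of_convertible sepH AB swAB qphi) => e /h[T /LA LT hT].
  by exists T.
have rA : (LOCCr A `<=` LOCC A)%classic.
  move=> T [I rI iT]; exists 0%N, (fun=> I); split=> //; by left.
tfae.
- move=> /(value1 _ (fun _ h => h)) hV; apply: (convertible_of_value AB qpsi qphi hV).
  move=> Phi Psi I T h iT; exists I => //; split; first by exists T.
  by move=> k; exists (Phi k), (Psi k); have [] := h k.
(* For left instruments the algebras exchange roles: trace data are symmetric, so measurements of
   [A] can be swapped too, and [value_sym_le] transfers the bound to the pair [(B, A)]. *)
- move=> /(value1 _ rA) hV.
  have scB : scalar_center (commutant A) A by move=> c Bc Ac; exact: sc.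
  have trB K : 1 < K -> exists2 xi : H, xi != 0 & trace_data (commutant A) A K xi.
    by move=> /tr[xi xi0 /trace_data_sym]; exists xi.
  have swBA t chi := @value_swap _ _ _ _ BA scB phi chi t trB.
  have hV' := le_trans hV (value_sym_le psi AB swBA).
  apply: (convertible_of_value BA qpsi qphi hV').
  move=> Phi Psi I T h iT; exists I => //; split; first by exists T.
  by move=> k; exists (Psi k), (Phi k); have [] := h k.
- move=> h e /h[T [I lI iT] hT]; exists T => //.
  by exists 0%N, (fun=> I); split=> //; right.
Qed.
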